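(* Let $X, X_1, X_2, \ldots$ be i.i.d. real random variables, $S_n=\sum_{k=1}^n X_k$ and $M_n=\max_{1\le k\le n}|S_k|$. For $a>-1$, $b>-1$ and a function $\psi:[1,\infty)\to(0,\infty)$ put $$J_{ab}(\psi)=\sum_{n=1}^{\infty}\frac{(\log n)^a(\log\log n)^b}{n}\exp\big(-1/\psi(n)^2\big).$$ For $0<\sigma<\infty$ consider the statement $$( * )\qquad \sum_{n=1}^{\infty}\frac{(\log n)^a(\log\log n)^b}{n}\,P\Big(M_n\le\sqrt{\sigma^2\pi^2 n/8}\;\psi(n)\Big)<\infty\ \text{ or }\ =\infty\quad\text{according as}\quad J_{ab}(\psi)<\infty\ \text{ or }\ =\infty.$$ (Direct part) Let $a>-1$ and $b>-1$. Suppose that $E X=0$, $E X^2=\sigma^2$ with $0<\sigma<\infty$, and $$E\big[X^2 I\{|X|\ge t\}\big]=O\big((\log\log t)^{-1}\big)\quad\text{as } t\to\infty.$$ Then $( * )$ holds for every eventually non-increasing $\psi:[1,\infty)\to(0,\infty)$. (Converse part) If there are some $a>-1$, $b>-1$ and $0<\sigma<\infty$ such that $( * )$ holds for every eventually non-increasing $\psi:[1,\infty)\to(0,\infty)$, then $E X=0$, $E X^2=\sigma^2$ and $$\liminf_{t\to\infty}\,(\log\log t)\,E\big[X^2 I\{|X|\ge t\}\big]<\infty.$$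
   Context: Conventions: $\log x=\ln(x\vee e)$ (so $\log x\ge 1$), $\log\log x=\log(\log x)$. $I\{\cdot\}$ denotes an indicator. ''Eventually non-increasing'' means non-increasing on $[x_0,\infty)$ for some $x_0$. *)

(* Defs.v *)
From HB Require Import structures.
From mathcomp Require Import all_boot all_order all_algebra.
From mathcomp Require Import all_classical all_reals all_analysis.

Set Implicit Arguments.
Unset Strict Implicit.
Unset Printing Implicit Defensive.

Import Order.TTheory GRing.Theory Num.Theory.
Import numFieldNormedType.Exports.

Local Open Scope classical_set_scope.
Local Open Scope ring_scope.

(* The truncated logarithm ln (x \/ e), which is at least 1 everywhere. *)
Definition logt (R : realType) (x : R) : R := ln (Num.max x (expR 1)).

Definition loglogt (R : realType) (x : R) : R := logt (logt x).

Definition independent_seq (d : measure_display) (T : measurableType d)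
    (R : realType) (P : probability T R) (X : nat -> {RV P >-> R}) : Prop :=
  forall (s : seq nat) (A : nat -> set R),
    uniq s -> (forall i, measurable (A i)) ->
    P (\bigcap_(i in [set` s]) (X i @^-1` A i))
      = (\prod_(i <- s) P (X i @^-1` A i))%E.

Definition identically_distributed (d : measure_display) (T : measurableType d)
    (R : realType) (P : probability T R) (X : nat -> {RV P >-> R}) : Prop :=
  forall (i j : nat) (A : set R), measurable A ->
    distribution P (X i) A = distribution P (X j) A.

Definition iid (d : measure_display) (T : measurableType d)
    (R : realType) (P : probability T R) (X : nat -> {RV P >-> R}) : Prop :=
  independent_seq X /\ identically_distributed X.

(* The generic copy "X" of the i.i.d. sequence is [X 0]; the partial sums start
   at [X 1]. *)
Definition partial_sum (d : measure_display) (T : measurableType d)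
    (R : realType) (P : probability T R) (X : nat -> {RV P >-> R})
    (n : nat) (w : T) : R :=
  \sum_(1 <= k < n.+1) X k w.

(* The default value 0 of the iterated maximum is harmless: the terms are
   nonnegative, and only n >= 1 is used. *)
Definition max_abs_sum (d : measure_display) (T : measurableType d)
    (R : realType) (P : probability T R) (X : nat -> {RV P >-> R})
    (n : nat) (w : T) : R :=
  \big[Num.max/0]_(1 <= k < n.+1) `|partial_sum X k w|.

Definition trunc_moment2 (d : measure_display) (T : measurableType d)
    (R : realType) (P : probability T R) (Y : {RV P >-> R}) (t : R) : \bar R :=
  'E_P[(fun w => Y w ^+ 2 * \1_[set w' | t <= `|Y w'|] w)%R]%E.

Definition weight (R : realType) (a b : R) (n : nat) : R :=
  logt n%:R `^ a * loglogt n%:R `^ b / n%:R.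

Definition J (R : realType) (a b : R) (psi : R -> R) : \bar R :=
  (\sum_(1 <= n <oo) (weight a b n * expR (- (1 / psi n%:R ^+ 2)))%:E)%E.

Definition small_ball_series (d : measure_display) (T : measurableType d)
    (R : realType) (P : probability T R) (X : nat -> {RV P >-> R})
    (sigma a b : R) (psi : R -> R) : \bar R :=
  (\sum_(1 <= n <oo) (weight a b n)%:E *
     P [set w | (max_abs_sum X n w <=
        Num.sqrt (sigma ^+ 2 * pi ^+ 2 * n%:R / 8) * psi n%:R)%R])%E.

(* psi : [1, oo) -> (0, oo) is represented by a total function of which only
   the values on [1, oo) matter. *)
Definition positive_on_ge1 (R : realType) (psi : R -> R) : Prop :=
  forall x, 1 <= x -> 0 < psi x.

Definition eventually_nonincreasing (R : realType) (psi : R -> R) : Prop :=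
  exists2 x0 : R, 1 <= x0 &
    forall x y, x0 <= x -> x <= y -> psi y <= psi x.

Definition integral_test (d : measure_display) (T : measurableType d)
    (R : realType) (P : probability T R) (X : nat -> {RV P >-> R})
    (sigma a b : R) (psi : R -> R) : Prop :=
  ((J a b psi < +oo)%E -> (small_ball_series X sigma a b psi < +oo)%E) /\
  (J a b psi = +oo%E -> small_ball_series X sigma a b psi = +oo%E).

(* Main.v *)
(** Small ball probabilities are estimated without an invariance principle, by
    applying the step operator of the walk killed on leaving [-r, r] to
    explicit test functions.  With theta close to pi / (2 r), a power of
    cos (theta s) slightly below 1 decreases by a factor
    1 - theta^2 s2 (1 - O(e)) / 2 at each step, and the paraboloid
    (pi / 2)^2 - (theta s)^2 bounds the time spent alive; this gives the upper
    bound.  The lower bound comes from cos + k cos^2 cut off at the zeros of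
    the cosine, the quadratic term compensating the loss due to the jumps of
    intermediate size.  With r^2 = sigma^2 pi^2 n psi^2 / 8 and jumps truncated
    at n^(1/4) both estimates are exp (- 1 / psi^2) up to constants, as long as
    E X^2 1{|X| >= t} = O (1 / loglog t) and 1 / psi^2 = O (loglog n).  Larger
    values of 1 / psi^2 contribute convergent series on both sides.

    Let B be the partial sums of the weights.  For the converse,
    1 / psi^2 = 1 + ln B makes J diverge, by Abel and Dini, while any relative
    gain in the exponent makes the series of probabilities converge; this
    excludes E X^2 = oo, E X <> 0 and E X^2 > sigma^2.  A step function psi,
    constant on sparse blocks, makes J converge, while the probabilities,
    larger than exp (- 1 / psi^2) by an arbitrary factor on blocks ]N, N^2],
    have a divergent series; this excludes E X^2 < sigma^2 and, E X^2 being
    sigma^2, a tail E X^2 1{|X| >= t} of larger order than 1 / loglog t. *)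
Require Import Defs.
From HB Require Import structures.
From mathcomp Require Import all_boot all_order all_algebra.
From mathcomp Require Import all_classical all_reals all_analysis.
From mathcomp Require Import measurable_realfun.
From mathcomp Require Import ring lra.

Set Implicit Arguments.
Unset Strict Implicit.
Unset Printing Implicit Defensive.

Import Order.TTheory GRing.Theory Num.Theory.
Import numFieldNormedType.Exports.

Local Open Scope classical_set_scope.
Local Open Scope ring_scope.

(** * The walk killed on leaving the ball *)

(** Everything has to hold up to a bounded factor although the exponent 1 / psi^2 may be of order
    loglog n. Relative errors in the exponent must then be O(1 / loglog n), the order of the tail
    itself, and no factor 1 / e may be lost when e is of that order. The delicate place is the
    boundary, where the cosine vanishes. In the upper bound a large jump z from a may cost about
    (tan a)^2 z^2; the strict concavity of the power 1 - 32 e yields a gain e (tan a)^2 z^2 on the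
    whole variance, which pays for it. Dividing by the minimum of the test function would lose a
    power of 1 / e; an exit time estimate over the last few steps avoids this. In the lower bound
    some losses do not vanish with the cosine, so no eigenvalue can pay for them there; cos^2 is
    convex near its zeros and gains k times the variance. The lower exponent involves the tails at
    two scales, n^(1/4) and the radius, and their difference has the wrong sign. The converse thus
    needs a range of scales on which the tail hardly decreases; a tail above 1 / loglog t has one,
    since loglog grows only linearly along N -> N^8. *)

Section restricted_law.
Context d (T : measurableType d) (R : realType) (P : probability T R).
Context d' (T' : measurableType d').
Variables (E : set T) (Z : T -> T').

(** The unnormalised law of [Z] on the event [E]. The two measurability proofs are arguments so that
    the measure structure can be attached to the term itself. *)
Definition restricted_law of measurable E & measurable_fun setT Z : set T' -> \bar R :=
  fun B => P (E `&` Z @^-1` B).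

Hypotheses (mE : measurable E) (mZ : measurable_fun setT Z).

Let law := restricted_law mE mZ.

Let mpre B : measurable B -> measurable (Z @^-1` B).
Proof. by move=> mB; rewrite -[X in measurable X]setTI; exact: mZ. Qed.

Let law0 : law set0 = 0%E.
Proof. by rewrite /law /restricted_law preimage_set0 setI0 measure0. Qed.

Let law_ge0 B : (0 <= law B)%E.
Proof. exact: measure_ge0. Qed.

Let law_sigma_additive : semi_sigma_additive law.
Proof.
move=> F mF tF mUF; rewrite /law /restricted_law preimage_bigcup setI_bigcupr.
apply: measure_semi_sigma_additive.
- by move=> n; apply: measurableI => //; exact: mpre.
- apply/trivIsetP => i j _ _ ij.
  have /trivIsetP/(_ i j I I ij) FF := tF.
  by rewrite setIACA setIid -preimage_setI FF preimage_set0 setI0.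
- by apply: bigcup_measurable => n _; apply: measurableI => //; exact: mpre.
Qed.

HB.instance Definition _ := isMeasure.Build _ _ _ law law0 law_ge0 law_sigma_additive.

Let law_fin : fin_num_fun law.
Proof.
move=> B mB; rewrite /law /restricted_law.
by apply: fin_num_measure; apply: measurableI => //; exact: mpre.
Qed.

HB.instance Definition _ := Measure_isFinite.Build _ _ _ law law_fin.

End restricted_law.

Section killed_walk.
Context d (T : measurableType d) (R : realType) (P : probability T R).
Variables (X : nat -> {RV P >-> R}) (r : R).

(* [r + 1] is a cemetery state. *)
Definition kill_step (z : R * R) : R :=
  if (`|z.1| <= r) && (`|z.1 + z.2| <= r) then z.1 + z.2 else r + 1.

Fixpoint killed (k : nat) (w : T) : R :=
  if k is k'.+1 then kill_step (killed k' w, X k w) else 0.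

Lemma max_abs_sumS k w : 0 <= r ->
  (max_abs_sum X k.+1 w <= r) = (max_abs_sum X k w <= r) && (`|partial_sum X k.+1 w| <= r).
Proof.
move=> r0.
have bigmax_all (s : seq nat) (F : nat -> R) :
    (\big[Num.max/0]_(i <- s) F i <= r) = all (fun i => F i <= r) s.
  by elim: s => [|i s IH]; rewrite ?big_nil ?r0// big_cons ge_max IH.
rewrite /max_abs_sum !bigmax_all /index_iota !subSS !subn0 -[in LHS](addn1 k).
by rewrite iotaD all_cat /= add1n andbT.
Qed.

Lemma killed_alive k w : 0 <= r ->
  (`|killed k w| <= r) = (max_abs_sum X k w <= r) /\
  (`|killed k w| <= r -> killed k w = partial_sum X k w).
Proof.
move=> r0; elim: k => [|k [IH1 IH2]] /=.
  by rewrite /max_abs_sum /partial_sum !big_geq// normr0 r0.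
rewrite max_abs_sumS// -IH1 /kill_step /=.
have [h|h] := boolP (`|killed k w| <= r) => /=; last first.
  by split => //; rewrite ger0_norm ?addr_ge0// gerDl ler10.
have -> : partial_sum X k.+1 w = killed k w + X k.+1 w.
  by rewrite IH2// /partial_sum big_nat_recr.
case: ifPn => h'.
  by split => //; rewrite h'.
by rewrite ger0_norm ?addr_ge0// gerDl ler10.
Qed.

Lemma measurable_kill_step : measurable_fun setT kill_step.
Proof.
have m1 : measurable_fun setT (fun z : R * R => `|z.1|).
  by apply: measurableT_comp => //; exact: measurable_fst.
have ms : measurable_fun setT (fun z : R * R => z.1 + z.2).
  by apply: measurable_funD; [exact: measurable_fst|exact: measurable_snd].
have m2 : measurable_fun setT (fun z : R * R => `|z.1 + z.2|).
  exact: measurableT_comp.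
apply: measurable_fun_ifT => //.
by apply: measurable_and; exact: measurable_fun_ler.
Qed.

Lemma measurable_killed k : measurable_fun setT (killed k).
Proof.
elim: k => [|k IH]; first exact: measurable_cst.
apply: (measurableT_comp measurable_kill_step).
by apply: measurable_fun_pair.
Qed.

Hypothesis indepX : independent_seq X.

Let future (s : seq nat) (C : nat -> set R) := \bigcap_(i in [set` s]) (X i @^-1` C i).

Let measurable_future s C : (forall i, measurable (C i)) -> measurable (future s C).
Proof.
move=> mC; apply: fin_bigcap_measurable; first exact: finite_seq.
by move=> i _; rewrite -[X in measurable X]setTI; exact: measurable_funP.
Qed.

(** Independence is given for events only, so it is carried through the recursion as a product
    formula. Keeping all finite families [s] of later increments makes the induction close, since
    one more step uses up [X k.+1]. The joint law of ([killed k], [X k.+1]) on the future event and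
    [c] times the unrestricted joint law agree on rectangles, hence on the preimage of [B] under
    [kill_step]. *)
Lemma killed_future k B s C : measurable B -> uniq s ->
  (forall i, i \in s -> (k < i)%N) -> (forall i, measurable (C i)) ->
  P (future s C `&` killed k @^-1` B)
    = (P (killed k @^-1` B) * \prod_(i <- s) P (X i @^-1` C i))%E.
Proof.
elim: k B s C => [|k IH] B s C mB us ks mC.
  rewrite /= preimage_cst; case: ifPn => _.
    by rewrite setIT probability_setT mul1e; exact: indepX.
  by rewrite setI0 measure0 mul0e.
have mF := measurable_future s mC.
have mZ : measurable_fun setT (fun w => (killed k w, X k.+1 w)).
  by apply: measurable_fun_pair => //; exact: measurable_killed.
pose m' : {measure set _ -> \bar R} := restricted_law P mF mZ.
pose m'0 : {measure set _ -> \bar R} := restricted_law P measurableT mZ.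
pose m1 : {finite_measure set _ -> \bar R} :=
  restricted_law P mF (measurable_killed k).
pose c : R := fine (\prod_(i <- s) P (X i @^-1` C i))%E.
have c0 : 0 <= c by apply: fine_ge0; apply: prode_ge0 => *; exact: measure_ge0.
have cE : c%:E = (\prod_(i <- s) P (X i @^-1` C i))%E.
  rewrite fineK//; apply: prode_fin_num => i _.
  by apply: fin_num_measure; rewrite -[X in measurable X]setTI; exact: measurable_funP.
have kn : k.+1 \notin s by apply/negP => /ks; rewrite ltnn.
have ks' i : i \in s -> (k < i)%N by move=> /ks /ltnW.
have rect0 A D : measurable A -> measurable D ->
    P (killed k @^-1` A `&` X k.+1 @^-1` D)
      = (P (killed k @^-1` A) * P (X k.+1 @^-1` D))%E.
  move=> mA mD; have := IH A [:: k.+1] (fun=> D) mA isT.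
  rewrite /future big_seq1 bigcap_seq big_seq1 setIC; apply=> //.
  by move=> i; rewrite inE => /eqP ->.
have rect A D : measurable A -> measurable D ->
    m' (A `*` D) = (m1 A * distribution P (X k.+1) D)%E.
  move=> mA mD; rewrite /m' /m1 /= /restricted_law.
  have -> : future s C `&` (fun w => (killed k w, X k.+1 w)) @^-1` (A `*` D) =
     future (k.+1 :: s) (fun i => if i == k.+1 then D else C i) `&` killed k @^-1` A.
    rewrite /future; apply/seteqP; split => w /=.
      move=> [h [hA hD]]; split => // i /=; rewrite inE => /orP[/eqP ->|iS].
        by rewrite eqxx.
      case: eqP => [ik|_]; first by rewrite ik (negPf kn) in iS.
      exact: h.
    move=> [h hA]; split.
      move=> i /= iS; have := h i; rewrite /= inE iS orbT => /(_ isT).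
      by case: eqP => [ik|//]; rewrite ik (negPf kn) in iS.
    by split => //; have := h k.+1; rewrite /= inE eqxx => /(_ isT).
  rewrite IH//=; last 3 first.
  - by rewrite kn.
  - by move=> i; rewrite inE => /orP[/eqP ->//|/ks'].
  - by move=> i; case: ifP.
  rewrite IH// big_cons eqxx /distribution /pushforward -muleA; congr (_ * _)%E.
  rewrite muleC; congr (_ * _)%E; rewrite !big_seq; apply: eq_bigr => i iS.
  by case: eqP => // ik; rewrite ik (negPf kn) in iS.
have rect' A D : measurable A -> measurable D ->
    mscale (NngNum c0) m'0 (A `*` D) = (m1 A * distribution P (X k.+1) D)%E.
  move=> mA mD; rewrite /mscale /= cE /m'0 /m1 /= /restricted_law setTI.
  rewrite (_ : _ @^-1` _ = killed k @^-1` A `&` X k.+1 @^-1` D)// rect0//.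
  by rewrite IH// muleA [X in (X * _)%E]muleC.
pose D := kill_step @^-1` B.
have mD : measurable D by rewrite -[X in measurable X]setTI; exact: measurable_kill_step.
have e1 := product_measure_unique rect mD.
have e2 := product_measure_unique rect' mD.
have e3 : m' D = (c%:E * m'0 D)%E by rewrite -e1 e2.
rewrite -cE muleC; have -> : P (killed k.+1 @^-1` B) = m'0 D; last exact: e3.
by rewrite /m'0 /= /restricted_law setTI.
Qed.

Lemma killed_indep k A D : measurable A -> measurable D ->
  P (killed k @^-1` A `&` X k.+1 @^-1` D)
      = (P (killed k @^-1` A) * P (X k.+1 @^-1` D))%E.
Proof.
move=> mA mD; have := @killed_future k A [:: k.+1] (fun=> D) mA isT.
rewrite /future big_seq1 bigcap_seq big_seq1 setIC; apply=> //.
by move=> i; rewrite inE => /eqP ->.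
Qed.

Hypothesis identX : identically_distributed X.

(** The Markov property: by [killed_indep] the joint law of state and increment is a product law, in
    which [X k.+1] may be replaced by [X 0]; Tonelli does the rest. *)
Lemma killed_stepE k (f : R -> \bar R) : measurable_fun setT f ->
  (forall y, 0 <= f y)%E ->
  (\int[P]_w f (killed k.+1 w) =
   \int[P]_w \int[P]_v f (kill_step (killed k w, X 0%N v)))%E.
Proof.
move=> mf f0.
have mk : measurable_fun setT (killed k : T -> R) := measurable_killed k.
pose V : {RV P >-> R} := HB.pack (killed k : T -> R) (isMeasurableFun.Build _ _ _ _ _ mk).
have mz : measurable_fun setT (fun w => (killed k w, X k.+1 w)).
  by apply: measurable_fun_pair => //.
pose Z : {RV P >-> (R * R)%type} := HB.pack (fun w => (killed k w, X k.+1 w))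
  (isMeasurableFun.Build _ _ _ _ _ mz).
have mg : measurable_fun setT (fun z => f (kill_step z)).
  exact: (measurableT_comp mf measurable_kill_step).
transitivity (\int[distribution P Z]_z f (kill_step z))%E.
  by rewrite ge0_integral_distribution.
transitivity (\int[(distribution P V \x distribution P (X 0%N))%E]_z f (kill_step z))%E.
  apply: eq_measure_integral => D mD _; apply/esym.
  apply: product_measure_unique => // A B mA mB.
  rewrite [LHS](_ : _ = P (killed k @^-1` A `&` X k.+1 @^-1` B))//.
  rewrite killed_indep//; congr (_ * _)%E; exact: identX.
rewrite fubini_tonelli1//= /fubini_F ge0_integral_distribution//=; last 2 first.
- exact: (measurable_fun_fubini_tonelli_F (m2 := distribution P (X 0%N)) _ mg).
- by move=> y; exact: integral_ge0.
apply: eq_integral => w _ /=.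
rewrite ge0_integral_distribution//=.
by apply: (measurableT_comp mg); exact: measurable_fun_pair.
Qed.

End killed_walk.

(** * Means over the surviving paths *)

Section killed_expectation.
Context d (T : measurableType d) (R : realType) (P : probability T R).
Variables (X : nat -> {RV P >-> R}) (r : R).
Hypotheses (r0 : 0 <= r) (hX : iid X).

Definition cutoff (f : R -> R) (s : R) : R := if `|s| <= r then f s else 0.

Definition kill_op (f : R -> R) (s : R) : \bar R :=
  (\int[P]_v (cutoff f (s + X 0%N v))%:E)%E.

(** By [killed_alive], the mean of f(S_k) on the event that the walk has stayed in [-r, r] up to
    time k. *)
Definition alive_mean (k : nat) (f : R -> R) : \bar R :=
  (\int[P]_w (cutoff f (killed X r k w))%:E)%E.

Lemma measurable_cutoff (f : R -> R) : measurable_fun setT f -> measurable_fun setT (cutoff f).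
Proof.
move=> mf; apply: measurable_fun_ifT => //.
by apply: measurable_fun_ler => //; exact: measurableT_comp.
Qed.

Let mcutk (f : R -> R) k : measurable_fun setT f ->
  measurable_fun setT (fun w => (cutoff f (killed X r k w))%:E).
Proof.
move=> /measurable_cutoff mf; apply/measurable_EFinP.
by apply: (measurableT_comp mf); exact: measurable_killed.
Qed.

Lemma cutoff_ge0 f s : (forall s, `|s| <= r -> 0 <= f s) -> 0 <= cutoff f s.
Proof. by move=> f0; rewrite /cutoff; case: ifPn => // /f0. Qed.

Lemma alive_mean0 f : alive_mean 0 f = (f 0)%:E.
Proof.
rewrite /alive_mean /= /cutoff normr0 r0 integral_cst//.
by rewrite -[RHS]mule1; congr (_ * _)%E; exact: probability_setT.
Qed.

Lemma alive_mean_mono k (f g : R -> R) :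
  measurable_fun setT f -> measurable_fun setT g ->
  (forall s, `|s| <= r -> 0 <= f s) ->
  (forall s, `|s| <= r -> f s <= g s) -> (alive_mean k f <= alive_mean k g)%E.
Proof.
move=> mf mg f0 fg; apply: ge0_le_integral => //; try exact: mcutk.
- by move=> w _; rewrite lee_fin; exact: cutoff_ge0.
- by move=> w _; rewrite lee_fin /cutoff; case: ifPn => // /fg.
Qed.

Lemma alive_meanZ k c (f : R -> R) : 0 <= c -> measurable_fun setT f ->
  (forall s, `|s| <= r -> 0 <= f s) ->
  alive_mean k (fun s => c * f s) = (c%:E * alive_mean k f)%E.
Proof.
move=> c0 mf f0; rewrite /alive_mean -ge0_integralZl_EFin//; last 2 first.
- by move=> w _; rewrite lee_fin; exact: cutoff_ge0.
- exact: mcutk.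
apply: eq_integral => w _; rewrite -EFinM /cutoff.
by case: ifPn => // _; rewrite mulr0.
Qed.

Lemma alive_meanD k (f g : R -> R) : measurable_fun setT f -> measurable_fun setT g ->
  (forall s, `|s| <= r -> 0 <= f s) -> (forall s, `|s| <= r -> 0 <= g s) ->
  alive_mean k (fun s => f s + g s) = (alive_mean k f + alive_mean k g)%E.
Proof.
move=> mf mg f0 g0; rewrite /alive_mean -ge0_integralD//; last 4 first.
- by move=> w _; rewrite lee_fin; exact: cutoff_ge0.
- exact: mcutk.
- by move=> w _; rewrite lee_fin; exact: cutoff_ge0.
- exact: mcutk.
apply: eq_integral => w _; rewrite -EFinD /cutoff.
by case: ifPn => // _; rewrite addr0.
Qed.

Lemma alive_meanS k (f : R -> R) : measurable_fun setT f -> (forall s, `|s| <= r -> 0 <= f s) ->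
  alive_mean k.+1 f =
    (\int[P]_w (if (`|killed X r k w| <= r)%R then kill_op f (killed X r k w) else 0))%E.
Proof.
move=> mf f0.
rewrite /alive_mean (@killed_stepE _ _ _ _ _ _ hX.1 hX.2 _ (fun y => (cutoff f y)%:E)); last 2 first.
- by apply/measurable_EFinP; exact: measurable_cutoff.
- by move=> y; rewrite lee_fin; exact: cutoff_ge0.
have cut_dead : cutoff f (r + 1) = 0.
  by rewrite /cutoff ger0_norm ?addr_ge0// gerDl ler10.
apply: eq_integral => w _; case: ifPn => h; last first.
  by rewrite integral0_eq// => v _; rewrite /kill_step /= (negPf h) cut_dead.
apply: eq_integral => v _; rewrite /kill_step /= h /=.
by case: ifPn => // h'; rewrite cut_dead /cutoff (negPf h').
Qed.

Let measurable_kill_op (f : R -> R) : measurable_fun setT f -> (forall s, `|s| <= r -> 0 <= f s) ->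
  measurable_fun setT (kill_op f).
Proof.
move=> mf f0.
have mg : measurable_fun setT (fun z : R * T => (cutoff f (z.1 + X 0%N z.2))%:E).
  apply/measurable_EFinP; apply: (measurableT_comp (measurable_cutoff mf)).
  by apply: measurable_funD => //; exact: measurableT_comp.
by apply: (measurable_fun_fubini_tonelli_F (m2 := P) _ mg) => z; rewrite lee_fin; exact: cutoff_ge0.
Qed.

Let measurable_kill_op_killed k (f : R -> R) :
  measurable_fun setT f -> (forall s, `|s| <= r -> 0 <= f s) ->
  measurable_fun setT
    (fun w => if `|killed X r k w| <= r then kill_op f (killed X r k w) else 0%E).
Proof.
move=> mf f0; have mk : measurable_fun setT (killed X r k) by exact: measurable_killed.
apply: measurable_fun_ifT => //.
- by apply: measurable_fun_ler => //; exact: measurableT_comp.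
- by apply: (measurableT_comp (measurable_kill_op mf f0)).
Qed.

Lemma alive_meanS_le k (f g : R -> R) :
  measurable_fun setT f -> measurable_fun setT g ->
  (forall s, `|s| <= r -> 0 <= f s) ->
  (forall s, `|s| <= r -> (kill_op f s <= (g s)%:E)%E) ->
  (alive_mean k.+1 f <= alive_mean k g)%E.
Proof.
move=> mf mg f0 fg; rewrite alive_meanS//; apply: ge0_le_integral => //.
- move=> w _; case: ifPn => // _; apply: integral_ge0 => v _.
  by rewrite lee_fin; exact: cutoff_ge0.
- exact: measurable_kill_op_killed.
- exact: mcutk.
- by move=> w _; rewrite /cutoff; case: ifPn => // h; exact: fg.
Qed.

Lemma alive_meanS_ge k (f g : R -> R) :
  measurable_fun setT f -> measurable_fun setT g ->
  (forall s, `|s| <= r -> 0 <= f s) -> (forall s, `|s| <= r -> 0 <= g s) ->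
  (forall s, `|s| <= r -> ((g s)%:E <= kill_op f s)%E) ->
  (alive_mean k g <= alive_mean k.+1 f)%E.
Proof.
move=> mf mg f0 g0 fg; rewrite alive_meanS//; apply: ge0_le_integral => //.
- by move=> w _; rewrite lee_fin; exact: cutoff_ge0.
- exact: mcutk.
- exact: measurable_kill_op_killed.
- by move=> w _; rewrite /cutoff; case: ifPn => // h; exact: fg.
Qed.

Lemma measurable_alive k : measurable [set w | max_abs_sum X k w <= r].
Proof.
have -> : [set w | max_abs_sum X k w <= r] = [set w | `|killed X r k w| <= r].
  by apply/seteqP; split => w /=; rewrite (killed_alive X k w r0).1.
rewrite -[X in measurable X]setTI.
apply: (@measurable_fun_le _ _ _ setT (fun w => `|killed X r k w|) (fun=> r)) => //.
by apply: measurableT_comp => //; exact: measurable_killed.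
Qed.

Lemma alive_mean1 k :
  alive_mean k (fun=> 1) = P [set w | max_abs_sum X k w <= r].
Proof.
rewrite -[in RHS](setIT [set w | _]) -integral_indic//; last exact: measurable_alive.
apply: eq_integral => w _; rewrite /cutoff indicE (killed_alive X k w r0).1.
by case: ifPn => h; [rewrite mem_set|rewrite memNset//=; exact/negP].
Qed.

Lemma alive_mean_le_power (f : R -> R) lam n :
  measurable_fun setT f -> (forall s, `|s| <= r -> 0 <= f s) -> 0 <= lam ->
  (forall s, `|s| <= r -> (kill_op f s <= (lam * f s)%:E)%E) ->
  (alive_mean n f <= (lam ^+ n * f 0)%:E)%E.
Proof.
move=> mf f0 l0 H; elim: n => [|n IH]; first by rewrite alive_mean0 mul1r.
have mlf : measurable_fun setT (fun s => lam * f s) by exact: measurable_funM.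
apply: (le_trans (alive_meanS_le n mf mlf f0 H)).
by rewrite alive_meanZ// exprS -mulrA EFinM; apply: lee_wpmul2l.
Qed.

Lemma alive_mean_ge_power (f : R -> R) lam n :
  measurable_fun setT f -> (forall s, `|s| <= r -> 0 <= f s) -> 0 <= lam ->
  (forall s, `|s| <= r -> ((lam * f s)%:E <= kill_op f s)%E) ->
  ((lam ^+ n * f 0)%:E <= alive_mean n f)%E.
Proof.
move=> mf f0 l0 H; elim: n => [|n IH]; first by rewrite alive_mean0 mul1r.
have mlf : measurable_fun setT (fun s => lam * f s) by exact: measurable_funM.
apply: (le_trans _ (alive_meanS_ge n mf mlf f0 _ H)); last first.
  by move=> s /f0 fs; exact: mulr_ge0.
by rewrite alive_meanZ// exprS -mulrA EFinM; apply: lee_wpmul2l.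
Qed.

Lemma alive_decr k m : (k <= m)%N ->
  (P [set w | (max_abs_sum X m w <= r)%R] <= P [set w | (max_abs_sum X k w <= r)%R])%E.
Proof.
elim: m => [|m IH]; first by rewrite leqn0 => /eqP ->.
rewrite leq_eqVlt => /orP[/eqP -> //|/IH]; apply: le_trans.
apply: le_measure; rewrite ?inE; try exact: measurable_alive.
by move=> w /=; rewrite max_abs_sumS// => /andP[].
Qed.

(* Summing the drift inequality bounds the expected time spent alive. *)
Lemma alive_exit (Q : R -> R) (c : R) k m :
  measurable_fun setT Q -> 0 <= c -> (forall s, `|s| <= r -> 0 <= Q s) ->
  (forall s, `|s| <= r -> (kill_op Q s <= (Q s - c)%:E)%E) ->
  ((m%:R * c)%:E * P [set w | (max_abs_sum X (k + m) w <= r)%R] <= alive_mean k Q)%E.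
Proof.
move=> mQ c0 Q0 H.
have mQc : measurable_fun setT (fun s => Q s - c) by exact: measurable_funB.
have Qc0 s : `|s| <= r -> 0 <= Q s - c.
  move=> sr; rewrite -lee_fin; apply: le_trans (H _ sr).
  by apply: integral_ge0 => v _; rewrite lee_fin; exact: cutoff_ge0.
elim: m k => [|m IH] k.
  rewrite mul0r mul0e; apply: integral_ge0 => w _.
  by rewrite lee_fin; exact: cutoff_ge0.
have -> : alive_mean k Q =
    (alive_mean k (fun s => (Q s - c)%R) + alive_mean k (fun=> c))%E.
  rewrite -alive_meanD//; apply: eq_integral => w _; congr (_%:E); rewrite /cutoff.
  by case: ifP => // _; rewrite subrK.
have -> : alive_mean k (fun=> c) = (c%:E * P [set w | (max_abs_sum X k w <= r)%R])%E.
  rewrite -alive_mean1 -alive_meanZ//; apply: eq_integral => w _.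
  by rewrite /cutoff mulr1.
have -> : (m.+1%:R * c)%:E = ((m%:R * c)%:E + c%:E)%E.
  by rewrite -EFinD -natr1 mulrDl mul1r.
rewrite ge0_muleDl ?lee_fin ?mulr_ge0//.
apply: leeD; last by apply: lee_wpmul2l => //; exact: alive_decr (leq_addr _ _).
rewrite addnS -addSn; apply: (le_trans (IH k.+1)).
exact: alive_meanS_le.
Qed.

End killed_expectation.

(** * Truncated second moments *)

Section quadratic_test.
Context d (T : measurableType d) (R : realType) (P : probability T R).
Variables (Y : {RV P >-> R}) (s2 : R).
Hypothesis m2 : ('E_P[(fun w => Y w ^+ 2)%R])%E = s2%:E.

Definition tail2 (t : R) : R := fine (trunc_moment2 Y t).

Definition tail_sqr (t x : R) : R := if t <= `|x| then x ^+ 2 else 0.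

Let mY : measurable_fun setT (Y : T -> R). Proof. exact: measurable_funP. Qed.

Let mY2 : measurable_fun setT (fun w => Y w ^+ 2).
Proof. exact: (measurable_funX 2 mY). Qed.

Lemma integrable_sqr : P.-integrable setT (fun w => (Y w ^+ 2)%:E).
Proof.
apply/integrableP; split; first exact/measurable_EFinP.
have -> : (\int[P]_w `|(Y w ^+ 2)%:E| = s2%:E)%E; last exact: ltry.
rewrite -m2 unlock; apply: eq_integral => w _.
by rewrite gee0_abs// lee_fin sqr_ge0.
Qed.

Lemma measurable_tail_sqr t : measurable_fun setT (tail_sqr t).
Proof.
apply: measurable_fun_ifT => //.
by apply: measurable_fun_ler => //; exact: measurableT_comp.
Qed.

Let mtail t : measurable_fun setT (fun w => tail_sqr t (Y w)).
Proof. exact: (measurableT_comp (measurable_tail_sqr t)). Qed.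

Lemma integrable_tail_sqr t : P.-integrable setT (fun w => (tail_sqr t (Y w))%:E).
Proof.
apply: (le_integrable _ _ _ integrable_sqr) => //; first exact/measurable_EFinP.
move=> w _; rewrite !abse_EFin lee_fin /tail_sqr; case: ifPn => // _.
by rewrite normr0.
Qed.

Lemma trunc_moment2E t : trunc_moment2 Y t = (\int[P]_w (tail_sqr t (Y w))%:E)%E.
Proof.
rewrite /trunc_moment2 unlock; apply: eq_integral => w _; congr (_%:E).
rewrite indicE /tail_sqr; case: ifPn => h.
  by rewrite mem_set// mulr1.
by rewrite memNset ?mulr0//; exact/negP.
Qed.

Lemma tail2E t : trunc_moment2 Y t = (tail2 t)%:E.
Proof.
by rewrite /tail2 trunc_moment2E fineK//; exact: integrable_fin_num (integrable_tail_sqr t).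
Qed.

Lemma tail2_ge0 t : 0 <= tail2 t.
Proof.
rewrite -lee_fin -tail2E trunc_moment2E; apply: integral_ge0 => w _.
by rewrite lee_fin /tail_sqr; case: ifP => // _; exact: sqr_ge0.
Qed.

Lemma tail2_anti t u : t <= u -> tail2 u <= tail2 t.
Proof.
move=> tu; rewrite -lee_fin -!tail2E !trunc_moment2E; apply: ge0_le_integral => //.
- by move=> w _; rewrite lee_fin /tail_sqr; case: ifP => // _; exact: sqr_ge0.
- exact/measurable_EFinP.
- exact/measurable_EFinP.
- move=> w _; rewrite lee_fin /tail_sqr; case: ifPn => h.
    by rewrite (le_trans tu h).
  by case: ifP => // _; exact: sqr_ge0.
Qed.

Lemma tail2_le t : tail2 t <= s2.
Proof.
rewrite -lee_fin -tail2E trunc_moment2E -m2 [in leRHS]unlock; apply: ge0_le_integral => //.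
- by move=> w _; rewrite lee_fin /tail_sqr; case: ifP => // _; exact: sqr_ge0.
- exact/measurable_EFinP.
- exact/measurable_EFinP.
- by move=> w _; rewrite lee_fin /tail_sqr; case: ifPn => // h; exact: sqr_ge0.
Qed.

Lemma integrable_Y : P.-integrable setT (fun w => (Y w)%:E).
Proof.
have i1 : P.-integrable setT (fun w => (1 + Y w ^+ 2)%:E).
  under eq_fun do rewrite EFinD; apply: integrableD => //; last exact: integrable_sqr.
  exact: finite_measure_integrable_cst.
apply: (le_integrable _ _ _ i1) => //; first exact/measurable_EFinP.
move=> w _; rewrite !abse_EFin lee_fin (@ger0_norm _ (1 + _)) ?addr_ge0 ?sqr_ge0//.
have := sqr_ge0 (`|Y w| - 1); rewrite -(real_normK (num_real (Y w))).
have := normr_ge0 (Y w); nra.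
Qed.

Hypothesis m1 : ('E_P[Y] = 0)%E.

(** The shape of all pointwise majorants and minorants used below: once the linear term is removed
    by the zero mean, its expectation depends only on the variance and on the tails at the levels
    [t] and [u]. *)
Definition quad (A B C D E t u x : R) : R :=
  A + B * x + C * x ^+ 2 + D * tail_sqr t x + E * tail_sqr u x.

Let quad_decomp A B C D E t u : (fun w => (quad A B C D E t u (Y w))%:E) =
  (fun w => (A%:E + B%:E * (Y w)%:E + C%:E * (Y w ^+ 2)%:E +
            D%:E * (tail_sqr t (Y w))%:E + E%:E * (tail_sqr u (Y w))%:E))%E.
Proof. by apply/funext => w; rewrite -!EFinM -!EFinD. Qed.

Lemma integrable_quad A B C D E t u :
  P.-integrable setT (fun w => (quad A B C D E t u (Y w))%:E).
Proof.
rewrite quad_decomp; repeat apply: integrableD => //.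
- exact: finite_measure_integrable_cst.
- by apply: integrableZl => //; exact: integrable_Y.
- by apply: integrableZl => //; exact: integrable_sqr.
- by apply: integrableZl => //; exact: integrable_tail_sqr.
- by apply: integrableZl => //; exact: integrable_tail_sqr.
Qed.

Lemma integral_quad A B C D E t u :
  (\int[P]_w (quad A B C D E t u (Y w))%:E =
   (A + C * s2 + D * tail2 t + E * tail2 u)%:E)%E.
Proof.
have iA : P.-integrable setT (fun=> A%:E) by exact: finite_measure_integrable_cst.
have iB : P.-integrable setT (fun w => B%:E * (Y w)%:E)%E.
  by apply: integrableZl => //; exact: integrable_Y.
have iC : P.-integrable setT (fun w => C%:E * (Y w ^+ 2)%:E)%E.
  by apply: integrableZl => //; exact: integrable_sqr.
have iD : P.-integrable setT (fun w => D%:E * (tail_sqr t (Y w))%:E)%E.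
  by apply: integrableZl => //; exact: integrable_tail_sqr.
have iE : P.-integrable setT (fun w => E%:E * (tail_sqr u (Y w))%:E)%E.
  by apply: integrableZl => //; exact: integrable_tail_sqr.
rewrite quad_decomp integralD//; last by do 3 apply: integrableD => //.
rewrite integralD//; last by do 2 apply: integrableD => //.
rewrite integralD//; last by apply: integrableD => //.
rewrite integralD// !integralZl//; try exact: integrable_tail_sqr; try exact: integrable_sqr; try exact: integrable_Y.
rewrite -!trunc_moment2E !tail2E.
have -> : (\int[P]_w (Y w ^+ 2)%:E = s2%:E)%E by rewrite -m2 unlock.
have -> : (\int[P]_w (Y w)%:E = 0)%E by rewrite -m1 unlock.
rewrite mule0 adde0 integral_cst//= (_ : (A%:E * _)%E = A%:E); last first.
  by rewrite -[RHS]mule1; congr (_ * _)%E; exact: probability_setT.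
by rewrite -!EFinM -!EFinD.
Qed.

Lemma integral_le_quad (f : R -> R) A B C D E t u : measurable_fun setT f ->
  (forall x, 0 <= f x) -> (forall x, f x <= quad A B C D E t u x) ->
  (\int[P]_w (f (Y w))%:E <= (A + C * s2 + D * tail2 t + E * tail2 u)%:E)%E.
Proof.
move=> mf f0 H; rewrite -(integral_quad A B); apply: ge0_le_integral => //.
- by move=> w _; rewrite lee_fin.
- exact/measurable_EFinP/(measurableT_comp mf).
- by have /integrableP[] := integrable_quad A B C D E t u.
- by move=> w _; rewrite lee_fin.
Qed.

Lemma integral_ge_quad (f : R -> R) A B C D E t u : measurable_fun setT f ->
  (forall x, 0 <= f x) -> (forall x, quad A B C D E t u x <= f x) ->
  ((A + C * s2 + D * tail2 t + E * tail2 u)%:E <= \int[P]_w (f (Y w))%:E)%E.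
Proof.
move=> mf f0 H; rewrite -(integral_quad A B) integralE.
have mq : measurable_fun setT (fun w => (quad A B C D E t u (Y w))%:E).
  by have /integrableP[] := integrable_quad A B C D E t u.
apply: (@le_trans _ _ (\int[P]_w (fun w => (quad A B C D E t u (Y w))%:E)^\+ w)%E).
  by rewrite geeDl// oppe_le0; apply: integral_ge0 => w _; exact: funeneg_ge0.
apply: ge0_le_integral => //.
- exact: measurable_funepos mq.
- exact/measurable_EFinP/(measurableT_comp mf).
- by move=> w _; rewrite [leLHS]funeposE ge_max !lee_fin H f0.
Qed.

End quadratic_test.

(** * Upper bound by a cosine test function *)

Section trig_bounds.
Context {R : realType}.
Implicit Types x y z a b p u : R.

Lemma le_of_derive (f df : R -> R) : (forall x, is_derive x 1 f (df x)) ->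
  (forall x, 0 <= x -> 0 <= df x) -> forall x, 0 <= x -> f 0 <= f x.
Proof.
move=> Df df0 x x0.
have cf : continuous f.
  by move=> y; apply: differentiable_continuous; apply/derivable1_diffP; have [] := Df y.
have [|c] := @MVT_segment R f df 0 x x0 (fun y _ => Df y).
  exact: continuous_subspaceT.
rewrite in_itv /= => /andP[c0 _] e.
by rewrite -subr_ge0 e subr0 mulr_ge0// df0.
Qed.

Lemma sin_le_id x : 0 <= x -> sin x <= x.
Proof.
move=> x0; rewrite -subr_ge0.
have := @le_of_derive (fun x => x - sin x) (fun x => 1 - cos x) _ _ x x0.
rewrite sin0 subrr; apply.
by move=> y _; rewrite subr_ge0 cos_le1.
Qed.

Lemma cos_ge_quad x : 1 - x ^+ 2 / 2 <= cos x.
Proof.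
wlog x0 : x / 0 <= x.
  move=> H; have [|/ltW x0] := leP 0 x; first exact: H.
  by rewrite -(cosN x) -(sqrrN x); apply: H; rewrite oppr_ge0.
rewrite -subr_ge0.
have := @le_of_derive (fun x => cos x - (1 - x ^+ 2 / 2)) (fun x => x - sin x) _ _ x x0.
have -> : cos 0 - (1 - 0 ^+ 2 / 2) = 0 :> R by rewrite cos0 expr0n /= mul0r; ring.
apply.
- by move=> y; apply: is_derive_eq; rewrite /GRing.scale /=; field.
- by move=> y y0; rewrite subr_ge0 sin_le_id.
Qed.

Lemma sin_ge_cubic x : 0 <= x -> x - x ^+ 3 / 6 <= sin x.
Proof.
move=> x0; rewrite -subr_ge0.
have := @le_of_derive (fun x => sin x - (x - x ^+ 3 / 6))
  (fun x => cos x - (1 - x ^+ 2 / 2)) _ _ x x0.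
have -> : sin 0 - (0 - 0 ^+ 3 / 6) = 0 :> R by rewrite sin0 expr0n /= mul0r; ring.
apply.
- by move=> y; apply: is_derive_eq; rewrite /GRing.scale /=; field.
- by move=> y y0; rewrite subr_ge0 cos_ge_quad.
Qed.

Lemma cos_le_quartic x : cos x <= 1 - x ^+ 2 / 2 + x ^+ 4 / 24.
Proof.
wlog x0 : x / 0 <= x.
  move=> H; have [|/ltW x0] := leP 0 x; first exact: H.
  have -> : x ^+ 4 = (- x) ^+ 4 by ring.
  by rewrite -(cosN x) -(sqrrN x); apply: H; rewrite oppr_ge0.
rewrite -subr_ge0.
have := @le_of_derive (fun x => 1 - x ^+ 2 / 2 + x ^+ 4 / 24 - cos x)
  (fun x => sin x - (x - x ^+ 3 / 6)) _ _ x x0.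
have -> : 1 - 0 ^+ 2 / 2 + 0 ^+ 4 / 24 - cos 0 = 0 :> R.
  by rewrite cos0 !expr0n /= !mul0r; ring.
apply.
- by move=> y; apply: is_derive_eq; rewrite /GRing.scale /=; field.
- by move=> y y0; rewrite subr_ge0 sin_ge_cubic.
Qed.

Lemma sin_sub_cubic x : `|x - sin x| <= `|x| ^+ 3 / 6.
Proof.
wlog x0 : x / 0 <= x.
  move=> H; have [|/ltW x0] := leP 0 x; first exact: H.
  have -> : x - sin x = - (- x - sin (- x)) by rewrite sinN; ring.
  by rewrite normrN -(normrN x) H// oppr_ge0.
rewrite !ger0_norm ?subr_ge0 ?sin_le_id//.
have := sin_ge_cubic x0; lra.
Qed.

Lemma normr_sin_le x : `|sin x| <= `|x|.
Proof.
wlog x0 : x / 0 <= x.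
  move=> H; have [|/ltW x0] := leP 0 x; first exact: H.
  by rewrite -normrN -sinN -(normrN x); apply: H; rewrite oppr_ge0.
rewrite (ger0_norm x0) ler_norml sin_le_id// andbT.
have [x1|x1] := leP x 1; last by have := sin_geN1 x; lra.
have : x ^+ 3 <= x.
  by rewrite exprS mulrC -[leRHS]mul1r ler_wpM2r// exprn_ile1.
have := sin_ge_cubic x0; lra.
Qed.

Lemma ler_sin_pihalf a b : - (pi / 2) <= a -> a <= b -> b <= pi / 2 ->
  sin a <= sin b.
Proof.
move=> ha; rewrite le_eqVlt => /predU1P[-> //|ab] hb.
apply: ltW; rewrite ltr_sin// in_itv /=; apply/andP; split; lra.
Qed.

Lemma cos_le_tangent a b : - (pi / 2) <= a <= pi / 2 -> - (pi / 2) <= b <= pi / 2 ->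
  cos b <= cos a - sin a * (b - a).
Proof.
have cc A : {within A, continuous (@cos R)}.
  by apply: continuous_subspaceT; exact: continuous_cos.
move=> ha hb; have [ab|/ltW ba] := leP a b.
  have [//|c] := @MVT_segment R cos (fun x => - sin x) a b ab (fun y _ => is_derive_cos y).
  rewrite in_itv /= => /andP[ac cb] e.
  have : sin a <= sin c by apply: ler_sin_pihalf; lra.
  nra.
have [//|c] := @MVT_segment R cos (fun x => - sin x) b a ba (fun y _ => is_derive_cos y).
rewrite in_itv /= => /andP[bc ca] e.
have : sin c <= sin a by apply: ler_sin_pihalf; lra.
nra.
Qed.

Lemma ln_le_subr1 x : 0 < x -> ln x <= x - 1.
Proof.
move=> x0; have := @le_ln1Dx R (x - 1).
by rewrite (_ : 1 + (x - 1) = x); [apply; lra|ring].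
Qed.

(** The weighted inequality between geometric and arithmetic mean for [u] and 1 with weights p and 1
    - p, proved by bounding the logarithms of u / m and 1 / m, where m is the arithmetic mean. *)
Lemma powR_bernoulli u p : 0 <= u -> 0 < p <= 1 -> u `^ p <= 1 + p * (u - 1).
Proof.
rewrite le_eqVlt => /predU1P[<-|u0] /andP[p0 p1].
  by rewrite powR0 ?gt_eqF//; lra.
have m0 : 0 < 1 + p * (u - 1) by nra.
set m := 1 + _ in m0 *.
rewrite -ler_ln ?posrE ?powR_gt0// ln_powR.
have h1 : ln u - ln m <= u / m - 1.
  by rewrite -ln_div ?posrE//; apply: ln_le_subr1; exact: divr_gt0.
have h2 : - ln m <= m^-1 - 1.
  by rewrite -lnV ?posrE//; apply: ln_le_subr1; rewrite invr_gt0.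
have e : p * (u / m - 1) + (1 - p) * (m^-1 - 1) = 0.
  by rewrite /m; field; rewrite -/m gt_eqF.
have : p * (ln u - ln m) <= p * (u / m - 1) by rewrite ler_wpM2l// ltW.
have : (1 - p) * (- ln m) <= (1 - p) * (m^-1 - 1) by rewrite ler_wpM2l// subr_ge0.
lra.
Qed.

(* Interpolating between [sqrt u] and [u] gives the second order term. *)
Lemma powR_le_quad u p : 0 < u -> u <= 3 -> 2^-1 < p <= 1 ->
  u `^ p <= 1 + p * (u - 1) - (1 - p) * (u - 1) ^+ 2 / 8.
Proof.
move=> u0 u3 /andP[p2 p1].
have [w w0 wE] : exists2 w, 0 < w & w ^+ 2 = u.
  by exists (Num.sqrt u); rewrite ?sqrtr_gt0// sqr_sqrtr// ltW.
have -> : u `^ p = w * w `^ (2 * p - 1).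
  rewrite mulr_powRB1 ?ltW//; last by lra.
  by rewrite powRrM powR_mulrn ?ltW// wE.
have h : w `^ (2 * p - 1) <= 1 + (2 * p - 1) * (w - 1).
  by apply: powR_bernoulli; [exact: ltW|lra].
have {h} : w * w `^ (2 * p - 1) <= w * (1 + (2 * p - 1) * (w - 1)).
  by rewrite ler_wpM2l// ltW.
move=> /le_trans; apply.
have w2 : w <= 9 / 5.
  rewrite leNgt; apply/negP => w2.
  have : 0 < (w - 9 / 5) * (w + 9 / 5) by apply: mulr_gt0; lra.
  have -> : (w - 9 / 5) * (w + 9 / 5) = u - 81 / 25 by rewrite -wE; field.
  lra.
(* The interpolated bound falls short of 1 + p (u - 1) by exactly (1 - p) (w - 1)^2, and (u - 1)^2 /
   8 = (w - 1)^2 (w + 1)^2 / 8 is smaller because (w + 1)^2 <= 8. This is where u <= 3 enters. *)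
have : 0 <= (1 - p) * ((w - 1) ^+ 2 * (8 - (w + 1) ^+ 2)).
  apply: mulr_ge0; first by lra.
  apply: mulr_ge0; first exact: sqr_ge0.
  have : 0 <= (9 / 5 - w) * (w + 9 / 5 + 2) by apply: mulr_ge0; lra.
  have -> : (9 / 5 - w) * (w + 9 / 5 + 2) = (14 / 5) ^+ 2 - (w + 1) ^+ 2 by field.
  lra.
rewrite -wE; nra.
Qed.

End trig_bounds.

(** * Pointwise one-step inequalities for the cosine power and the paraboloid *)

Section upper_pointwise.
Context {R : realType}.
Implicit Types a y z e p s : R.

(** With y = tan a, [u] is the ratio cos (a + z) / cos a, and |y z| <= 2 e keeps it near 1. The
    constant 32 makes the second order term of [powR_le_quad] equal to 4 e (u - 1)^2; as (u - 1)^2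
    is about y^2 z^2 / 4 or more, this leaves the gain e y^2 z^2. *)
Lemma ratio_small e y z : 0 < e <= 128^-1 -> `|y| <= 2 / e -> `|z| <= e ^+ 2 ->
  let u := cos z - y * sin z in let p := 1 - 32 * e in
  0 < u /\ u `^ p <= 1 - p * y * z - (p / 2 - e + e * y ^+ 2) * z ^+ 2.
Proof.
move=> /andP[e0 e128] hy hz u p.
have yz : `|y| * `|z| <= 2 * e.
  have -> : 2 * e = 2 / e * e ^+ 2 by field; rewrite gt_eqF.
  exact: ler_pM.
have e2 : e ^+ 2 <= e / 128.
  by rewrite expr2 ler_wpM2l// ltW.
have z0 := normr_ge0 z; have y0 := normr_ge0 y.
have z1 : `|z| <= 128^-1 by lra.
have zz : z ^+ 2 = `|z| ^+ 2 by rewrite real_normK ?num_real.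
have yy : y ^+ 2 = `|y| ^+ 2 by rewrite real_normK ?num_real.
have z2e : `|z| ^+ 2 <= e / 128 by have : `|z| ^+ 2 <= `|z| * 1; [rewrite expr2 ler_wpM2l//; lra|lra].
have hs := normr_sin_le z.
have hs3 := sin_sub_cubic z.
have hc1 := cos_ge_quad z; have hc2 := cos_le_quartic z; have hc3 := cos_le1 z.
have ys : `|y * sin z| <= 2 * e.
  by rewrite normrM; apply: le_trans yz; exact: ler_wpM2l.
have /andP[ys1 ys2] : - (2 * e) <= y * sin z <= 2 * e by rewrite -ler_norml.
have u0 : 0 < u by rewrite /u; lra.
split=> //.
have u3 : u <= 3 by rewrite /u; lra.
have hp : 2^-1 < p <= 1 by rewrite /p; apply/andP; split; lra.
have := powR_le_quad u0 u3 hp.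
have -> : (1 - p) = 32 * e by rewrite /p; ring.
have ub : u - 1 <= - (y * z) - z ^+ 2 / 2 + z ^+ 4 / 24 + `|y| * `|z| ^+ 3 / 6.
  have : `|y * (z - sin z)| <= `|y| * (`|z| ^+ 3 / 6) by rewrite normrM; exact: ler_wpM2l.
  by rewrite ler_norml => /andP[_]; rewrite /u; lra.
have sq : y ^+ 2 * z ^+ 2 / 4 - z ^+ 4 / 4 <= (u - 1) ^+ 2.
  have h1 : z ^+ 2 / 2 <= sin z ^+ 2.
    have h2 : `|z| * (3 / 4) <= `|sin z|.
      have : `|z| <= `|z - sin z| + `|sin z|.
        by rewrite -{1}(subrK (sin z) z); exact: ler_normD.
      have : `|z| ^+ 3 <= `|z| * 1.
        by rewrite exprS; apply: ler_wpM2l => //; lra.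
      lra.
    have -> : sin z ^+ 2 = `|sin z| ^+ 2 by rewrite real_normK ?num_real.
    rewrite zz; nra.
  have h3 : (1 - cos z) ^+ 2 <= z ^+ 4 / 4.
    have -> : z ^+ 4 / 4 = (z ^+ 2 / 2) ^+ 2 by field.
    by rewrite ler_sqr ?nnegrE; [lra|lra|rewrite divr_ge0 ?sqr_ge0].
  have h4 : (y * sin z) ^+ 2 / 2 <= (u - 1) ^+ 2 + (1 - cos z) ^+ 2.
    have := sqr_ge0 ((u - 1) - (1 - cos z)); rewrite /u; nra.
  have h5 : y ^+ 2 * (z ^+ 2 / 2) <= (y * sin z) ^+ 2.
    by rewrite exprMn; apply: ler_wpM2l => //; exact: sqr_ge0.
  lra.
move=> /le_trans; apply.
have m1 : p * (u - 1) <= p * (- (y * z) - z ^+ 2 / 2 + z ^+ 4 / 24 + `|y| * `|z| ^+ 3 / 6).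
  by apply: ler_wpM2l => //; rewrite /p; lra.
have m2 : e * (y ^+ 2 * z ^+ 2 / 4 - z ^+ 4 / 4) <= e * (u - 1) ^+ 2.
  by apply: ler_wpM2l => //; exact: ltW.
have k1 : z ^+ 4 <= z ^+ 2 * (e / 128).
  have -> : z ^+ 4 = z ^+ 2 * z ^+ 2 by ring.
  by apply: ler_wpM2l; [exact: sqr_ge0|rewrite zz].
have k2 : `|y| * `|z| ^+ 3 <= z ^+ 2 * (2 * e).
  have -> : `|y| * `|z| ^+ 3 = z ^+ 2 * (`|y| * `|z|) by rewrite zz; ring.
  by apply: ler_wpM2l; first exact: sqr_ge0.
have k0 := sqr_ge0 z.
have z40 : 0 <= z ^+ 4.
  have -> : z ^+ 4 = (z ^+ 2) ^+ 2 by ring.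
  exact: sqr_ge0.
have k3 : p * (z ^+ 4 / 24 + `|y| * `|z| ^+ 3 / 6) <= z ^+ 4 / 24 + `|y| * `|z| ^+ 3 / 6.
  rewrite -[leRHS]mul1r; apply: ler_wpM2r; last by rewrite /p; lra.
  by apply: addr_ge0; apply: divr_ge0 => //; rewrite mulr_ge0 ?exprn_ge0.
have k4 : e * z ^+ 4 <= z ^+ 4.
  by rewrite -[leRHS]mul1r; apply: ler_wpM2r; lra.
have k5 : z ^+ 2 * e = e * z ^+ 2 by ring.
have -> : 1 - p * y * z - (p / 2 - e + e * y ^+ 2) * z ^+ 2 =
  1 - p * (y * z) - p * (z ^+ 2 / 2) + e * z ^+ 2 - e * (y ^+ 2 * z ^+ 2) by field.
move: m1 m2 k1 k2 k3 k4.
rewrite !mulrDr !mulrN !mulrA; lra.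
Qed.

Definition cos_pow (e s : R) : R := cos s `^ (1 - 32 * e).

(** Killing at distance [e] before the zero of the cosine bounds the tangent, so that jumps of size
    e^2 change the cosine by a factor close to 1. *)
Lemma alive_cos e a : 0 < e <= 128^-1 -> `|a| <= pi / 2 - e ->
  [/\ e / 2 <= cos a, - (pi / 2) <= a <= pi / 2 & `|tan a| <= 2 / e].
Proof.
move=> /andP[e0 e128] ha.
have /andP[a1 a2] : - (pi / 2 - e) <= a <= pi / 2 - e by rewrite -ler_norml.
have p1 := @pihalf_ge1 R; have a0 := normr_ge0 a.
have hc : e / 2 <= cos a.
  have h : sin e <= cos a.
    rewrite -cos_norm -[sin e]cosBpihalf -(cosN (e - _)) opprB.
    have [->//|ne] := eqVneq `|a| (pi / 2 - e).
    have lt : `|a| < pi / 2 - e by rewrite lt_neqAle ne.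
    by apply: ltW; rewrite ltr_cos ?in_itv//=; apply/andP; split; lra.
  have := @sin_ge_cubic R e (ltW e0).
  have : e ^+ 3 <= e * 1.
    by rewrite exprS; apply: ler_wpM2l; [exact: ltW|apply: exprn_ile1; lra].
  lra.
have c0 : 0 < cos a by lra.
split=> //; first by apply/andP; split; lra.
rewrite /tan normrM normfV (gtr0_norm c0) ler_pdivrMr//.
have : 1 <= 2 / e * cos a.
  rewrite [leLHS](_ : _ = 2 / e * (e / 2)); last by field; rewrite gt_eqF.
  by apply: ler_wpM2l => //; rewrite divr_ge0// ltW.
have := sin_max a; lra.
Qed.

(** For a large jump, concavity of the cosine and of the power gives the bound 1 - p y z, which may
    be negative when the walk is killed. Adding (p y z / 2)^2 turns it into the square (1 - p y z /
    2)^2; this explains the coefficient of the tail. *)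
Lemma upper_step e a z tau : 0 < e <= 128^-1 -> `|a| <= pi / 2 - e -> tau <= e ^+ 2 ->
  let p := 1 - 32 * e in let y := tan a in let q := p / 2 - e + e * y ^+ 2 in
  (if `|a + z| <= pi / 2 - e then cos_pow e (a + z) else 0) <=
  cos_pow e a * (1 - p * y * z - q * z ^+ 2 +
      (q + p ^+ 2 * y ^+ 2 / 4) * (if tau <= `|z| then z ^+ 2 else 0)).
Proof.
move=> he ha htau; lazy zeta.
set p := 1 - 32 * e; set y := tan a; set q := p / 2 - e + e * y ^+ 2.
have /andP[e0 e128] := he.
have [ca a12 ty] := alive_cos he ha.
have c0 : 0 < cos a by lra.
have F0 : 0 < cos_pow e a by exact: powR_gt0.
have hp : 0 < p <= 1 by rewrite /p; apply/andP; split; lra.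
have uE : cos (a + z) = cos a * (cos z - y * sin z).
  by rewrite cosD /y /tan; field; rewrite gt_eqF.
have Fu : 0 < cos z - y * sin z ->
    cos_pow e (a + z) = cos_pow e a * (cos z - y * sin z) `^ p.
  by move=> u0; rewrite /cos_pow uE powRM// ltW.
case: (boolP (tau <= `|z|)) => hz; last first.
  have hz' : `|z| <= e ^+ 2 by rewrite -ltNge in hz; lra.
  have [u0 hu] := ratio_small he ty hz'.
  have h : 0 < (cos z - y * sin z) `^ p by exact: powR_gt0.
  have hr : (cos z - y * sin z) `^ p <= 1 - p * y * z - q * z ^+ 2 + (q + p ^+ 2 * y ^+ 2 / 4) * 0.
    by rewrite mulr0 addr0.
  case: ifPn => _; first by rewrite Fu// ler_pM2l.
  by apply: mulr_ge0; [exact: ltW|lra].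
have -> : 1 - p * y * z - q * z ^+ 2 + (q + p ^+ 2 * y ^+ 2 / 4) * z ^+ 2 =
  1 - p * y * z + (p * y * z / 2) ^+ 2 by field.
case: ifPn => haz; last first.
  apply: mulr_ge0; first exact: ltW.
  have -> : 1 - p * y * z + (p * y * z / 2) ^+ 2 = (1 - p * y * z / 2) ^+ 2 by field.
  exact: sqr_ge0.
have [caz az12 _] := alive_cos he haz.
have u0 : 0 < cos z - y * sin z.
  by rewrite -(pmulr_rgt0 _ c0) -uE; lra.
rewrite Fu// ler_pM2l//.
apply: (@le_trans _ _ (1 + p * (cos z - y * sin z - 1))).
  by apply: powR_bernoulli => //; exact: ltW.
have ht : cos z - y * sin z - 1 <= - (y * z).
  rewrite -(ler_pM2l c0) mulrBr -uE mulr1.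
  have := cos_le_tangent a12 az12.
  have -> : cos a * - (y * z) = - (sin a * z) by rewrite /y /tan; field; rewrite gt_eqF.
  have -> : a + z - a = z by ring.
  lra.
have : p * (cos z - y * sin z - 1) <= p * - (y * z).
  by apply: ler_wpM2l => //; have /andP[/ltW] := hp.
have := sqr_ge0 (p * y * z / 2).
have -> : p * - (y * z) = - (p * y * z) by ring.
lra.
Qed.

Definition arch (s : R) : R := (pi / 2) ^+ 2 - s ^+ 2.

(** With b = pi / 2 - |a| <= 2, [arch a] is at most 4 b, whereas cos a = sin b >= b / 3, and the
    power only increases a number in [0, 1]; hence 12 = 4 * 3. *)
Lemma arch_le_cos e a : 0 < e <= 128^-1 -> `|a| <= pi / 2 - e ->
  e <= arch a /\ arch a <= 12 * cos_pow e a.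
Proof.
move=> he ha; have /andP[e0 e128] := he.
have p1 := @pihalf_ge1 R; have p2 := @pihalf_lt2 R.
have [ca _ _] := alive_cos he ha.
have QE : arch a = (pi / 2 - `|a|) * (pi / 2 + `|a|).
  by rewrite /arch -(real_normK (num_real a)); ring.
have a0 := normr_ge0 a.
split.
  rewrite QE -[leLHS]mulr1; apply: ler_pM => //; try lra.
have c1 : cos a <= cos_pow e a.
  by apply: ger1_powR; rewrite ?cos_le1 ?andbT; lra.
apply: (@le_trans _ _ (12 * cos a)); last by lra.
have -> : cos a = sin (pi / 2 - `|a|).
  by rewrite -cos_norm -cosBpihalf -[LHS]cosN; congr cos; ring.
set b := pi / 2 - `|a| in QE *.
have b0 : 0 <= b by rewrite /b; lra.
have := sin_ge_cubic b0.
have : b ^+ 3 <= b * 4.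
  rewrite exprS; apply: ler_wpM2l => //.
  have -> : 4 = 2 ^+ 2 :> R by ring.
  by rewrite ler_sqr ?nnegrE; rewrite /b; lra.
have : arch a <= b * 4 by rewrite QE; apply: ler_wpM2l => //; rewrite /b; lra.
lra.
Qed.

Lemma arch_step e a z tau : 0 < e <= 128^-1 -> `|a| <= pi / 2 - e -> tau <= e ->
  (if `|a + z| <= pi / 2 - e then arch (a + z) else 0) <=
  arch a - 2 * a * z - z ^+ 2 + (5 / e) * (if tau <= `|z| then z ^+ 2 else 0).
Proof.
move=> he ha htau; have /andP[e0 e128] := he.
have p1 := @pihalf_ge1 R; have p2 := @pihalf_lt2 R.
have [Q0 _] := arch_le_cos he ha.
have E : arch (a + z) = arch a - 2 * a * z - z ^+ 2 by rewrite /arch; ring.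
have z2 := sqr_ge0 z; have a0 := normr_ge0 a; have z0 := normr_ge0 z.
have e5 : 0 <= 5 / e by rewrite divr_ge0// ltW.
case: ifPn => haz.
  rewrite E lerDl mulr_ge0//; case: ifP => // _.
case: ifPn => hz.
  (* A large jump may kill the walk, so the bound has to be nonnegative: adding z^2 a^2 / arch a
     completes the square (arch a - a z)^2 / arch a. The constant 5 / e covers this term, at most 4
     / e, and the z^2 subtracted before. *)
  have k : a ^+ 2 <= 4 * (arch a / e).
    have : 1 <= arch a / e by rewrite ler_pdivlMr// mul1r.
    rewrite -(real_normK (num_real a)).
    have : `|a| ^+ 2 <= 2 ^+ 2 by rewrite ler_sqr ?nnegrE; lra.
    lra.
  have Qp : 0 < arch a by lra.
  have k2 : a ^+ 2 / arch a <= 4 / e.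
    by rewrite ler_pdivrMr// mulrAC -mulrA.
  have k3 : z ^+ 2 * (a ^+ 2 / arch a) <= z ^+ 2 * (4 / e) by apply: ler_wpM2l.
  have k4 : 0 <= arch a - 2 * a * z + z ^+ 2 * (a ^+ 2 / arch a).
    have -> : arch a - 2 * a * z + z ^+ 2 * (a ^+ 2 / arch a) = (arch a - a * z) ^+ 2 / arch a.
      by field; rewrite gt_eqF.
    by rewrite divr_ge0 ?sqr_ge0// ltW.
  have k5 : z ^+ 2 <= z ^+ 2 * e^-1.
    by rewrite ler_peMr// invf_ge1//; lra.
  have -> : 5 / e * z ^+ 2 = z ^+ 2 * (4 / e) + z ^+ 2 * e^-1 by ring.
  lra.
rewrite -ltNge in hz; rewrite mulr0 addr0 -E /arch subr_ge0 -(real_normK (num_real (a + z))).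
rewrite ler_sqr ?nnegrE//; last by lra.
have := ler_normD a z; lra.
Qed.

End upper_pointwise.

(** * Drift and survival probability: the upper bound *)

Section upper_bound.
Context d (T : measurableType d) (R : realType) (P : probability T R).
Variables (X : nat -> {RV P >-> R}) (s2 : R).
Hypotheses (hX : iid X) (s20 : 0 < s2).
Hypothesis m1 : ('E_P[X 0%N] = 0)%E.
Hypothesis m2 : ('E_P[(fun w => X 0%N w ^+ 2)%R])%E = s2%:E.
Variables (e r t : R).
Hypotheses (he : 0 < e <= 128^-1) (r0 : 0 < r) (t0 : 0 <= t).
Hypothesis small_jumps : 2 * t <= e ^+ 2 * r.
Hypothesis small_tail : tail2 (X 0%N) t <= e * s2 / 10.
Hypothesis large_r : 4 * s2 <= r ^+ 2.

(** [v] and [tl] are the variance and the tail of the rescaled jump th X, and [lam] is the decay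
    factor of one step. They are tied by equations, so that the arithmetic sees them as atoms;
    [small_ball_upper] instantiates them with [erefl]. *)
Variables th v tl lam : R.
Hypotheses (thE : th = (pi / 2 - e) / r) (vE : v = th ^+ 2 * s2).
Hypotheses (tlE : tl = th ^+ 2 * tail2 (X 0%N) t) (lamE : lam = 1 - v / 2 * (1 - 36 * e)).

Let b0 : 0 < pi / 2 - e.
Proof. by have := @pihalf_ge1 R; move/andP: he => []; lra. Qed.

Let th0 : 0 < th. Proof. by rewrite thE divr_gt0. Qed.

Let aliveE (s : R) : (`|s| <= r) = (`|th * s| <= pi / 2 - e).
Proof.
rewrite normrM (gtr0_norm th0) thE mulrAC ler_pdivrMr// ler_pM2l//.
Qed.

Let tauE : th * t <= e ^+ 2.
Proof.
rewrite thE mulrAC ler_pdivrMr//; apply: le_trans small_jumps.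
by rewrite ler_wpM2r//; have := @pihalf_lt2 R; move/andP: he => []; lra.
Qed.

Let tailE (x : R) : (if th * t <= `|th * x| then (th * x) ^+ 2 else 0) =
  th ^+ 2 * tail_sqr t x.
Proof.
rewrite normrM (gtr0_norm th0) ler_pM2l// /tail_sqr exprMn.
by case: ifP => // _; rewrite mulr0.
Qed.

Let mcos (a : R) : measurable_fun setT (fun s : R => cos_pow e (a * s)).
Proof.
apply: (measurableT_comp (measurable_powR _)).
apply: (@measurableT_comp _ _ _ _ _ _ (@cos R) _ (fun s => a * s)).
  by apply: continuous_measurable_fun; exact: continuous_cos.
exact: measurable_funM.
Qed.

Let march (a : R) : measurable_fun setT (fun s : R => arch (a * s)).
Proof.
apply: measurable_funB => //.
by apply: (@measurable_funX _ _ R _ (fun s : R => a * s) 2); exact: measurable_funM.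
Qed.

Let v0 : 0 < v. Proof. by rewrite vE mulr_gt0// exprn_gt0. Qed.

Let v1 : v <= 1.
Proof.
have hb := b0.
have h : th ^+ 2 * r ^+ 2 <= 4.
  rewrite -exprMn thE divfK ?gt_eqF//.
  have -> : 4 = 2 ^+ 2 :> R by ring.
  by rewrite ler_sqr ?nnegrE//; have := @pihalf_lt2 R; move/andP: he => []; lra.
have : th ^+ 2 * (4 * s2) <= th ^+ 2 * r ^+ 2 by rewrite ler_wpM2l// sqr_ge0.
rewrite vE; lra.
Qed.

Let tlv : tl <= e * v / 10.
Proof.
rewrite tlE vE (_ : e * _ / 10 = th ^+ 2 * (e * s2 / 10)); last by ring.
by rewrite ler_wpM2l// sqr_ge0.
Qed.

Let tl0 : 0 <= tl. Proof. by rewrite tlE mulr_ge0 ?sqr_ge0//; exact: (tail2_ge0 m2). Qed.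

Let cos_drift s : `|s| <= r ->
  (kill_op X r (fun s => cos_pow e (th * s)) s <= (lam * cos_pow e (th * s))%:E)%E.
Proof.
move=> hs; have /andP[e0 e128] := he.
set p := 1 - 32 * e; set y := tan (th * s); set q := p / 2 - e + e * y ^+ 2.
set c := cos_pow e (th * s).
have ha : `|th * s| <= pi / 2 - e by rewrite -aliveE.
have [ca _ _] := alive_cos he ha.
have c0 : 0 < c by apply: powR_gt0; lra.
have mf : measurable_fun setT (fun x => cutoff r (fun s => cos_pow e (th * s)) (s + x)).
  by apply: (measurableT_comp (measurable_cutoff r (mcos th))); exact: measurable_funD.
have f0 x : 0 <= cutoff r (fun s => cos_pow e (th * s)) (s + x).
  by apply: cutoff_ge0 => u _; exact: powR_ge0.
have H x : cutoff r (fun s => cos_pow e (th * s)) (s + x) <=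
    quad c (- (c * p * y * th)) (- (c * q * th ^+ 2))
      (c * (q + p ^+ 2 * y ^+ 2 / 4) * th ^+ 2) 0 t t x.
  have := upper_step (th * x) he ha tauE; lazy zeta.
  rewrite -/p -/y -/q -/c tailE -mulrDr -aliveE /cutoff => /le_trans; apply.
  by rewrite le_eqVlt; apply/orP; left; apply/eqP; rewrite /quad; ring.
apply: (le_trans (integral_le_quad m2 m1 mf f0 H)).
rewrite lee_fin mul0r addr0.
have -> : c + - (c * q * th ^+ 2) * s2 +
    c * (q + p ^+ 2 * y ^+ 2 / 4) * th ^+ 2 * tail2 (X 0%N) t =
    c * (1 - q * v + (q + p ^+ 2 * y ^+ 2 / 4) * tl) by rewrite vE tlE; ring.
rewrite mulrC; apply: ler_wpM2r; first exact: ltW.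
have y2 := sqr_ge0 y.
have k1 : p ^+ 2 * y ^+ 2 <= y ^+ 2.
  by rewrite -[leRHS]mul1r ler_wpM2r// exprn_ile1 /p; lra.
(* The unbounded terms in y^2: the loss (e + 1/4) tl due to the large jumps is covered by the gain e
   v from the concavity of the power. *)
have k2 : y ^+ 2 * ((e + 4^-1) * tl) <= y ^+ 2 * (e * v).
  apply: ler_wpM2l => //.
  have : (e + 4^-1) * tl <= 1 * tl by apply: ler_wpM2r => //; lra.
  have : 0 <= e * v by rewrite mulr_ge0// ltW.
  by have := tlv; have := tl0; lra.
have k3 : p ^+ 2 * y ^+ 2 * tl <= y ^+ 2 * tl by apply: ler_wpM2r.
have k4 : (p / 2 - e) * tl <= 1 * tl by apply: ler_wpM2r => //; rewrite /p; lra.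
have ev : 0 <= e * v by rewrite mulr_ge0// ltW.
have -> : lam = 1 - v / 2 + 18 * (e * v) by rewrite lamE; field.
have -> : 1 - q * v + (q + p ^+ 2 * y ^+ 2 / 4) * tl =
  1 - v / 2 + 17 * (e * v) - y ^+ 2 * (e * v) + (p / 2 - e) * tl + y ^+ 2 * (e * tl)
   + (p ^+ 2 * y ^+ 2 * tl) / 4 by rewrite /q /p; field.
have : y ^+ 2 * ((e + 4^-1) * tl) = y ^+ 2 * (e * tl) + (y ^+ 2 * tl) / 4 by field.
by have := tlv; have := tl0; lra.
Qed.

Let arch_drift s : `|s| <= r ->
  (kill_op X r (fun s => arch (th * s)) s <= (arch (th * s) - v / 2)%:E)%E.
Proof.
move=> hs; have /andP[e0 e128] := he.
have ha : `|th * s| <= pi / 2 - e by rewrite -aliveE.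
have mf : measurable_fun setT (fun x => cutoff r (fun s => arch (th * s)) (s + x)).
  by apply: (measurableT_comp (measurable_cutoff r (march th))); exact: measurable_funD.
have f0 x : 0 <= cutoff r (fun s => arch (th * s)) (s + x).
  apply: cutoff_ge0 => u; rewrite aliveE => hu; have [h _] := arch_le_cos he hu; lra.
have te : th * t <= e.
  by apply: (le_trans tauE); rewrite expr2 ler_piMr//; lra.
have H x : cutoff r (fun s => arch (th * s)) (s + x) <=
    quad (arch (th * s)) (- (2 * (th * s) * th)) (- th ^+ 2) (5 / e * th ^+ 2) 0 t t x.
  have := arch_step (th * x) he ha te.
  rewrite tailE -mulrDr -aliveE /cutoff => /le_trans; apply.
  by rewrite le_eqVlt; apply/orP; left; apply/eqP; rewrite /quad; ring.
apply: (le_trans (integral_le_quad m2 m1 mf f0 H)).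
rewrite lee_fin mul0r addr0.
have -> : arch (th * s) + - th ^+ 2 * s2 + 5 / e * th ^+ 2 * tail2 (X 0%N) t =
    arch (th * s) - v + 5 / e * tl by rewrite vE tlE; ring.
(* The denominator 10 in [small_tail] is chosen for this step: half of the drift [v] survives. *)
have : 5 / e * tl <= 5 / e * (e * v / 10).
  by apply: ler_wpM2l => //; rewrite divr_ge0// ltW.
have -> : 5 / e * (e * v / 10) = v / 2 by field; rewrite gt_eqF.
lra.
Qed.

Let lam0 : 0 <= lam.
Proof.
have /andP[e0 e128] := he; have h0 := v0; have h1 := v1.
have : v / 2 * (1 - 36 * e) <= 1 * 1 by apply: ler_pM; lra.
by rewrite lamE; lra.
Qed.

Let lam_le n : lam ^+ n <= expR (- (v / 2 * (1 - 36 * e) * n%:R)).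
Proof.
rewrite -mulNr expRM_natr; apply: lerXn2r; rewrite ?nnegrE ?expR_ge0 ?lam0//.
by rewrite lamE; exact: expR_ge1Dx.
Qed.

Let p_le1 n : (P [set w | (max_abs_sum X n w <= r)%R] <= 1)%E.
Proof. by apply: probability_le1; exact: measurable_alive (ltW r0) _. Qed.

(** The last m steps, with m v between 1 and 2, are spent on the exit time: m v / 2 >= 1/2 times the
    probability is at most the mean of [arch] at time n - m, hence at most 12 lam^(n - m). This
    gives 24, and restoring the m missing steps in the exponent costs the factor e. For n < m the
    bound exceeds 1. *)
Let upper_v n : (P [set w | (max_abs_sum X n w <= r)%R] <=
  (24 * expR 1 * expR (- (v / 2 * (1 - 36 * e) * n%:R)))%:E)%E.
Proof.
have /andP[e0 e128] := he; have h0 := v0; have h1 := v1.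
have r0' := ltW r0.
pose m := (Num.truncn v^-1).+1.
have mv : 1 <= m%:R * v.
  rewrite -ler_pdivrMr// mul1r; apply: ltW; exact: truncnS_gt.
have mv2 : m%:R * v <= 2.
  have : (Num.truncn v^-1)%:R * v <= 1.
    by rewrite -ler_pdivlMr// mul1r truncn_le invr_ge0 ltW.
  by rewrite /m -natr1 mulrDl mul1r; lra.
have [nm|mn] := ltnP n m.
  apply: (le_trans (p_le1 n)); rewrite lee_fin -mulrA -expRD.
  have h : 1 <= expR (1 + - (v / 2 * (1 - 36 * e) * n%:R)).
    rewrite -[leLHS]expR0 ler_expR.
    have : v / 2 * (1 - 36 * e) * n%:R <= v / 2 * 1 * m%:R.
      rewrite ler_pM//; [by rewrite mulr_ge0//; lra| |by rewrite ler_nat ltnW].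
      by rewrite ler_wpM2l//; lra.
    have -> : v / 2 * 1 * m%:R = m%:R * v / 2 by field.
    lra.
  lra.
have exit := @alive_exit _ _ _ _ X r r0' hX (fun s => arch (th * s)) (v / 2) (n - m) m
  (march th) _ _ arch_drift.
have mean := alive_mean_le_power r0' hX (n - m) (mcos th) _ lam0 cos_drift.
have hF s : `|s| <= r -> 0 <= cos_pow e (th * s) by move=> _; exact: powR_ge0.
have hQ s : `|s| <= r -> 0 <= arch (th * s).
  by rewrite aliveE => hu; have [h _] := arch_le_cos he hu; lra.
have comp : (alive_mean X r (n - m) (fun s => arch (th * s)) <=
    12%:E * alive_mean X r (n - m) (fun s => cos_pow e (th * s)))%E.
  rewrite -alive_meanZ//; apply: alive_mean_mono => //.
    exact: measurable_funM.
  by move=> s; rewrite aliveE => hu; have [_ h] := arch_le_cos he hu.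
have {}exit := exit _ hQ; rewrite subnK// in exit.
have vv : 0 <= v / 2 by rewrite divr_ge0// ltW.
have {}exit := exit vv.
have {}mean := mean hF.
rewrite mulr0 /cos_pow cos0 powR1 mulr1 in mean.
have hp : P [set w | (max_abs_sum X n w <= r)%R] \is a fin_num.
  by apply: fin_num_measure; exact: measurable_alive.
move: exit; rewrite -(fineK hp).
set pn := fine _ => exit.
have e1 : (m%:R * (v / 2)) * pn <= 12 * lam ^+ (n - m).
  rewrite -lee_fin EFinM; apply: (le_trans exit); apply: (le_trans comp).
  by rewrite [in leRHS]EFinM; apply: lee_wpmul2l.
rewrite lee_fin.
have pn0 : 0 <= pn by exact: fine_ge0.
have e2 : pn <= 24 * lam ^+ (n - m).
  have : 2^-1 * pn <= (m%:R * (v / 2)) * pn by apply: ler_wpM2r => //; lra.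
  lra.
apply: (le_trans e2); rewrite -mulrA ler_pM2l//; apply: (le_trans (lam_le _)).
rewrite -expRD ler_expR natrB// mulrBr.
have : v / 2 * (1 - 36 * e) * m%:R <= v / 2 * 1 * m%:R.
  by rewrite ler_wpM2r// ler_wpM2l//; lra.
have -> : v / 2 * 1 * m%:R = m%:R * v / 2 by field.
lra.
Qed.

Lemma small_ball_upper_aux n : (P [set w | (max_abs_sum X n w <= r)%R] <=
  (24 * expR 1 * expR (- (pi ^+ 2 * s2 * n%:R / (8 * r ^+ 2) * (1 - 40 * e))))%:E)%E.
Proof.
apply: (le_trans (upper_v n)); rewrite lee_fin ler_pM2l; last first.
  by rewrite mulr_gt0 ?expR_gt0.
have /andP[e0 e128] := he.
rewrite ler_expR lerN2.
have p1 := @pihalf_ge1 R.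
have -> : pi ^+ 2 * s2 * n%:R / (8 * r ^+ 2) * (1 - 40 * e) =
  (s2 * n%:R / (2 * r ^+ 2)) * ((pi / 2) ^+ 2 * (1 - 40 * e)) by field; rewrite gt_eqF.
have -> : v / 2 * (1 - 36 * e) * n%:R =
  (s2 * n%:R / (2 * r ^+ 2)) * ((pi / 2 - e) ^+ 2 * (1 - 36 * e)).
  by rewrite vE thE; field; rewrite gt_eqF.
apply: ler_wpM2l.
  by rewrite divr_ge0 ?mulr_ge0 ?sqr_ge0// ltW.
set b := pi / 2 in p1 *.
(* Since pi / 2 >= 1, replacing pi / 2 - e by pi / 2 costs a relative error 2 e, which together with
   36 e stays below 40 e. *)
have h : b ^+ 2 * (1 - 2 * e) <= (b - e) ^+ 2.
  have : 0 <= 2 * e * (b * (b - 1)) + e ^+ 2.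
    apply: addr_ge0; last exact: sqr_ge0.
    by apply: mulr_ge0; [lra|apply: mulr_ge0; lra].
  have -> : 2 * e * (b * (b - 1)) + e ^+ 2 = (b - e) ^+ 2 - b ^+ 2 * (1 - 2 * e) by ring.
  lra.
have h2 : b ^+ 2 * (1 - 2 * e) * (1 - 36 * e) <= (b - e) ^+ 2 * (1 - 36 * e).
  by apply: ler_wpM2r => //; lra.
apply: le_trans h2; rewrite -mulrA ler_wpM2l ?sqr_ge0//.
have : 0 <= e * (2 + 72 * e) by rewrite mulr_ge0//; lra.
have -> : (1 - 2 * e) * (1 - 36 * e) = 1 - 40 * e + e * (2 + 72 * e) by ring.
lra.
Qed.

End upper_bound.

Lemma small_ball_upper d (T : measurableType d) (R : realType) (P : probability T R)
    (X : nat -> {RV P >-> R}) (s2 e r t : R) n :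
  iid X -> 0 < s2 -> 'E_P[X 0%N]%E = 0%E ->
  'E_P[(fun w => X 0%N w ^+ 2)%R]%E = s2%:E ->
  0 < e <= 128^-1 -> 0 < r -> 0 <= t -> 2 * t <= e ^+ 2 * r ->
  tail2 (X 0%N) t <= e * s2 / 10 -> 4 * s2 <= r ^+ 2 ->
  (P [set w | (max_abs_sum X n w <= r)%R] <=
  (24 * expR 1 * expR (- (pi ^+ 2 * s2 * n%:R / (8 * r ^+ 2) * (1 - 40 * e))))%:E)%E.
Proof.
move=> hX s20 m1 m2 he r0 t0 h1 h2 h3.
exact: (small_ball_upper_aux hX s20 m1 m2 he r0 t0 h1 h2 h3 erefl erefl erefl erefl n).
Qed.

(** * Lower bound by a truncated cosine *)

Section lower_bound_pointwise.
Context {R : realType}.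
Implicit Types a k z tau : R.

Lemma cos_add_ge a z :
  cos a - z * sin a - cos a * (z ^+ 2 / 2) - z ^+ 4 / 24 - `|z| ^+ 3 / 6 <= cos (a + z).
Proof.
rewrite cosD.
have h1 : `|cos a * (cos z - (1 - z ^+ 2 / 2))| <= z ^+ 4 / 24.
  rewrite normrM -[leRHS]mul1r; apply: ler_pM => //; first exact: cos_max.
  have := cos_ge_quad z; have := cos_le_quartic z.
  by move=> ? ?; rewrite ger0_norm; lra.
have h2 : `|sin a * (z - sin z)| <= `|z| ^+ 3 / 6.
  rewrite normrM -[leRHS]mul1r; apply: ler_pM => //; first exact: sin_max.
  exact: sin_sub_cubic.
move: h1 h2; rewrite !ler_norml => /andP[+ _] /andP[+ _]; lra.
Qed.

Lemma cos_add_ge_crude a z : cos a - z * sin a - 3 / 2 * z ^+ 2 <= cos (a + z).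
Proof.
rewrite cosD.
have z2 := sqr_ge0 z; have z0 := normr_ge0 z.
have zz : z ^+ 2 = `|z| ^+ 2 by rewrite real_normK ?num_real.
have h1 : `|cos a * (1 - cos z)| <= z ^+ 2 / 2.
  rewrite normrM -[leRHS]mul1r; apply: ler_pM => //; first exact: cos_max.
  have := cos_ge_quad z; have := cos_le1 z.
  by move=> ? ?; rewrite ger0_norm; lra.
have h2 : `|sin a * (z - sin z)| <= z ^+ 2.
  rewrite normrM -[leRHS]mul1r; apply: ler_pM => //; first exact: sin_max.
  have [z1|z1] := leP `|z| 2.
    apply: (le_trans (sin_sub_cubic z)).
    have : `|z| ^+ 3 <= `|z| ^+ 2 * 2 by rewrite exprSr ler_wpM2l// exprn_ge0.
    lra.
  apply: (le_trans (ler_normB _ _)); have := sin_max z.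
  have : `|z| * 2 <= `|z| * `|z| by rewrite ler_wpM2l// ltW.
  rewrite zz expr2; lra.
move: h1 h2; rewrite !ler_norml => /andP[_ +] /andP[+ _]; lra.
Qed.

Definition cos_quad (k s : R) : R := cos s + k * cos s ^+ 2.
(** Minus the derivative of [cos_quad k]. *)
Let slope (k s : R) : R := sin s + k * sin (s *+ 2).

Let cos2 a : cos a ^+ 2 = (1 + cos (a *+ 2)) / 2.
Proof. by rewrite cos_mulr2n -mulr_natr; field. Qed.

Let add2 a z : (a + z) *+ 2 = a *+ 2 + z *+ 2. Proof. by rewrite mulrnDl. Qed.

(** A second order expansion whose remainder, of order |z|^3, is at most tau z^2. Writing cos^2
    through the doubled angle reduces it to [cos_add_ge]. At the zeros of the cosine the second
    order coefficient of the cos^2 part is - k, so the expansion gains k z^2 there. *)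
Lemma cos_quad_ge tau k a z : 0 <= k <= 2^-1 -> 0 <= tau <= 1 -> `|z| <= tau ->
  cos_quad k a - z * slope k a
    - z ^+ 2 * (cos a / 2 + k * (2 * cos a ^+ 2 - 1) + tau) <= cos_quad k (a + z).
Proof.
move=> /andP[k0 k2] /andP[t0 t1] hz.
have z2 := sqr_ge0 z; have z0 := normr_ge0 z.
have zz : z ^+ 2 = `|z| ^+ 2 by rewrite real_normK ?num_real.
have zz4 : z ^+ 4 = `|z| ^+ 4 by rewrite (exprM _ 2 2) zz -exprM.
have h1 := cos_add_ge a z.
have h2 := cos_add_ge (a *+ 2) (z *+ 2).
have z3 : `|z| ^+ 3 <= z ^+ 2 * tau by rewrite zz exprSr ler_wpM2l// exprn_ge0.
have z4 : z ^+ 4 <= z ^+ 2 * tau.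
  rewrite zz zz4; apply: (@le_trans _ _ (`|z| ^+ 3 * 1)); last by rewrite mulr1 -zz.
  by rewrite exprSr ler_wpM2l ?exprn_ge0//; lra.
have h3 : cos (a *+ 2) - z *+ 2 * sin (a *+ 2) - cos (a *+ 2) * (2 * z ^+ 2)
   - 2 * (z ^+ 2 * tau) <= cos ((a + z) *+ 2).
  rewrite add2; apply: le_trans h2.
  have -> : (z *+ 2) ^+ 2 / 2 = 2 * z ^+ 2 by rewrite -mulr_natr; field.
  have -> : (z *+ 2) ^+ 4 / 24 = 2 / 3 * z ^+ 4 by rewrite -mulr_natr; field.
  have -> : `|z *+ 2| ^+ 3 / 6 = 4 / 3 * `|z| ^+ 3.
    by rewrite normrMn -[`|z| *+ 2]mulr_natr; field.
  lra.
rewrite /cos_quad /slope [cos (a + z) ^+ 2]cos2.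
have h4 := ler_wpM2l k0 h3.
have h5 : k * (z ^+ 2 * tau) <= 2^-1 * (z ^+ 2 * tau).
  by rewrite ler_wpM2r// mulr_ge0.
have h6 : 0 <= z ^+ 2 * tau by rewrite mulr_ge0.
have e2 : cos (a *+ 2) = 2 * cos a ^+ 2 - 1 by rewrite cos_mulr2n -mulr_natr; ring.
move: h4; rewrite e2 -[z *+ 2]mulr_natr; set S := sin _; set C := cos a; set D := cos ((a + z) *+ 2).
have -> : k * ((1 + D) / 2) = k / 2 + k * D / 2 by field.
have -> : k * (2 * C ^+ 2 - 1 - z * 2 * S - (2 * C ^+ 2 - 1) * (2 * z ^+ 2) - 2 * (z ^+ 2 * tau)) =
  2 * (k * C ^+ 2) - k - 2 * (z * (k * S)) - 2 * (z ^+ 2 * (k * (2 * C ^+ 2 - 1))) - 2 * (k * (z ^+ 2 * tau)) by ring.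
have -> : C + k * C ^+ 2 - z * (sin a + k * S) - z ^+ 2 * (C / 2 + k * (2 * C ^+ 2 - 1) + tau) =
  C + k * C ^+ 2 - z * sin a - z * (k * S) - C * (z ^+ 2 / 2) - z ^+ 2 * (k * (2 * C ^+ 2 - 1)) - z ^+ 2 * tau by field.
move: h1; rewrite -/C; lra.
Qed.

Lemma cos_quad_ge_crude k a z : 0 <= k <= 2^-1 ->
  cos_quad k a - z * slope k a - 4 * z ^+ 2 <= cos_quad k (a + z).
Proof.
move=> /andP[k0 k2]; have z2 := sqr_ge0 z.
have h1 := cos_add_ge_crude a z.
have := cos_add_ge_crude (a *+ 2) (z *+ 2).
have -> : 3 / 2 * (z *+ 2) ^+ 2 = 6 * z ^+ 2 by rewrite -mulr_natr; field.
rewrite -add2 -[z *+ 2]mulr_natr => /(ler_wpM2l k0).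
have : k * z ^+ 2 <= 2^-1 * z ^+ 2 by rewrite ler_wpM2r.
rewrite /cos_quad /slope [cos (a + z) ^+ 2]cos2 [cos a ^+ 2]cos2.
set S := sin (a *+ 2); set C := cos (a *+ 2); set D := cos ((a + z) *+ 2).
have -> : k * (C - z * 2 * S - 6 * z ^+ 2) = k * C - 2 * (z * (k * S)) - 6 * (k * z ^+ 2) by ring.
have -> : cos a + k * ((1 + C) / 2) - z * (sin a + k * S) - 4 * z ^+ 2 =
  cos a + k / 2 + k * C / 2 - z * sin a - z * (k * S) - 4 * z ^+ 2 by field.
have -> : k * ((1 + D) / 2) = k / 2 + k * D / 2 by field.
move: h1; lra.
Qed.

Lemma slope_le k a : 0 <= k <= 2^-1 -> `|slope k a| <= 2.
Proof.
move=> /andP[k0 k2]; apply: (le_trans (ler_normD _ _)).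
have h1 := sin_max a; have h2 := sin_max (a *+ 2).
rewrite normrM (ger0_norm k0).
have : k * `|sin (a *+ 2)| <= 1 * 1 by apply: ler_pM => //; lra.
lra.
Qed.

Lemma cos_quad_alive k a : 0 <= k <= 2^-1 -> `|a| <= pi / 2 ->
  [/\ 0 <= cos a, 0 <= cos_quad k a & cos_quad k a <= 2].
Proof.
move=> /andP[k0 k2] ha; have c0 : 0 <= cos a by apply: cos_ge0_pihalf; rewrite -ler_norml.
have c1 := cos_le1 a.
have : k * cos a ^+ 2 <= 1 * 1.
  by apply: ler_pM; rewrite ?sqr_ge0 ?exprn_ile1//; lra.
have : 0 <= k * cos a ^+ 2 by rewrite mulr_ge0// sqr_ge0.
by move=> ? ?; split=> //; rewrite /cos_quad; lra.
Qed.

(** From inside [-pi/2, pi/2] a jump of length at most 2 ends within 3 pi / 2; there the cutoff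
    replaces a nonpositive value by 0, which only helps a lower bound. *)
Lemma cos_quad_dead k a : 0 <= k <= 2^-1 -> pi / 2 < `|a| -> `|a| <= pi / 2 *+ 3 ->
  cos_quad k a <= 0.
Proof.
move=> /andP[k0 k2] ha1 ha2; rewrite /cos_quad -cos_norm.
have c0 : cos `|a| <= 0.
  have -> : `|a| = (`|a| - pi) + pi by ring.
  rewrite cosDpi oppr_le0; apply: cos_ge0_pihalf.
  by move: ha2; rewrite -mulr_natr => ha2; apply/andP; split; lra.
have c1 := cos_geN1 `|a|.
have -> : cos `|a| + k * cos `|a| ^+ 2 = cos `|a| * (1 + k * cos `|a|) by ring.
apply: mulr_le0_ge0 => //.
have : - (1 * 1) <= k * cos `|a|.
  rewrite lerNl -mulrN; apply: ler_pM => //; lra.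
lra.
Qed.

(* The jumps beyond 64 are charged almost nothing: they are killed, and this
   costs less than the variance they carry. *)
Lemma lower_step tau k a z : 0 <= k <= 2^-1 -> 0 <= tau <= 1 -> `|a| <= pi / 2 ->
  cos_quad k a - z * slope k a
    - z ^+ 2 * (cos a / 2 + k * (2 * cos a ^+ 2 - 1) + tau)
    - 5 * (if tau <= `|z| then z ^+ 2 else 0)
    + (5 + cos a / 2 - k - 16^-1) * (if 64 <= `|z| then z ^+ 2 else 0) <=
  (if `|a + z| <= pi / 2 then cos_quad k (a + z) else 0).
Proof.
move=> hk ht ha.
have /andP[k0 k2] := hk; have /andP[t0 t1] := ht.
have p1 := @pihalf_ge1 R.
have [c0 G0 G2] := cos_quad_alive hk ha.
have c1 := cos_le1 a.
have z0 := normr_ge0 z; have z2 := sqr_ge0 z.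
have zz : z ^+ 2 = `|z| ^+ 2 by rewrite real_normK ?num_real.
have sl : - (z * slope k a) <= 2 * `|z|.
  apply: (le_trans (ler_norm _)); rewrite normrN normrM mulrC.
  by apply: ler_wpM2r => //; exact: slope_le.
have kc : 0 <= k * cos a ^+ 2 by rewrite mulr_ge0 ?sqr_ge0.
have val0 : 0 <= (if `|a + z| <= pi / 2 then cos_quad k (a + z) else 0).
  by case: ifP => // h; have [] := cos_quad_alive hk h.
have valG : `|z| <= 2 -> cos_quad k (a + z) <=
    (if `|a + z| <= pi / 2 then cos_quad k (a + z) else 0).
  move=> hz; case: ifPn => // h; rewrite -ltNge in h.
  apply: cos_quad_dead => //; rewrite -mulr_natr.
  have := ler_normD a z; lra.
set V := if _ then _ else _ in val0 valG *.
(* For a jump beyond 64 the left side is at most 2 + 2 |z| - z^2 / 16, which is negative. *)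
case: (boolP (64 <= `|z|)) => hz64.
  have -> : tau <= `|z| by lra.
  have h : 64 * `|z| <= z ^+ 2 by rewrite zz expr2 ler_wpM2r.
  have h' : 0 <= z ^+ 2 * (k * cos a ^+ 2) by rewrite mulr_ge0.
  have h'' : 0 <= z ^+ 2 * tau by rewrite mulr_ge0.
  have -> : cos_quad k a - z * slope k a - z ^+ 2 * (cos a / 2 + k * (2 * cos a ^+ 2 - 1) + tau) -
    5 * z ^+ 2 + (5 + cos a / 2 - k - 16^-1) * z ^+ 2 =
    cos_quad k a - z * slope k a - 2 * (z ^+ 2 * (k * cos a ^+ 2)) - z ^+ 2 * tau - 16^-1 * z ^+ 2 by field.
  lra.
rewrite mulr0 addr0.
(* Of the coefficient 5, at most 1/2 is used up by the term in k. The remaining 9/2 covers the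
   constant 4 of the crude expansion if |z| <= 2, and makes the left side negative if |z| > 2. *)
case: (boolP (tau <= `|z|)) => htz.
  have h1 : 0 <= z ^+ 2 * (cos a / 2) by rewrite mulr_ge0 ?divr_ge0.
  have h2 : 0 <= z ^+ 2 * (k * cos a ^+ 2) by rewrite mulr_ge0.
  have h3 : 0 <= z ^+ 2 * tau by rewrite mulr_ge0.
  have h4 : k * z ^+ 2 <= 2^-1 * z ^+ 2 by rewrite ler_wpM2r.
  have h5 : cos_quad k a - z * slope k a - z ^+ 2 * (cos a / 2 + k * (2 * cos a ^+ 2 - 1) + tau) -
    5 * z ^+ 2 <= cos_quad k a - z * slope k a - (9 / 2) * z ^+ 2.
    have -> : z ^+ 2 * (cos a / 2 + k * (2 * cos a ^+ 2 - 1) + tau) =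
     z ^+ 2 * (cos a / 2) + 2 * (z ^+ 2 * (k * cos a ^+ 2)) - k * z ^+ 2 + z ^+ 2 * tau by ring.
    lra.
  apply: (le_trans h5).
  have [hz|hz] := leP `|z| 2.
    apply: le_trans (valG hz); have := @cos_quad_ge_crude k a z hk; lra.
  have : 2 * `|z| <= z ^+ 2 by rewrite zz expr2 ler_wpM2r// ltW.
  lra.
rewrite -ltNge in htz; rewrite mulr0 subr0.
apply: (@le_trans _ _ (cos_quad k (a + z))); last by apply: valG; lra.
by apply: cos_quad_ge => //; exact: ltW.
Qed.

End lower_bound_pointwise.

(** * Drift and survival probability: the lower bound *)

Section lower_bound.
Context d (T : measurableType d) (R : realType) (P : probability T R).
Variables (X : nat -> {RV P >-> R}) (s2 : R).
Hypotheses (hX : iid X) (s20 : 0 <= s2).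
Hypothesis m1 : ('E_P[X 0%N] = 0)%E.
Hypothesis m2 : ('E_P[(fun w => X 0%N w ^+ 2)%R])%E = s2%:E.
Variables (k r t th u : R).
Hypotheses (hk : 0 <= k <= 2^-1) (r0 : 0 < r).
Hypotheses (thE : th = pi / (2 * r)) (uE : u = 64 / th).
Hypothesis small_jumps : 0 <= th * t <= 1.
Hypothesis small_tail : tail2 (X 0%N) u <= s2 / 2.
(** The left side is twice the sum of the losses in [lower_step] that do not vanish with the cosine.
    So half of the gain k s2 pays for them, and the other half for k times the tail at [u], by
    [small_tail]. *)
Hypothesis hks : 2 * (th * t) * s2 + 10 * (tail2 (X 0%N) t - tail2 (X 0%N) u)
   + tail2 (X 0%N) u / 8 <= k * s2.
Hypothesis large_r : 12 * s2 <= r ^+ 2.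

Let th0 : 0 < th. Proof. by rewrite thE divr_gt0 ?mulr_gt0 ?pi_gt0. Qed.

Let aliveE (s : R) : (`|s| <= r) = (`|th * s| <= pi / 2).
Proof.
have -> : pi / 2 = th * r by rewrite thE; field; rewrite gt_eqF.
by rewrite normrM (gtr0_norm th0) ler_pM2l.
Qed.

Let tailE (t' x : R) : (if th * t' <= `|th * x| then (th * x) ^+ 2 else 0) =
  th ^+ 2 * tail_sqr t' x.
Proof.
rewrite normrM (gtr0_norm th0) ler_pM2l// /tail_sqr exprMn.
by case: ifP => // _; rewrite mulr0.
Qed.

Let thu : th * u = 64. Proof. by rewrite uE; field; rewrite gt_eqF. Qed.

Let mG : measurable_fun setT (fun s : R => cos_quad k (th * s)).
Proof.
have mc : measurable_fun setT (fun s : R => cos (th * s)).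
  apply: (@measurableT_comp _ _ _ _ _ _ (@cos R) _ (fun s => th * s)).
    by apply: continuous_measurable_fun; exact: continuous_cos.
  exact: measurable_funM.
apply: measurable_funD => //; apply: measurable_funM => //.
exact: (measurable_funX 2 mc).
Qed.

Let G0 s : `|s| <= r -> 0 <= cos_quad k (th * s).
Proof. by rewrite aliveE => h; have [] := cos_quad_alive hk h. Qed.

Variable lam : R.
Hypothesis lamE : lam = 1 - th ^+ 2 / 2 * (s2 - tail2 (X 0%N) u + 4 * k * s2).

Let lower_drift s : `|s| <= r ->
  ((lam * cos_quad k (th * s))%:E <= kill_op X r (fun s => cos_quad k (th * s)) s)%E.
Proof.
move=> hs.
have ha : `|th * s| <= pi / 2 by rewrite -aliveE.
have [c0 Gs0 _] := cos_quad_alive hk ha.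
have c1 := cos_le1 (th * s).
pose S := sin (th * s) + k * sin (th * s *+ 2).
set c := cos (th * s) in c0 c1.
have mf : measurable_fun setT (fun x => cutoff r (fun s => cos_quad k (th * s)) (s + x)).
  by apply: (measurableT_comp (measurable_cutoff r mG)); exact: measurable_funD.
have f0 x : 0 <= cutoff r (fun s => cos_quad k (th * s)) (s + x).
  exact: cutoff_ge0.
have H x : quad (cos_quad k (th * s)) (- (th * S))
      (- (th ^+ 2 * (c / 2 + k * (2 * c ^+ 2 - 1) + th * t)))
      (- (5 * th ^+ 2)) ((5 + c / 2 - k - 16^-1) * th ^+ 2) t u x <=
    cutoff r (fun s => cos_quad k (th * s)) (s + x).
  have := lower_step (th * x) hk small_jumps ha.
  rewrite -[64]thu !tailE -mulrDr -aliveE /cutoff; apply: le_trans.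
  by rewrite le_eqVlt; apply/orP; left; apply/eqP; rewrite /quad /S /c; ring.
apply: le_trans (integral_ge_quad m2 m1 mf f0 H).
rewrite lee_fin.
have hst := small_tail; have hs0 := s20; have hks' := hks.
set e1 := tail2 _ t in hst hks' *; set e2 := tail2 _ u in hst hks' *.
have e20 : 0 <= e2 by exact: (tail2_ge0 m2).
pose w := th ^+ 2.
have w0 : 0 <= w by exact: sqr_ge0.
have c2 : c ^+ 2 <= c by rewrite expr2 ler_piMr.
have cc : 0 <= c ^+ 2 by exact: sqr_ge0.
have /andP[k0 k2] := hk.
have h1 : w * (2 * (th * t) * s2 + 10 * (e1 - e2) + e2 / 8) <= w * (k * s2).
  exact: ler_wpM2l.
have h2 : w * (k * e2) <= w * (k * (s2 / 2)) by rewrite ler_wpM2l// ler_wpM2l.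
have h3 : 0 <= w * ((s2 - e2 + 4 * k * s2) * (k * c ^+ 2)).
  rewrite mulr_ge0// mulr_ge0//; last by rewrite mulr_ge0.
  rewrite addr_ge0 ?mulr_ge0//.
  have : e2 <= s2 / 2 by [].
  by lra.
(* The price of the quadratic term: the expansion loses 2 k c^2, and the summand 4 k s2 of [lam]
   provides 2 k c, which is more because c <= 1. *)
have h4 : w * (k * s2 * c ^+ 2) <= w * (k * s2 * c).
  by rewrite ler_wpM2l// ler_wpM2l// mulr_ge0.
rewrite -subr_ge0.
have -> : cos_quad k (th * s) + - (th ^+ 2 * (c / 2 + k * (2 * c ^+ 2 - 1) + th * t)) * s2 +
   - (5 * th ^+ 2) * e1 + (5 + c / 2 - k - 16^-1) * th ^+ 2 * e2 - lam * cos_quad k (th * s) =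
   2^-1 * (w * ((s2 - e2 + 4 * k * s2) * (k * c ^+ 2)))
   - 2^-1 * (w * (2 * (th * t) * s2 + 10 * (e1 - e2) + e2 / 8))
   + w * (k * s2) - w * (k * e2) + 2 * (w * (k * s2 * c)) - 2 * (w * (k * s2 * c ^+ 2)).
  by rewrite lamE -/e2 /w /cos_quad -/c; field.
lra.
Qed.

Let x : R := pi ^+ 2 / (8 * r ^+ 2) * (s2 - tail2 (X 0%N) u + 4 * k * s2).

(** The test function is at least 1 at the origin and at most 2 everywhere inside, hence the factor
    1/2; and 1 - x >= exp (- x (1 + 2 x)) for 0 <= x <= 1/2. *)
Lemma small_ball_lower_aux n : (((2^-1 * expR (- (n%:R * x * (1 + 2 * x))))%:E <=
  P [set w | (max_abs_sum X n w <= r)%R])%E).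
Proof.
have hst := small_tail; have hlr := large_r; have hs0 := s20; have hr0 := r0.
have xE : lam = 1 - x by rewrite lamE /x thE; field; rewrite gt_eqF.
have /andP[k0 k2] := hk.
have e20 : 0 <= tail2 (X 0%N) u by exact: (tail2_ge0 m2).
have ks : k * s2 <= 2^-1 * s2 by rewrite ler_wpM2r.
have ks0 : 0 <= k * s2 by rewrite mulr_ge0.
have hx : 0 <= x <= 2^-1.
  have pp : 0 <= pi ^+ 2 / (8 * r ^+ 2) by rewrite divr_ge0 ?sqr_ge0// mulr_ge0// sqr_ge0.
  have k4 : 4 * k * s2 = 4 * (k * s2) by ring.
  rewrite /x k4; apply/andP; split; first by apply: mulr_ge0 => //; lra.
  apply: (@le_trans _ _ (pi ^+ 2 / (8 * r ^+ 2) * (3 * s2))).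
    by apply: ler_wpM2l => //; lra.
  rewrite mulrAC ler_pdivrMr ?mulr_gt0 ?exprn_gt0//.
  have : pi ^+ 2 <= 4 ^+ 2 :> R.
    by rewrite ler_sqr ?nnegrE ?pi_ge0//; have := @pihalf_lt2 R; lra.
  move=> /(ler_wpM2r (s20)); lra.
have /andP[x0 x2] := hx.
have lam0 : 0 <= lam by rewrite xE; lra.
have r0' := ltW r0.
have low := alive_mean_ge_power r0' hX n mG G0 lam0 lower_drift.
have up : (alive_mean X r n (fun s => cos_quad k (th * s)) <=
   2%:E * P [set w | (max_abs_sum X n w <= r)%R])%E.
  rewrite -(alive_mean1 X r0') -alive_meanZ//.
  apply: alive_mean_mono => // s; rewrite aliveE => hs; rewrite mulr1.
  by have [] := cos_quad_alive hk hs.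
have hp : P [set w | (max_abs_sum X n w <= r)%R] \is a fin_num.
  by apply: fin_num_measure; exact: measurable_alive.
have := le_trans low up; rewrite -(fineK hp) -EFinM !lee_fin => h.
have hl : expR (- (n%:R * x * (1 + 2 * x))) <= lam ^+ n.
  have -> : - (n%:R * x * (1 + 2 * x)) = - (x * (1 + 2 * x)) * n%:R by ring.
  rewrite expRM_natr; apply: lerXn2r; rewrite ?nnegrE ?expR_ge0//.
  rewrite expRN -[leRHS]invrK lef_pV2 ?posrE ?invr_gt0 ?expR_gt0//; last by rewrite xE; lra.
  apply: le_trans (expR_ge1Dx _).
  rewrite xE -[leLHS]mul1r ler_pdivrMr; last by lra.
  have : 0 <= x ^+ 2 * (1 - 2 * x) by rewrite mulr_ge0 ?sqr_ge0//; lra.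
  have -> : (1 + x * (1 + 2 * x)) * (1 - x) = 1 + x ^+ 2 * (1 - 2 * x) by ring.
  lra.
have : lam ^+ n * 1 <= lam ^+ n * cos_quad k (th * 0).
  by rewrite ler_wpM2l ?exprn_ge0// /cos_quad mulr0 cos0; lra.
lra.
Qed.

End lower_bound.

Lemma small_ball_lower d (T : measurableType d) (R : realType) (P : probability T R)
    (X : nat -> {RV P >-> R}) (s2 k r t : R) n :
  iid X -> 0 <= s2 -> 'E_P[X 0%N]%E = 0%E ->
  'E_P[(fun w => X 0%N w ^+ 2)%R]%E = s2%:E ->
  0 <= k <= 2^-1 -> 0 < r ->
  let th := pi / (2 * r) in let u := 64 / th in
  let x := pi ^+ 2 / (8 * r ^+ 2) * (s2 - tail2 (X 0%N) u + 4 * k * s2) in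
  0 <= th * t <= 1 -> tail2 (X 0%N) u <= s2 / 2 ->
  2 * (th * t) * s2 + 10 * (tail2 (X 0%N) t - tail2 (X 0%N) u)
   + tail2 (X 0%N) u / 8 <= k * s2 ->
  12 * s2 <= r ^+ 2 ->
  ((2^-1 * expR (- (n%:R * x * (1 + 2 * x))))%:E <=
  P [set w | (max_abs_sum X n w <= r)%R])%E.
Proof.
move=> hX s20 m1 m2 hk r0 th u x h1 h2 h3 h4.
exact: (small_ball_lower_aux hX s20 m1 m2 hk r0 erefl erefl h1 h2 h3 h4 erefl n).
Qed.

(** * A crude upper bound without moment assumptions *)

Section crude_upper_bound.
Context d (T : measurableType d) (R : realType) (P : probability T R).
Variables (X : nat -> {RV P >-> R}).
Hypotheses (hX : iid X).

Definition cut_id (t x : R) : R := if `|x| <= t then x else 0.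
Definition cut_sqr (t x : R) : R := if `|x| <= t then x ^+ 2 else 0.

Definition trunc_mean (Y : {RV P >-> R}) (t : R) : R := fine (\int[P]_w (cut_id t (Y w))%:E)%E.
Definition trunc_sqr (Y : {RV P >-> R}) (t : R) : R := fine (\int[P]_w (cut_sqr t (Y w))%:E)%E.

Lemma measurable_cut_id t : measurable_fun setT (cut_id t).
Proof.
by apply: measurable_fun_ifT => //; apply: measurable_fun_ler => //; exact: measurableT_comp.
Qed.

Lemma measurable_cut_sqr t : measurable_fun setT (cut_sqr t).
Proof.
by apply: measurable_fun_ifT => //; apply: measurable_fun_ler => //; exact: measurableT_comp.
Qed.

Lemma bounded_integrable (f : T -> R) (M : R) : measurable_fun setT f ->
  (forall w, `|f w| <= M) -> P.-integrable setT (fun w => (f w)%:E).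
Proof.
move=> mf fM.
have iM : P.-integrable setT (fun=> M%:E) by exact: finite_measure_integrable_cst.
apply: (le_integrable _ _ _ iM) => //; first exact/measurable_EFinP.
by move=> w _; rewrite !abse_EFin lee_fin (le_trans (fM w))// ler_norm.
Qed.

Lemma integrable_cut_id (Y : {RV P >-> R}) t : 0 <= t ->
  P.-integrable setT (fun w => (cut_id t (Y w))%:E).
Proof.
move=> t0; apply: (@bounded_integrable _ t).
  by apply: (measurableT_comp (measurable_cut_id t)).
by move=> w; rewrite /cut_id; case: ifPn => //; rewrite normr0.
Qed.

Lemma integrable_cut_sqr (Y : {RV P >-> R}) t : 0 <= t ->
  P.-integrable setT (fun w => (cut_sqr t (Y w))%:E).
Proof.
move=> t0; apply: (@bounded_integrable _ (t ^+ 2)).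
  by apply: (measurableT_comp (measurable_cut_sqr t)).
move=> w; rewrite /cut_sqr; case: ifPn => h; last by rewrite normr0 sqr_ge0.
by rewrite normrX lerXn2r ?nnegrE.
Qed.

Variables (r : R) (r0 : 0 < r).

Let mu := trunc_mean (X 0%N) (2 * r).
Let V := trunc_sqr (X 0%N) (2 * r).
(** The vertex of the parabola is moved by 2 r against the sign of the truncated mean: then (s + c)
    mu >= r |mu| for |s| <= r, so the mean contributes to the drift instead of perturbing it. The
    coefficient 25 keeps [parabola] nonnegative on [-3 r, 3 r]. Truncating at 2 r is harmless, since
    longer jumps leave [-r, r]. *)
Let c := 2 * r * Num.sg mu.
Definition parabola (a s : R) : R := 25 * r ^+ 2 - (s + a) ^+ 2.

Let mQ a : measurable_fun setT (parabola a).
Proof.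
apply: measurable_funB => //.
by apply: (@measurable_funX _ _ R _ (fun s : R => s + a) 2); exact: measurable_funD.
Qed.

Let c2 : `|c| <= 2 * r.
Proof.
rewrite /c normrM ger0_norm; last by rewrite mulr_ge0// ltW.
by rewrite ler_piMr ?mulr_ge0 ?(ltW r0)// normr_sg; case: eqP.
Qed.

Let Q0 s : `|s| <= 3 * r -> 0 <= parabola c s.
Proof.
move=> hs; have hr := r0; have hc := c2.
rewrite /parabola subr_ge0 -(real_normK (num_real (s + c))).
have -> : 25 * r ^+ 2 = (5 * r) ^+ 2 by ring.
rewrite ler_sqr ?nnegrE//; last by lra.
have := ler_normD s c; lra.
Qed.

Let drift s : `|s| <= r ->
  (kill_op X r (parabola c) s <= (parabola c s - (V + 2 * r * `|mu|))%:E)%E.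
Proof.
move=> hs; have hr := r0; have r20 : 0 <= 2 * r by lra.
have i1 := integrable_cut_id (X 0%N) r20.
have i2 := integrable_cut_sqr (X 0%N) r20.
pose h w := parabola c s - (2 * (s + c)) * cut_id (2 * r) (X 0%N w) - cut_sqr (2 * r) (X 0%N w).
have hE : (fun w => (h w)%:E) = (fun w => (parabola c s)%:E
    + (- (2 * (s + c)))%:E * (cut_id (2 * r) (X 0%N w))%:E
    + (- 1)%:E * (cut_sqr (2 * r) (X 0%N w))%:E)%E.
  by apply/funext => w; rewrite -!EFinM -!EFinD /h; congr (_%:E); ring.
have iP : P.-integrable setT (fun=> (parabola c s)%:E) by exact: finite_measure_integrable_cst.
have i1' : P.-integrable setT (fun w => (- (2 * (s + c)))%:E * (cut_id (2 * r) (X 0%N w))%:E)%E.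
  exact: integrableZl.
have i2' : P.-integrable setT (fun w => (- 1)%:E * (cut_sqr (2 * r) (X 0%N w))%:E)%E.
  exact: integrableZl.
have ih : (\int[P]_w (h w)%:E = (parabola c s - 2 * (s + c) * mu - V)%:E)%E.
  rewrite hE integralD//; last exact: integrableD.
  rewrite integralD// !integralZl//.
  have -> : (\int[P]_w (cut_id (2 * r) (X 0%N w))%:E = mu%:E)%E.
    by rewrite /mu /trunc_mean fineK//; exact: integrable_fin_num i1.
  have -> : (\int[P]_w (cut_sqr (2 * r) (X 0%N w))%:E = V%:E)%E.
    by rewrite /V /trunc_sqr fineK//; exact: integrable_fin_num i2.
  rewrite integral_cst//= (_ : ((parabola c s)%:E * _)%E = (parabola c s)%:E); last first.
    by rewrite -[RHS]mule1; congr (_ * _)%E; exact: probability_setT.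
  by rewrite -!EFinM -!EFinD; congr (_%:E); ring.
have ptw x : cutoff r (parabola c) (s + x) <=
    parabola c s - (2 * (s + c)) * cut_id (2 * r) x - cut_sqr (2 * r) x.
  have E : parabola c (s + x) = parabola c s - 2 * (s + c) * x - x ^+ 2.
    by rewrite /parabola; ring.
  have Qs : 0 <= parabola c s by apply: Q0; lra.
  rewrite /cutoff /cut_id /cut_sqr; case: (boolP (`|x| <= 2 * r)) => hx.
    rewrite -E; case: ifPn => // _; apply: Q0; have := ler_normD s x; lra.
  rewrite mulr0 !subr0; case: ifPn => // hsx; exfalso; move/negP: hx; apply.
  have -> : x = (s + x) - s by ring.
  have := ler_normB (s + x) s; lra.
have cut0 x : 0 <= cutoff r (parabola c) (s + x).
  by apply: cutoff_ge0 => y hy; apply: Q0; lra.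
apply: (@le_trans _ _ (\int[P]_w (h w)%:E)%E).
  apply: ge0_le_integral => //.
  - by move=> w _; rewrite lee_fin.
  - apply/measurable_EFinP; apply: (measurableT_comp (measurable_cutoff r (mQ c))).
    exact: measurable_funD.
  - by rewrite hE; apply: (measurable_int P); apply: integrableD => //; exact: integrableD.
  - by move=> w _; rewrite lee_fin; exact: ptw.
rewrite ih lee_fin.
have e : c * mu = 2 * r * `|mu| by rewrite /c -mulrA -normrEsg.
have : `|s * mu| <= r * `|mu| by rewrite normrM ler_wpM2r.
rewrite ler_norml => /andP[h1 _].
have -> : 2 * (s + c) * mu = 2 * (s * mu) + 2 * (c * mu) by ring.
rewrite e; lra.
Qed.

(** By the exit estimate the survival probability at least halves in every m steps, and 1/2 <= exp
    (- 1/2). The incomplete last block costs the factor exp (1/2). *)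
Lemma crude_upper (m n : nat) : (0 < m)%N ->
  50 * r ^+ 2 <= m%:R * (trunc_sqr (X 0%N) (2 * r) + 2 * r * `|trunc_mean (X 0%N) (2 * r)|) ->
  (P [set w | (max_abs_sum X n w <= r)%R] <= (expR (2^-1 - n%:R / (2 * m%:R)))%:E)%E.
Proof.
rewrite -/mu -/V; set v := V + _ => m0 hm.
have r0' := ltW r0.
have r2 : 0 < r ^+ 2 by rewrite exprn_gt0.
have mR : 0 < m%:R :> R by rewrite ltr0n.
have v0 : 0 <= v.
  rewrite -(pmulr_rge0 _ mR); apply: le_trans hm; lra.
have hp k : P [set w | (max_abs_sum X k w <= r)%R] \is a fin_num.
  by apply: fin_num_measure; exact: measurable_alive.
pose p k := fine (P [set w | (max_abs_sum X k w <= r)%R]).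
have pE k : P [set w | (max_abs_sum X k w <= r)%R] = (p k)%:E by rewrite fineK.
have p0 k : 0 <= p k by exact: fine_ge0.
have Q0' s : `|s| <= r -> 0 <= parabola c s.
  by move=> hs; apply: Q0; have := r0; lra.
have halve k : p (k + m)%N <= 2^-1 * p k.
  have := alive_exit r0' hX k m (mQ c) v0 Q0' drift.
  have up : (alive_mean X r k (parabola c) <=
     (25 * r ^+ 2)%:E * P [set w | (max_abs_sum X k w <= r)%R])%E.
    rewrite -(alive_mean1 X r0') -alive_meanZ//; last by rewrite mulr_ge0 ?sqr_ge0.
    by apply: alive_mean_mono => // s _; rewrite mulr1 /parabola gerBl sqr_ge0.
  move=> /le_trans /(_ up); rewrite !pE -!EFinM lee_fin => h.
  have : 50 * r ^+ 2 * p (k + m)%N <= m%:R * v * p (k + m)%N by rewrite ler_wpM2r.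
  move=> /le_trans /(_ h).
  have -> : 50 * r ^+ 2 * p (k + m)%N = (25 * r ^+ 2) * (2 * p (k + m)%N) by ring.
  by rewrite ler_pM2l ?mulr_gt0//; lra.
have pj j k : p (k + j * m)%N <= expR (- (j%:R / 2)).
  elim: j k => [|j IH] k.
    rewrite mul0r oppr0 expR0 -lee_fin -pE; apply: probability_le1.
    exact: measurable_alive.
  rewrite mulSn addnA addnAC; apply: (le_trans (halve _)).
  have -> : expR (- (j.+1%:R / 2)) = expR (- 2^-1) * expR (- (j%:R / 2)) :> R.
    by rewrite -expRD -natr1; congr expR; field.
  apply: ler_pM => //.
  by apply: le_trans (expR_ge1Dx _); lra.
rewrite pE lee_fin {1}(divn_eq n m) addnC; apply: (le_trans (pj _ _)).
rewrite ler_expR.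
have : n%:R <= (n %/ m)%N.+1%:R * m%:R :> R.
  by rewrite -natrM ler_nat ltnW// ltn_ceil.
rewrite -natr1 mulrDl mul1r => h.
have -> : n%:R / (2 * m%:R) = n%:R / m%:R / 2 :> R by field; rewrite gt_eqF.
have : n%:R / m%:R <= (n %/ m)%:R + 1 :> R.
  by rewrite ler_pdivrMr// mulrDl mul1r.
lra.
Qed.

End crude_upper_bound.

(** * Iterated logarithms and the weights *)

Section iterated_log.
Context {R : realType}.
Implicit Types x y z p : R.

Lemma expR_half_le2 : expR (2^-1) <= 2 :> R.
Proof.
have h := @expR_ge1Dx R (- 2^-1).
rewrite -[leLHS]invrK -expRN -[leRHS]invrK lef_pV2 ?posrE ?invr_gt0 ?expR_gt0//.
apply: le_trans h; lra.
Qed.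

Lemma logtE x : expR (logt x) = Num.max x (expR 1).
Proof. by rewrite lnK// posrE lt_max expR_gt0 orbT. Qed.

Lemma logt_ge1 x : 1 <= logt x.
Proof. by rewrite -ler_expR logtE le_max lexx orbT. Qed.

Lemma logt_gt0 x : 0 < logt x.
Proof. exact: lt_le_trans (logt_ge1 x). Qed.

Lemma ler_logt x y : x <= y -> logt x <= logt y.
Proof. by move=> xy; rewrite -ler_expR !logtE le_max2. Qed.

Lemma ln_le_logt x : 0 < x -> ln x <= logt x.
Proof. by move=> x0; rewrite -ler_expR logtE lnK// le_max lexx. Qed.

Lemma logt_le_1ln x : 1 <= x -> logt x <= 1 + ln x.
Proof.
move=> x1; rewrite -ler_expR logtE expRD lnK ?posrE ?(lt_le_trans _ x1)//.
have e1 : 1 <= expR 1 :> R by rewrite -[leLHS]expR0 ler_expR.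
rewrite ge_max; apply/andP; split.
  by rewrite ler_peMl// (le_trans _ x1).
by rewrite ler_peMr// ltW// expR_gt0.
Qed.

Lemma loglogt_ge1 x : 1 <= loglogt x. Proof. by rewrite /loglogt logt_ge1. Qed.

Lemma loglogt_le x : loglogt x <= logt x.
Proof.
apply: (le_trans (logt_le_1ln (logt_ge1 x))).
by have := ln_le_subr1 (logt_gt0 x); lra.
Qed.

Lemma ler_loglogt x y : x <= y -> loglogt x <= loglogt y.
Proof. by move=> xy; apply/ler_logt/ler_logt. Qed.

Lemma logt_mul_le x z : 1 <= x -> 1 <= z -> logt (x * z) <= logt x + ln z.
Proof.
move=> x1 z1; rewrite -ler_expR expRD !logtE lnK ?posrE ?(lt_le_trans _ z1)//.
have e0 := expR_gt0 (1 : R).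
rewrite ge_max; apply/andP; split.
  by rewrite ler_wpM2r ?le_max ?lexx// (le_trans _ z1).
rewrite -[leLHS]mulr1; by apply: ler_pM; rewrite ?expR_ge0// le_max lexx orbT.
Qed.

Lemma ln1_le_powR p z : 0 < p -> 1 <= z -> 1 + ln z <= (Num.min p 1)^-1 * z `^ p.
Proof.
move=> p0 z1; have z0 : 0 < z by lra.
set q := Num.min p 1.
have q0 : 0 < q by rewrite lt_min p0 ltr01.
have q1 : q <= 1 by rewrite ge_min lexx orbT.
have qp : q <= p by rewrite ge_min lexx.
rewrite ler_pdivlMl//; apply: (@le_trans _ _ (z `^ q)); last exact: ler_powR.
rewrite /powR gt_eqF//; apply: le_trans (expR_ge1Dx _).
by rewrite mulrDr mulr1 lerD2r.
Qed.

End iterated_log.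

(** * Growth of the sums of the weights *)

Section weights.
Context {R : realType}.
Variables (a b : R).
Hypotheses (ha : -1 < a) (hb : -1 < b).

Let V (x : R) : R := logt x `^ a * loglogt x `^ b.
(** An exponent in ]-1, 0] strictly below [a]: the slack [eps] absorbs the power of loglog whatever
    the sign of [b], and g > -1 keeps the sums of (log k)^g / k growing like (log n)^(1 + g). *)
Let g : R := Num.min ((a - 1) / 2) 0.
Let eps : R := a - g.
Let C : R := (Num.min eps 1)^-1.

Definition weight_sum (n : nat) : R := \sum_(1 <= k < n.+1) weight a b k.

Let g_bounds : [/\ -1 < g, g <= 0 & 0 < eps].
Proof.
have h := ha; split.
- by rewrite lt_min; apply/andP; split; lra.
- by rewrite ge_min lexx orbT.
- by rewrite /eps /g subr_gt0 gt_min; apply/orP; have [a1|a1] := ltP a 1; [left|right]; lra.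
Qed.

Let C_ge1 : 1 <= C.
Proof.
have [_ _ e0] := g_bounds; rewrite /C invf_ge1 ?lt_min ?e0 ?ltr01//.
by rewrite ge_min lexx orbT.
Qed.

Let V_gt0 x : 0 < V x.
Proof.
by rewrite mulr_gt0 ?powR_gt0 ?logt_gt0// (lt_le_trans _ (loglogt_ge1 _)).
Qed.

Lemma weightE n : weight a b n = V n%:R / n%:R. Proof. by []. Qed.

Lemma weight_ge0 n : 0 <= weight a b n.
Proof. by rewrite weightE divr_ge0// ltW. Qed.

(** A substitute for monotonicity, which may fail when [a] or [b] is negative: V / logt^g is
    increasing up to a constant factor. *)
Let V_ratio x y : x <= y -> V x <= C * (V y * (logt x / logt y) `^ g).
Proof.
move=> xy; have [_ g0 e0] := g_bounds.
set U := logt x; set W := logt y.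
have U1 : 1 <= U by exact: logt_ge1.
have U0 : 0 < U by exact: logt_gt0.
have W0 : 0 < W by exact: logt_gt0.
have UW : U <= W by exact: ler_logt.
have ll0 (u : R) : 0 < loglogt u by rewrite (lt_le_trans _ (loglogt_ge1 _)).
have lxy := ler_loglogt xy; have llx := ltW (ll0 x); have lly := ltW (ll0 y).
have key : U `^ eps * loglogt x `^ b <= C * (W `^ eps * loglogt y `^ b).
  have [b0|b0] := leP 0 b.
    apply: (@le_trans _ _ (W `^ eps * loglogt y `^ b)).
      apply: ler_pM; rewrite ?powR_ge0//; apply: ge0_ler_powR => //; rewrite ?nnegrE ?(ltW e0) ?(ltW U0) ?(ltW W0) ?(ltW (ll0 _))//.
    by rewrite ler_peMl// mulr_ge0// powR_ge0.
  (* For b < 0 the power of loglog decreases. Its loss is at most 1 + ln z, because - b < 1 and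
     loglog grows at most by the factor 1 + ln z, and z^eps outweighs this logarithm. *)
  pose z := W / U.
  have z1 : 1 <= z by rewrite ler_pdivlMr// mul1r.
  have WE : W = U * z by rewrite /z mulrC divfK ?gt_eqF.
  have lln : loglogt y <= loglogt x * (1 + ln z).
    rewrite {1}/loglogt -/W WE; apply: (le_trans (logt_mul_le U1 z1)).
    rewrite mulrDr mulr1 lerD2l ler_peMl// ?ln_ge0//; exact: loglogt_ge1.
  have lz : 1 <= 1 + ln z by rewrite lerDl ln_ge0.
  have r1 : loglogt x `^ b <= loglogt y `^ b * (1 + ln z).
    rewrite -[b]opprK powRN [X in _ <= X * _]powRN.
    rewrite mulrC -ler_pdivrMr ?invr_gt0 ?powR_gt0// invrK.
    rewrite ler_pdivrMl ?powR_gt0//.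
    apply: (@le_trans _ _ ((loglogt x * (1 + ln z)) `^ (- b))).
      apply: ge0_ler_powR; rewrite ?nnegrE ?oppr_ge0 ?(ltW b0) ?(ltW (ll0 _))//.
      by rewrite mulr_ge0 ?(ltW (ll0 _))// (le_trans _ lz).
    rewrite powRM ?(ltW (ll0 _)) ?(le_trans _ lz)//.
    rewrite ler_wpM2l ?powR_ge0//.
    by have hb' := hb; apply: ler1_powR => //; lra.
  have r2 : U `^ eps * (1 + ln z) <= C * W `^ eps.
    have -> : C * W `^ eps = U `^ eps * (C * z `^ eps).
      by rewrite WE powRM; [ring|exact: ltW|lra].
    by rewrite ler_wpM2l ?powR_ge0//; exact: ln1_le_powR.
  apply: (@le_trans _ _ (U `^ eps * (loglogt y `^ b * (1 + ln z)))).
    by rewrite ler_wpM2l ?powR_ge0.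
  have -> : U `^ eps * (loglogt y `^ b * (1 + ln z)) =
    (U `^ eps * (1 + ln z)) * loglogt y `^ b by ring.
  by rewrite mulrA ler_wpM2r ?powR_ge0.
have aE u : 0 < u -> u `^ a = u `^ g * u `^ eps.
  move=> u0; rewrite -powRD; first by congr (_ `^ _); rewrite /eps; ring.
  by rewrite (gt_eqF u0) implybT.
rewrite /V -/U -/W !aE// powRM ?invr_ge0 ?(ltW U0) ?(ltW W0)//.
have -> : W^-1 `^ g = (W `^ g)^-1.
  by rewrite -powR_inv1 ?(ltW W0)// -powRrM mulN1r powRN.
have Wg : 0 < W `^ g by exact: powR_gt0.
have -> : C * (W `^ g * W `^ eps * loglogt y `^ b * (U `^ g * (W `^ g)^-1)) =
  U `^ g * (C * (W `^ eps * loglogt y `^ b)) by field; rewrite gt_eqF.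
rewrite [leLHS](_ : _ = U `^ g * (U `^ eps * loglogt x `^ b)); last by rewrite mulrA.
by rewrite ler_wpM2l ?powR_ge0.
Qed.

Let V_ratio_ex : exists2 C : R, 1 <= C & forall x y : R, x <= y ->
  V x <= C * (V y * (logt x / logt y) `^ g).
Proof. by exists C; [exact: C_ge1|exact: V_ratio]. Qed.

(** Comparison with the primitive (1 + ln x)^(1 + h) / (1 + h); the Bernoulli inequality for the
    power 1 + h in ]0, 1] bounds its increments from below. The shift by 1 avoids a singularity at k
    = 1. *)
Let power_sum (h : R) n : -1 < h <= 0 -> (0 < n)%N ->
  \sum_(1 <= k < n.+1) (1 + ln k%:R) `^ h / k%:R <= (1 + h)^-1 * (1 + ln n%:R) `^ (1 + h).
Proof.
move=> /andP[h1 h0]; set p := 1 + h.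
have p0 : 0 < p by rewrite /p; lra.
have p1 : p <= 1 by rewrite /p; lra.
case: n => [//|n] _; elim: n => [|n IH].
  rewrite big_nat1 ln1 addr0 !powR1 divr1 mulr1 invf_ge1//.
rewrite big_nat_recr//=; apply: (le_trans (lerD IH (lexx _))).
have : n.+2%:R = n.+1%:R + 1 :> R by rewrite -natr1.
have : 1 <= n.+1%:R :> R by rewrite ler1n.
move: (n.+1%:R : R) (n.+2%:R : R) => x y x1 yx.
have x0 : 0 < x by lra.
have y0 : 0 < y by lra.
have lxy : y^-1 <= ln y - ln x.
  have := @ln_le_subr1 R (x / y); rewrite ln_div ?posrE// divr_gt0// => /(_ isT).
  have -> : x / y - 1 = - y^-1 by rewrite (_ : x = y - 1); [field; rewrite gt_eqF|lra].
  lra.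
have X0 : 0 < 1 + ln x by have := ln_ge0 x1; lra.
have Y0 : 0 < 1 + ln y by have : 0 < y^-1 by [rewrite invr_gt0]; lra.
set U := 1 + ln x in X0 *; set W := 1 + ln y in Y0 *.
have bern := @powR_bernoulli R (U / W) p.
have UW0 : 0 <= U / W by rewrite divr_ge0// ltW.
have {}bern : (U / W) `^ p <= 1 + p * (U / W - 1) by apply: bern => //; rewrite p0.
have WU : W `^ p * (U / W) `^ p = U `^ p.
  by rewrite -powRM ?(ltW Y0)// mulrC divfK// gt_eqF.
have := ler_wpM2l (powR_ge0 W p) bern; rewrite WU.
have Wp : W `^ p = W * W `^ h.
  by rewrite -(mulr_powRB1 (ltW Y0) p0) (_ : p - 1 = h)//; rewrite /p; ring.
have -> : W `^ p * (1 + p * (U / W - 1)) = W `^ p - p * (W `^ h * (W - U)).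
  by rewrite Wp; field; rewrite gt_eqF.
move=> h2.
have h3 : W `^ h * y^-1 <= W `^ h * (W - U).
  by rewrite ler_wpM2l ?powR_ge0//; rewrite /W /U; lra.
have h4 : p^-1 * (p * (W `^ h * y^-1)) <= p^-1 * (W `^ p - U `^ p).
  rewrite ler_pM2l ?invr_gt0//.
  have : p * (W `^ h * y^-1) <= p * (W `^ h * (W - U)) by rewrite ler_pM2l.
  lra.
rewrite mulKf ?gt_eqF// in h4.
by move: h4; rewrite mulrBr; lra.
Qed.

Let harmonic_up n : (0 < n)%N -> \sum_(1 <= k < n.+1) (k%:R^-1 : R) <= 1 + ln n%:R.
Proof.
move=> n0; have := @power_sum 0 n _ n0; rewrite addr0 invr1 mul1r.
rewrite powRr1; last by rewrite addr_ge0// ln_ge0// ler1n.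
under eq_bigr do rewrite powRr0 mul1r.
by apply; rewrite lexx andbT; lra.
Qed.

Let harmonic_low m n : (0 < m)%N -> (m <= n)%N ->
  ln n%:R - ln m%:R <= \sum_(m <= k < n) (k%:R^-1 : R).
Proof.
move=> m0 /subnKC <-; elim: (n - m)%N => [|j IH].
  by rewrite addn0 subrr big_geq.
rewrite addnS big_nat_recr ?leq_addr//=.
set x : R := (m + j)%:R in IH *.
have x0 : 0 < x by rewrite ltr0n addn_gt0 m0.
have h : ln (x + 1) - ln x <= x^-1.
  rewrite -ln_div ?posrE ?addr_gt0//; apply: (le_trans (ln_le_subr1 _)).
    by rewrite divr_gt0// addr_gt0.
  by rewrite mulrDl divff ?gt_eqF// mul1r; lra.
rewrite -natr1 -/x; lra.
Qed.

Lemma weight_sumS n : weight_sum n.+1 = weight_sum n + weight a b n.+1.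
Proof. by rewrite /weight_sum big_nat_recr. Qed.

Lemma weight_sum_homo m n : (m <= n)%N -> weight_sum m <= weight_sum n.
Proof.
move=> /subnKC <-; elim: (n - m)%N => [|j IH]; first by rewrite addn0.
by rewrite addnS weight_sumS (le_trans IH)// lerDl weight_ge0.
Qed.

Let logt1 : logt (1 : R) = 1.
Proof.
rewrite /logt (_ : Num.max _ _ = expR 1) ?expRK//.
by apply: max_idPr; rewrite -[leLHS]expR0 ler_expR.
Qed.

Let V1 : V 1 = 1. Proof. by rewrite /V /loglogt !logt1 !powR1 mulr1. Qed.

Lemma weight_sum_ge1 n : (0 < n)%N -> 1 <= weight_sum n.
Proof.
move=> n0; apply: le_trans (weight_sum_homo n0).
by rewrite /weight_sum big_nat1 weightE V1 divr1.
Qed.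

Let logt_le_expR_loglogt (x : R) : logt x <= expR (loglogt x).
Proof. by rewrite /loglogt logtE le_max lexx. Qed.

Lemma weight_sum_up : exists2 A : R, 0 < A &
  forall n, (0 < n)%N -> weight_sum n <= 2 * expR (A * loglogt (n%:R : R)).
Proof.
exists (`|a| + `|b| + 1); first by rewrite ltr_wpDl.
move=> n n0; set N : R := n%:R.
have N1 : 1 <= N by rewrite ler1n.
have lN := logt_ge1 N.
have hV k : (1 <= k < n.+1)%N -> V k%:R <= logt N `^ (`|a| + `|b|).
  move=> /andP[k1 kn].
  have kN : logt (k%:R : R) <= logt N by apply: ler_logt; rewrite ler_nat.
  have up (u c : R) : 1 <= u -> u <= logt N -> u `^ c <= logt N `^ `|c|.
    move=> u1 uN; apply: (@le_trans _ _ (u `^ `|c|)); first by rewrite ler_powR// ler_norm.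
    have u0 : 0 <= u by lra.
    have N0 : 0 <= logt N by lra.
    by apply: ge0_ler_powR.
  rewrite powRD; last by rewrite (gt_eqF (logt_gt0 N)) implybT.
  apply: ler_pM; rewrite ?powR_ge0//; apply: up; rewrite ?logt_ge1 ?loglogt_ge1//.
  exact: le_trans (loglogt_le _) kN.
apply: (@le_trans _ _ (logt N `^ (`|a| + `|b|) * (1 + ln N))).
  apply: (@le_trans _ _ (logt N `^ (`|a| + `|b|) * \sum_(1 <= k < n.+1) (k%:R^-1 : R))).
    rewrite mulr_sumr /weight_sum big_seq [leRHS]big_seq; apply: ler_sum => k.
    rewrite mem_index_iota => hk; rewrite weightE ler_wpM2r ?invr_ge0//; exact: hV.
  by rewrite ler_wpM2l ?powR_ge0//; exact: harmonic_up.
have h1 : 1 + ln N <= 2 * logt N.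
  by have := ln_le_logt (lt_le_trans ltr01 N1); lra.
apply: (@le_trans _ _ (2 * logt N `^ (`|a| + `|b| + 1))).
  rewrite [X in _ <= 2 * X]powRD; last by rewrite (gt_eqF (logt_gt0 N)) implybT.
  rewrite powRr1 ?(ltW (logt_gt0 _))//.
  rewrite [leRHS](_ : _ = logt N `^ (`|a| + `|b|) * (2 * logt N)); last by ring.
  by rewrite ler_wpM2l ?powR_ge0.
rewrite ler_pM2l// mulrC expRM; apply: ge0_ler_powR.
- by rewrite !addr_ge0.
- by rewrite nnegrE ltW// logt_gt0.
- by rewrite nnegrE expR_ge0.
- exact: logt_le_expR_loglogt.
Qed.

(** [V_ratio] against the point 1 gives V(k) >= (log n)^g / K for k <= n, and the harmonic sum
    supplies one more power of log n, so the exponent is 1 + g. *)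
Lemma weight_sum_low : exists c1 c : R, [/\ 0 < c1, 0 < c &
  forall n, (0 < n)%N -> c * expR (c1 * loglogt (n%:R : R)) <= weight_sum n].
Proof.
have [g1 g0 _] := g_bounds; have [K hC Vratio] := V_ratio_ex.
set p := 1 + g; have p0 : 0 < p by rewrite /p; lra.
have C0 : 0 < K by lra.
exists p, (K^-1 / 2 * (expR 1 `^ p)^-1); split=> //.
  by apply: mulr_gt0; [rewrite divr_gt0// invr_gt0|rewrite invr_gt0 powR_gt0// expR_gt0].
move=> n n0; set N : R := n%:R.
have N1 : 1 <= N by rewrite ler1n.
have N0 : 0 < N by lra.
have lN := logt_ge1 N; have lN0 := logt_gt0 N.
have hV k : (1 <= k < n.+1)%N -> K^-1 * logt N `^ g <= V k%:R.
  move=> /andP[k1 kn].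
  have k1' : 1 <= k%:R :> R by rewrite ler1n.
  have := Vratio _ _ k1'; rewrite V1 logt1 div1r.
  have lk0 := logt_gt0 (k%:R : R).
  have -> : (logt (k%:R : R))^-1 `^ g = (logt (k%:R : R) `^ g)^-1.
    by rewrite -powR_inv1 ?(ltW lk0)// -powRrM mulN1r powRN.
  rewrite mulrA ler_pdivlMr ?powR_gt0// mul1r -ler_pdivrMl// => h.
  apply: le_trans h; rewrite ler_pM2l ?invr_gt0//.
  rewrite -[g]opprK powRN [leRHS]powRN lef_pV2 ?posrE ?powR_gt0//.
  apply: ge0_ler_powR; rewrite ?nnegrE ?oppr_ge0 ?(ltW lk0) ?(ltW lN0)//.
  by apply: ler_logt; rewrite ler_nat.
apply: (@le_trans _ _ (K^-1 * logt N `^ g * ln (N + 1))); last first.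
  apply: (@le_trans _ _ (K^-1 * logt N `^ g * \sum_(1 <= k < n.+1) (k%:R^-1 : R))).
    rewrite ler_wpM2l ?mulr_ge0 ?invr_ge0 ?powR_ge0 ?(ltW C0)//.
    by have := @harmonic_low 1 n.+1 isT isT; rewrite ln1 subr0 -natr1.
  rewrite mulr_sumr /weight_sum big_seq [leRHS]big_seq; apply: ler_sum => k.
  by rewrite mem_index_iota => hk; rewrite weightE ler_wpM2r ?invr_ge0//; exact: hV.
have h1 : logt N <= 2 * ln (N + 1).
  rewrite -ler_expR logtE (_ : 2 * ln (N + 1) = ln (N + 1) + ln (N + 1)); last by ring.
  rewrite expRD lnK ?posrE ?addr_gt0// ge_max; apply/andP; split; first by nra.
  rewrite (_ : 1 = 2^-1 + 2^-1 :> R); last by field.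
  by rewrite expRD; apply: ler_pM; rewrite ?expR_ge0//; apply: (le_trans expR_half_le2); lra.
have h2 : expR (p * loglogt N) <= expR 1 `^ p * logt N `^ p.
  rewrite mulrC expRM -powRM ?expR_ge0 ?(ltW lN0)//.
  apply: ge0_ler_powR; rewrite ?nnegrE ?(ltW p0) ?expR_ge0 ?mulr_ge0 ?expR_ge0 ?(ltW lN0)//.
  rewrite /loglogt logtE ge_max ler_peMl ?(ltW lN0)//= ?ler_peMr ?expR_ge0//.
  by rewrite -[leLHS]expR0 ler_expR.
apply: (@le_trans _ _ (K^-1 / 2 * (expR 1 `^ p)^-1 * (expR 1 `^ p * logt N `^ p))).
  by rewrite ler_wpM2l// mulr_ge0 ?divr_ge0 ?invr_ge0 ?(ltW C0) ?powR_ge0.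
have e0 : 0 < expR 1 `^ p :> R by rewrite powR_gt0 ?expR_gt0.
have pE : logt N `^ p = logt N `^ g * logt N.
  rewrite /p addrC powRD; last by rewrite (gt_eqF lN0) implybT.
  by rewrite powRr1 ?(ltW lN0).
rewrite pE [leLHS](_ : _ = K^-1 * logt N `^ g * (logt N / 2)); last by field; rewrite !gt_eqF.
by rewrite ler_wpM2l ?mulr_ge0 ?invr_ge0 ?powR_ge0 ?(ltW C0)//; lra.
Qed.

(** Squaring N only doubles its logarithm, so V changes little on ]N, N^2]: the sum over this block
    is at least, and the sum up to N at most, a constant times V(N) log N. For N >= 4 the truncation
    of the logarithm is inactive. *)
Lemma weight_sum_block : exists2 c : R, 0 < c &
  forall N, (4 <= N)%N -> c * weight_sum N <= weight_sum (N ^ 2) - weight_sum N.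
Proof.
have [g1 g0 _] := g_bounds; have [K hC Vratio] := V_ratio_ex.
set p := 1 + g; have p0 : 0 < p by rewrite /p; lra.
have p1 : p <= 1 by rewrite /p; lra.
have C0 : 0 < K by lra.
exists (p / (16 * K ^+ 2)); first by rewrite divr_gt0// mulr_gt0// exprn_gt0.
move=> n n4; set N : R := n%:R.
have N4 : 4 <= N by rewrite (ler_nat _ 4).
have N0 : 0 < N by lra.
have lN := logt_ge1 N; have lN0 := logt_gt0 N.
have two_g : (2^-1 : R) `^ g <= 2.
  rewrite -powR_inv1// -powRrM mulN1r.
  rewrite -[leRHS]powRr1//; apply: ler_powR; lra.
have lnN : logt N = ln N.
  rewrite /logt (_ : Num.max _ _ = N)//; apply: max_idPl.
  rewrite (_ : 1 = 2^-1 + 2^-1 :> R); last by field.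
  rewrite expRD; apply: le_trans N4; rewrite (_ : 4 = 2 * 2 :> R); last by ring.
  by apply: ler_pM; rewrite ?expR_ge0 ?expR_half_le2.
have VN := V_gt0 N.
have up : weight_sum n <= 4 * K / p * (V N * logt N).
  have hk k : (1 <= k < n.+1)%N ->
      weight a b k <= K * V N * (logt N `^ g)^-1 * 2 * ((1 + ln k%:R) `^ g / k%:R).
    move=> /andP[k1 kn].
    have k1' : 1 <= k%:R :> R by rewrite ler1n.
    have kN : k%:R <= N by rewrite ler_nat.
    have lk0 := logt_gt0 (k%:R : R).
    rewrite weightE mulrA ler_wpM2r ?invr_ge0//; apply: (le_trans (Vratio _ _ kN)).
    rewrite powRM ?(ltW lk0) ?invr_ge0 ?(ltW lN0)//.
    have -> : (logt N)^-1 `^ g = (logt N `^ g)^-1.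
      by rewrite -powR_inv1 ?(ltW lN0)// -powRrM mulN1r powRN.
    rewrite [leLHS](_ : _ = K * V N * (logt N `^ g)^-1 * logt (k%:R : R) `^ g); last by ring.
    rewrite -[leRHS]mulrA ler_wpM2l ?mulr_ge0 ?invr_ge0 ?powR_ge0 ?(ltW C0) ?(ltW VN)//.
    have L0 : 0 < 1 + ln k%:R :> R by have := ln_ge0 k1'; lra.
    apply: (@le_trans _ _ ((2^-1 * (1 + ln k%:R)) `^ g)).
      rewrite -[g]opprK powRN [leRHS]powRN lef_pV2 ?posrE ?powR_gt0 ?mulr_gt0//.
      apply: ge0_ler_powR; rewrite ?nnegrE ?oppr_ge0 ?(ltW lk0) ?mulr_ge0 ?(ltW L0)//.
      by have := ln_le_logt (lt_le_trans ltr01 k1'); have := logt_ge1 (k%:R : R); lra.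
    by rewrite powRM ?(ltW L0)// ler_wpM2r ?powR_ge0.
  apply: (@le_trans _ _ (K * V N * (logt N `^ g)^-1 * 2 * (p^-1 * (1 + ln N) `^ p))).
    apply: (@le_trans _ _ (K * V N * (logt N `^ g)^-1 * 2 * \sum_(1 <= k < n.+1) (1 + ln k%:R) `^ g / k%:R)).
      rewrite mulr_sumr /weight_sum big_seq [leRHS]big_seq; apply: ler_sum => k.
      by rewrite mem_index_iota; exact: hk.
    rewrite ler_wpM2l ?mulr_ge0 ?invr_ge0 ?powR_ge0 ?(ltW C0) ?(ltW VN)//.
    by apply: power_sum; [rewrite g1|exact: leq_trans n4].
  have h : (1 + ln N) `^ p <= 2 * logt N `^ p.
    apply: (@le_trans _ _ ((2 * logt N) `^ p)).
      apply: ge0_ler_powR; rewrite ?nnegrE ?(ltW p0) ?mulr_ge0 ?(ltW lN0)//.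
        by rewrite addr_ge0// -lnN ltW.
      by rewrite -lnN; lra.
    rewrite powRM ?(ltW lN0)// ler_wpM2r ?powR_ge0// ler1_powR//; lra.
  have pE : logt N `^ p = logt N `^ g * logt N.
    rewrite /p addrC powRD; last by rewrite (gt_eqF lN0) implybT.
    by rewrite powRr1 ?(ltW lN0).
  have lg0 : 0 < logt N `^ g by exact: powR_gt0.
  rewrite [leRHS](_ : _ = K * V N * (logt N `^ g)^-1 * 2 * (p^-1 * (2 * logt N `^ p))); last first.
    by rewrite pE; field; rewrite !gt_eqF.
  rewrite ler_wpM2l ?mulr_ge0 ?invr_ge0 ?powR_ge0 ?(ltW C0) ?(ltW VN)//.
  by rewrite ler_wpM2l ?invr_ge0 ?(ltW p0).
have nn : (n <= n ^ 2)%N by rewrite -{1}(expn1 n) leq_pexp2l// (leq_trans _ n4).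
have low : V N * logt N / (4 * K) <= weight_sum (n ^ 2) - weight_sum n.
  have -> : weight_sum (n ^ 2) - weight_sum n = \sum_(n.+1 <= k < (n ^ 2).+1) weight a b k.
    rewrite /weight_sum (@big_cat_nat _ _ _ n.+1 1 (n ^ 2).+1)//=; first by ring.
  have hk k : (n.+1 <= k < (n ^ 2).+1)%N -> V N / (2 * K) * k%:R^-1 <= weight a b k.
    move=> /andP[k1 kn]; rewrite weightE; apply: ler_wpM2r; first by rewrite invr_ge0.
    have Nk : N <= k%:R by rewrite ler_nat ltnW.
    have lk0 := logt_gt0 (k%:R : R).
    rewrite ler_pdivrMr ?mulr_gt0//; apply: (le_trans (Vratio _ _ Nk)).
    rewrite [leRHS](_ : _ = K * (V k%:R * 2)); last by ring.
    rewrite ler_pM2l// ler_pM2l ?V_gt0//; apply: le_trans two_g.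
    have r0 : 0 < logt N / logt (k%:R : R) by rewrite divr_gt0.
    rewrite -[g]opprK powRN [leRHS]powRN lef_pV2 ?posrE ?powR_gt0//.
    apply: ge0_ler_powR; rewrite ?nnegrE ?oppr_ge0 ?(ltW r0)//.
    rewrite ler_pdivlMr//.
    have : logt (k%:R : R) <= logt N + ln N.
      apply: le_trans (logt_mul_le _ _); try lra.
      by apply: ler_logt; rewrite /N -natrM ler_nat mulnn.
    by rewrite -lnN; lra.
  apply: (@le_trans _ _ (V N / (2 * K) * \sum_(n.+1 <= k < (n ^ 2).+1) (k%:R^-1 : R))); last first.
    rewrite mulr_sumr big_seq [leRHS]big_seq; apply: ler_sum => k.
    by rewrite mem_index_iota; exact: hk.
  rewrite [leLHS](_ : _ = V N / (2 * K) * (logt N / 2)); last by field; rewrite gt_eqF.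
  have q0 : 0 <= V N / (2 * K).
    by apply: divr_ge0; [exact: ltW|apply: mulr_ge0 => //; exact: ltW].
  apply: ler_wpM2l => //.
  have := @harmonic_low n.+1 (n ^ 2).+1 isT; rewrite ltnS => /(_ nn); apply: le_trans.
  have l1 : ln N + ln N <= ln ((n ^ 2).+1%:R : R).
    rewrite -lnM ?posrE// ler_ln ?posrE ?mulr_gt0//.
    by rewrite -natr1 /N -natrM mulnn; lra.
  have l2 : ln (n.+1%:R : R) <= ln N + ln N / 2.
    have -> : ln N / 2 = ln (Num.sqrt N) by rewrite -powR12_sqrt ?(ltW N0)// ln_powR mulrC.
    have s2 : 2 <= Num.sqrt N.
      have e2 : Num.sqrt (2 ^+ 2) = 2 :> R by rewrite sqrtr_sqr ger0_norm.
      by rewrite -[leLHS]e2 ler_wsqrtr//; lra.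
    rewrite -lnM ?posrE ?sqrtr_gt0// ler_ln ?posrE ?mulr_gt0 ?sqrtr_gt0// -natr1 -/N.
    have : N * 2 <= N * Num.sqrt N by rewrite ler_pM2l.
    lra.
  rewrite lnN; lra.
apply: le_trans low.
apply: (@le_trans _ _ (p / (16 * K ^+ 2) * (4 * K / p * (V N * logt N)))).
  by rewrite ler_wpM2l// divr_ge0 ?(ltW p0)// mulr_ge0// sqr_ge0.
by rewrite le_eqVlt; apply/orP; left; apply/eqP; field; rewrite !gt_eqF.
Qed.

End weights.

(** * Convergence of nonnegative series *)

Section summability.
Context {R : realType}.
Implicit Types f h : nat -> R.

Definition bounded_series f : Prop := exists M : R, forall N : nat, \sum_(1 <= n < N.+1) f n <= M.

Let partial_sum_homo f m n : (forall k, 0 <= f k) -> (m <= n)%N ->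
  \sum_(1 <= k < m.+1) f k <= \sum_(1 <= k < n.+1) f k.
Proof.
move=> f0 mn; rewrite (@big_cat_nat _ _ _ m.+1 1 n.+1)//=.
by rewrite lerDl; apply: sumr_ge0.
Qed.

Lemma bounded_seriesP f : (forall k, 0 <= f k) ->
  bounded_series f <-> (\sum_(1 <= n <oo) (f n)%:E < +oo)%E.
Proof.
move=> f0; have f0' (k : nat) : (1 <= k)%N -> true -> (0 <= (f k)%:E)%E by rewrite lee_fin.
split=> [[M hM]|hlt].
  have hM' m : \sum_(1 <= n < m) f n <= M.
    case: m => [|m]; last exact: hM.
    by rewrite big_geq//; apply: le_trans (hM 0%N); rewrite big_geq.
  apply: (@le_lt_trans _ _ M%:E); last exact: ltry.
  apply: lime_le; first exact: is_cvg_nneseries.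
  by near=> N; rewrite sumEFin lee_fin; exact: hM'.
exists (fine (\sum_(1 <= n <oo) (f n)%:E)%E) => N.
rewrite -lee_fin fineK; last first.
  by rewrite ge0_fin_numE//; apply: nneseries_ge0.
rewrite -sumEFin.
exact: nneseries_lim_ge.
Unshelve. all: by end_near. Qed.

Lemma not_bounded_seriesP f : (forall k, 0 <= f k) ->
  (~ bounded_series f) <-> (\sum_(1 <= n <oo) (f n)%:E = +oo)%E.
Proof.
move=> f0; rewrite (bounded_seriesP f0); split=> [h|->]; last by rewrite ltxx.
by apply/eqP; rewrite -leye_eq leNgt; apply/negP.
Qed.

Lemma bounded_series_le f h (c : R) n0 : (forall k, 0 <= f k) -> (forall k, 0 <= h k) -> 0 <= c ->
  (forall n, (n0 <= n)%N -> f n <= c * h n) -> bounded_series h -> bounded_series f.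
Proof.
move=> f0 h0 c0 fh [M hM].
exists (\sum_(1 <= k < n0.+1) f k + c * M) => N.
have key : \sum_(1 <= k < N.+1) f k <= \sum_(1 <= k < n0.+1) f k + c * \sum_(1 <= k < N.+1) h k.
  rewrite mulr_sumr; have [Nn|nN] := leqP N n0.
    apply: (le_trans (partial_sum_homo f0 Nn)); rewrite lerDl.
    by apply: sumr_ge0 => k _; exact: mulr_ge0.
  have nN' : (n0.+1 <= N.+1)%N by rewrite ltnS ltnW.
  rewrite (@big_cat_nat _ _ _ n0.+1 1 N.+1)//= lerD2l.
  rewrite [leRHS](@big_cat_nat _ _ _ n0.+1 1 N.+1)//=.
  rewrite -[leLHS]add0r; apply: lerD.
    by apply: sumr_ge0 => k _; exact: mulr_ge0.
  rewrite big_nat [leRHS]big_nat; apply: ler_sum => k /andP[k1 _]; apply: fh; exact: ltnW.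
apply: (le_trans key); rewrite lerD2l; exact: ler_wpM2l.
Qed.

Lemma bounded_seriesD f h : bounded_series f -> bounded_series h -> bounded_series (fun n => f n + h n).
Proof.
move=> [M hM] [M' hM']; exists (M + M') => N.
by rewrite big_split /=; exact: lerD.
Qed.

Lemma bounded_series_block f : (forall k, 0 <= f k) -> bounded_series f -> forall e : R, 0 < e ->
  exists N, forall m n, (N <= m)%N -> (m <= n)%N ->
    \sum_(1 <= k < n.+1) f k - \sum_(1 <= k < m.+1) f k < e.
Proof.
move=> f0 [M hM] e e0.
pose S := [set x : R | exists N, x = \sum_(1 <= k < N.+1) f k].
have hS : has_sup S.
  split; first by exists (\sum_(1 <= k < 1) f k), 0%N.
  by exists M => x [N ->].
have [_ [N ->] hN] := sup_adherent e0 hS.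
exists N => m n Nm mn.
have h1 : \sum_(1 <= k < n.+1) f k <= sup S.
  by apply: ub_le_sup; [exact: hS.2|exists n].
have h2 := partial_sum_homo f0 Nm.
lra.
Qed.

End summability.

(** * The theorems of Abel and Dini for the weights *)

Section abel_dini.
Context {R : realType}.
Variables (a b : R).
Hypotheses (ha : -1 < a) (hb : -1 < b).

Let B := weight_sum a b.

Lemma weight_sum_unbounded (M : R) : exists N, forall n, (N <= n)%N -> M <= B n.
Proof.
have [c c0 hc] := weight_sum_block ha hb.
have B4 : 1 <= B 4 by exact: weight_sum_ge1.
have h j : exists N, 1 + j%:R * c <= B N /\ (4 <= N)%N.
  elim: j => [|j [N [IH N4]]]; first by exists 4%N; rewrite mul0r addr0.
  exists (N ^ 2)%N; split; last by rewrite (leq_trans N4)// -{1}(expn1 N) leq_pexp2l// (leq_trans _ N4).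
  have := hc N N4; rewrite -/B.
  have : c * 1 <= c * B N.
    by rewrite ler_pM2l// /B weight_sum_ge1// (leq_trans _ N4).
  rewrite -natr1; lra.
have [N [hN _]] := h (Num.truncn (`|M| / c)).+1.
exists N => n Nn; apply: le_trans (weight_sum_homo _ _ Nn); apply: le_trans hN.
have : `|M| / c < (Num.truncn (`|M| / c)).+1%:R by exact: truncnS_gt.
rewrite ltr_pdivrMr//; have := ler_norm M; lra.
Qed.

(** From any index N + 1 on there is a block with B n >= 2 B (N + 1), and it contributes at least (B
    n - B (N + 1)) / B n >= 1/2. *)
Lemma abel_dini_div : ~ bounded_series (fun n => weight a b n / B n).
Proof.
have B0 n : (0 < n)%N -> 0 < B n.
  by move=> n0; rewrite (lt_le_trans ltr01)// /B weight_sum_ge1.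
have B0' n : 0 <= B n.
  by case: n => [|n]; [rewrite /B /weight_sum big_geq|rewrite ltW// B0].
move=> /bounded_series_block h; have [||N hN] := h _ (2^-1); rewrite ?invr_gt0//.
  by move=> k; rewrite divr_ge0// weight_ge0.
have [N' hN'] := weight_sum_unbounded (2 * B N.+1).
pose n := maxn N' N.+1.
have nN : (N.+1 <= n)%N by rewrite leq_maxr.
have := hN N.+1 n (leqnSn _) nN; apply/negP; rewrite -leNgt.
have Bn : 2 * B N.+1 <= B n by apply: hN'; rewrite leq_maxl.
have n0 : (0 < n)%N by exact: leq_trans nN.
have Bn0 : 0 < B n by exact: B0.
rewrite (@big_cat_nat _ _ _ N.+2 1 n.+1)//=.
rewrite [X in _ <= X](_ : _ = \sum_(N.+2 <= i < n.+1) weight a b i / B i); last by ring.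
apply: (@le_trans _ _ ((B n - B N.+1) / B n)).
  by rewrite ler_pdivlMr//; lra.
have -> : B n - B N.+1 = \sum_(N.+2 <= i < n.+1) weight a b i.
  by rewrite /B /weight_sum (@big_cat_nat _ _ _ N.+2 1 n.+1)//=; ring.
rewrite mulr_suml big_nat [leRHS]big_nat; apply: ler_sum => k /andP[k1 k2].
rewrite ler_wpM2l ?weight_ge0// lef_pV2 ?posrE ?B0//; last exact: leq_trans k1.
exact: weight_sum_homo.
Qed.

(** Telescoping: with consecutive sums x and y, w / y <= ln y - ln x bounds the term by (x^(-g) -
    y^(-g)) / g. The first term is 1 because B 1 = 1. *)
Lemma abel_dini_cvg (g : R) : 0 < g ->
  bounded_series (fun n => weight a b n * expR (- (1 + g) * ln (B n))).
Proof.
move=> g0; exists (1 + g^-1) => N.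
have B1 n : (0 < n)%N -> 1 <= B n by exact: weight_sum_ge1.
case: N => [|N]; first by rewrite big_geq// addr_ge0// invr_ge0 ltW.
suff : \sum_(1 <= n < N.+2) weight a b n * expR (- (1 + g) * ln (B n)) <=
    1 + g^-1 * (1 - expR (- g * ln (B N.+1))).
  move=> /le_trans; apply; have g0' : 0 <= g^-1 by rewrite invr_ge0 ltW.
  have := mulr_ge0 g0' (expR_ge0 (- g * ln (B N.+1))); rewrite mulrBr; lra.
elim: N => [|N IH].
  rewrite big_nat1 (_ : weight a b 1 = B 1); last by rewrite /B /weight_sum big_nat1.
  have -> : B 1 = 1.
    apply/le_anti; rewrite B1// andbT.
    rewrite /B /weight_sum big_nat1 /weight /loglogt.
    have logt1 : logt (1 : R) = 1.
      rewrite /logt (_ : Num.max _ _ = expR 1) ?expRK//.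
      by apply: max_idPr; rewrite -[leLHS]expR0 ler_expR.
    by rewrite !logt1 !powR1 mulr1 divr1.
  by rewrite ln1 !mulr0 expR0 subrr mulr0 addr0 mulr1.
rewrite big_nat_recr//=; apply: (le_trans (lerD IH (lexx _))).
have BS : B N.+2 = B N.+1 + weight a b N.+2 by exact: weight_sumS.
have w0 := weight_ge0 a b N.+2.
have b1 := B1 N.+1 isT; have b2 := B1 N.+2 isT.
move: (B N.+1) (B N.+2) (weight a b N.+2) BS w0 b1 b2 => x y w yx w0 x1 y1.
have x0 : 0 < x by lra.
have y0 : 0 < y by lra.
have h1 : w / y <= ln y - ln x.
  have := @ln_le_subr1 R (x / y); rewrite ln_div ?posrE// divr_gt0// => /(_ isT).
  have -> : x / y - 1 = - (w / y) by rewrite (_ : x = y - w); [field; rewrite gt_eqF|lra].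
  lra.
have h2 : expR (- g * ln y) * (g * (w / y)) <= expR (- g * ln x) - expR (- g * ln y).
  have -> : expR (- g * ln x) = expR (- g * ln y) * expR (g * (ln y - ln x)).
    by rewrite -expRD; congr expR; ring.
  rewrite -[X in _ - X]mulr1 -mulrBr ler_wpM2l ?expR_ge0//.
  have := expR_ge1Dx (g * (ln y - ln x)).
  have : g * (w / y) <= g * (ln y - ln x) by rewrite ler_pM2l.
  lra.
have e : w * expR (- (1 + g) * ln y) = g^-1 * (expR (- g * ln y) * (g * (w / y))).
  have -> : expR (- (1 + g) * ln y) = expR (- g * ln y) / y.
    have -> : - (1 + g) * ln y = - g * ln y + - ln y by ring.
    by rewrite expRD expRN lnK.
  by field; rewrite !gt_eqF.
have h3 : g^-1 * (expR (- g * ln y) * (g * (w / y))) <= g^-1 * (expR (- g * ln x) - expR (- g * ln y)).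
  by rewrite ler_pM2l ?invr_gt0.
rewrite e; move: h3; rewrite !mulrBr; lra.
Qed.

End abel_dini.

(** * Small ball probabilities at the critical scale *)

Section asymptotics.
Context {R : realType}.

(** The truncation level n^(1/4): negligible against the radius, which is at least of order sqrt (n
    / loglog n), while its iterated logarithm is comparable with that of n. *)
Definition quarter (n : nat) : R := expR (ln n%:R / 4).

Lemma near_loglogt (M : R) : \forall n \near \oo, M <= loglogt (n%:R : R).
Proof.
near=> n.
have h : expR (expR M) <= n%:R by near: n; exact: nbhs_infty_ger.
rewrite /loglogt -[M]expRK; apply: (@le_trans _ _ (ln (logt (n%:R : R)))).
  rewrite ler_ln ?posrE ?expR_gt0 ?logt_gt0//.
  by rewrite -ler_expR logtE le_max h.
by apply: ln_le_logt; exact: logt_gt0.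
Unshelve. all: by end_near. Qed.

(** The power 5 is 4 + 1: the squared small jump conditions cost loglog^4, for e of order 1 / loglog
    n, and the squared radius may be as small as n / loglog n. Against the squared jump level sqrt
    n, a room of sqrt n is left. *)
Lemma near_loglogt_expn (D : R) :
  \forall n \near \oo, D * loglogt (n%:R : R) ^+ 5 <= Num.sqrt (n%:R : R).
Proof.
have [c c0 hexp] : exists2 c : R, 0 < c & forall x, 0 <= x -> x ^+ 6 / c <= expR x.
  exists (6`!%:R); first by rewrite ltr0n fact_gt0.
  by move=> x x0; apply: le_trans (expR_ge1Dxn 5 x0); rewrite lerDr.
near=> n.
have n1 : 1 <= n%:R :> R by near: n; exact: nbhs_infty_ger.
have n0 : 0 < n%:R :> R by lra.
have hl : `|D| * (c * 2 ^+ 6) * 2 ^+ 5 <= ln (n%:R : R).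
  rewrite -ler_expR lnK//; near: n; exact: nbhs_infty_ger.
have hl1 : 1 <= ln (n%:R : R).
  rewrite -ler_expR lnK//; near: n; exact: nbhs_infty_ger.
set l := ln _ in hl hl1.
have l0 : 0 <= l by lra.
have Ll : loglogt (n%:R : R) <= 2 * l.
  apply: (le_trans (loglogt_le _)); apply: (le_trans (logt_le_1ln n1)); rewrite -/l; lra.
have L0 : 0 <= loglogt (n%:R : R) by rewrite (le_trans _ (loglogt_ge1 _)).
have sq : Num.sqrt (n%:R : R) = expR (l / 2).
  by rewrite -powR12_sqrt ?ltW// /powR gt_eqF// mulrC.
rewrite sq; have l2 : 0 <= l / 2 by lra.
apply: le_trans (hexp _ l2); rewrite ler_pdivlMr//.
apply: (@le_trans _ _ (`|D| * (2 * l) ^+ 5 * c)).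
  rewrite ler_pM2r//; apply: (@le_trans _ _ (`|D| * loglogt (n%:R : R) ^+ 5)).
    by rewrite ler_wpM2r ?exprn_ge0// ler_norm.
  by rewrite ler_wpM2l// lerXn2r ?nnegrE// mulr_ge0.
have : l ^+ 5 * (`|D| * (c * 2 ^+ 6) * 2 ^+ 5) <= l ^+ 5 * l by rewrite ler_wpM2l// exprn_ge0.
have -> : l ^+ 5 * l = l ^+ 6 by ring.
have -> : (l / 2) ^+ 6 = l ^+ 6 / 2 ^+ 6 by field.
have -> : l ^+ 5 * (`|D| * (c * 2 ^+ 6) * 2 ^+ 5) = 2 ^+ 6 * (`|D| * (2 * l) ^+ 5 * c) by ring.
by rewrite ler_pdivlMr ?exprn_gt0// mulrC.
Unshelve. all: by end_near. Qed.

Lemma near_quarter (M : R) : \forall n \near \oo,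
  [/\ M <= quarter n, loglogt (n%:R : R) / 2 <= loglogt (quarter n) &
      quarter n ^+ 2 = Num.sqrt n%:R].
Proof.
near=> n.
have n1 : 1 <= n%:R :> R by near: n; exact: nbhs_infty_ger.
have n0 : 0 < n%:R :> R by lra.
have l1 : 4 * expR 1 <= ln (n%:R : R).
  rewrite -ler_expR lnK//; near: n; exact: nbhs_infty_ger.
have l2 : 4 * `|M| <= ln (n%:R : R).
  rewrite -ler_expR lnK//; near: n; exact: nbhs_infty_ger.
have l6 : 6 <= loglogt (n%:R : R) by near: n; exact: near_loglogt.
split.
- apply: le_trans (expR_ge1Dx _); have := ler_norm M; lra.
- have e0 := expR_gt0 (1 : R).
  have lt : ln (n%:R : R) / 4 <= logt (quarter n).
    by rewrite -[leLHS]expRK ln_le_logt// /quarter expR_gt0.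
  have lnn : logt (n%:R : R) <= 2 * ln (n%:R : R).
    have e1 : 1 <= expR 1 :> R by rewrite -[leLHS]expR0 ler_expR.
    by apply: (le_trans (logt_le_1ln n1)); lra.
  have l8 : logt (n%:R : R) / 8 <= logt (quarter n) by lra.
  rewrite {2}/loglogt; apply: (@le_trans _ _ (ln (logt (quarter n)))); last first.
    by apply: ln_le_logt; exact: logt_gt0.
  apply: (@le_trans _ _ (ln (logt (n%:R : R) / 8))); last first.
    by rewrite ler_ln ?posrE ?divr_gt0 ?logt_gt0.
  have lg := logt_gt0 (n%:R : R).
  rewrite ln_div ?posrE//.
  have L : loglogt (n%:R : R) = ln (logt (n%:R : R)).
    rewrite /loglogt {1}/logt (_ : Num.max _ _ = logt (n%:R : R))//.
    apply: max_idPl; apply: le_trans (ln_le_logt n0); lra.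
  have : ln 8 <= 3 :> R.
    have -> : 8 = 2 ^+ 3 :> R by ring.
    have -> : ln (2 ^+ 3) = 3 * ln 2 :> R by rewrite lnXn// -[LHS]mulr_natl.
    have := @ln_le_subr1 R 2 (ltr0Sn _ 1); lra.
  rewrite L in l6 *; lra.
- rewrite /quarter -expRM_natr -powR12_sqrt ?ltW// /powR gt_eqF//.
  by congr expR; field.
Unshelve. all: by end_near. Qed.

End asymptotics.

(** * Estimates uniform over the critical range of 1 / y^2 *)

Section small_ball_asymptotics.
Context d (T : measurableType d) (R : realType) (P : probability T R).
Variables (X : nat -> {RV P >-> R}) (hX : iid X) (s2 sigma : R).
Hypotheses (m1 : ('E_P[X 0%N] = 0)%E) (sg0 : 0 < sigma).
Hypothesis m2 : ('E_P[(fun w => X 0%N w ^+ 2)%R])%E = s2%:E.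

Lemma tail2_cvg0 (e : R) : 0 < e -> exists t0, forall t, t0 <= t -> tail2 (X 0%N) t <= e.
Proof.
move=> e0.
have cv : (\int[P]_w (tail_sqr k%:R (X 0%N w))%:E)%E @[k --> \oo] --> (\int[P]_w (cst 0%E) w)%E.
  apply: (@dominated_cvg _ _ _ P setT measurableT (fun k w => (tail_sqr k%:R (X 0%N w))%:E) (cst 0%E) (fun w => (X 0%N w ^+ 2)%:E)).
  - by move=> k; exact: measurable_int (integrable_tail_sqr m2 _).
  - move=> w _; apply: cvg_near_cst; near=> k.
    rewrite /tail_sqr ifF//; apply/negbTE; rewrite -ltNge.
    near: k; exact: nbhs_infty_gtr.
  - by [].
  - exact: integrable_sqr m2.
  - move=> k w _; rewrite abse_EFin lee_fin /tail_sqr; case: ifP => _.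
      by rewrite ger0_norm// sqr_ge0.
    by rewrite normr0 sqr_ge0.
have {cv} cv : (tail2 (X 0%N) k%:R)%:E @[k --> \oo] --> (0%R)%:E.
  move: cv; rewrite integral0 => cv.
  by under eq_fun do rewrite -(tail2E m2) trunc_moment2E.
move/fine_cvgP : cv => [_ /cvgrPdist_le/(_ _ e0)[N _ hN]].
exists N%:R => t Nt; apply: (le_trans (tail2_anti m2 Nt)).
have := hN N (leqnn N); rewrite /= sub0r normrN; apply: le_trans; exact: ler_norm.
Unshelve. all: by end_near. Qed.

Definition ball_radius (n : nat) (y : R) : R := Num.sqrt (sigma ^+ 2 * pi ^+ 2 * n%:R / 8) * y.

Definition ball_prob (n : nat) (y : R) : R :=
  fine (P [set w | max_abs_sum X n w <= ball_radius n y]).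

Lemma ball_radius_ge0 n y : 0 <= y -> 0 <= ball_radius n y.
Proof. by move=> y0; rewrite mulr_ge0// sqrtr_ge0. Qed.

Lemma ball_probE n y : 0 <= y ->
  P [set w | max_abs_sum X n w <= ball_radius n y] = (ball_prob n y)%:E.
Proof.
move=> y0; rewrite fineK//; apply: fin_num_measure.
by apply: measurable_alive; exact: ball_radius_ge0.
Qed.

Lemma ball_prob_ge0 n y : 0 <= ball_prob n y.
Proof. by apply: fine_ge0; exact: measure_ge0. Qed.

Lemma ball_prob_homo n y y' : 0 <= y -> y <= y' -> ball_prob n y <= ball_prob n y'.
Proof.
move=> y0 yy; have y'0 := le_trans y0 yy.
rewrite -lee_fin -!ball_probE//; apply: le_measure; rewrite ?inE.
- by apply: measurable_alive; exact: ball_radius_ge0.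
- by apply: measurable_alive; exact: ball_radius_ge0.
- by move=> w /= /le_trans; apply; rewrite ler_wpM2l// sqrtr_ge0.
Qed.

Let ball_radius_sqr n y : ball_radius n y ^+ 2 = sigma ^+ 2 * pi ^+ 2 * n%:R / 8 * y ^+ 2.
Proof.
rewrite exprMn sqr_sqrtr//; apply: divr_ge0 => //; apply: mulr_ge0 => //.
by apply: mulr_ge0; exact: sqr_ge0.
Qed.

(* [1 / y ^+ 2 <= A * loglogt n] keeps the radius above [c * sqrt (n / loglog n)]. *)
Let near_radius (A D : R) : 0 < A -> \forall n \near \oo, forall y, 0 < y ->
  (y ^+ 2)^-1 <= A * loglogt (n%:R : R) ->
  0 < ball_radius n y /\ D * loglogt (n%:R : R) ^+ 4 * quarter n ^+ 2 <= ball_radius n y ^+ 2.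
Proof.
move=> A0; near=> n => y y0 hy.
have n1 : 1 <= n%:R :> R by near: n; exact: nbhs_infty_ger.
have n0 : 0 < n%:R :> R by lra.
have p0 := @pi_gt0 R.
have K0 : 0 < sigma ^+ 2 * pi ^+ 2 / 8 by rewrite divr_gt0 ?mulr_gt0 ?exprn_gt0.
have L1 := loglogt_ge1 (n%:R : R).
have [_ _ q2] : [/\ 0 <= quarter n :> R, loglogt (n%:R : R) / 2 <= loglogt (quarter n) &
      quarter n ^+ 2 = Num.sqrt (n%:R : R)] by near: n; exact: near_quarter.
have big : (A * `|D| / (sigma ^+ 2 * pi ^+ 2 / 8)) * loglogt (n%:R : R) ^+ 5 <= Num.sqrt (n%:R : R).
  by near: n; exact: near_loglogt_expn.
split.
  apply: mulr_gt0 => //; rewrite sqrtr_gt0.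
  by rewrite (_ : _ / 8 = sigma ^+ 2 * pi ^+ 2 / 8 * n%:R); [exact: mulr_gt0|ring].
rewrite q2 ball_radius_sqr.
set L := loglogt _ in hy L1 big *; set s := Num.sqrt n%:R in big *.
have L0 : 0 < L by lra.
have s0 : 0 <= s by exact: sqrtr_ge0.
have ns : n%:R = s * s by rewrite -expr2 sqr_sqrtr// ltW.
have y2 : 0 < y ^+ 2 by exact: exprn_gt0.
have hy' : 1 <= A * L * y ^+ 2 by rewrite -ler_pdivrMr// mul1r.
apply: (@le_trans _ _ (`|D| * L ^+ 4 * s * (A * L * y ^+ 2))).
  have L40 : 0 <= L ^+ 4 by exact/exprn_ge0/ltW.
  have D4 : 0 <= `|D| * L ^+ 4 * s by apply: mulr_ge0 => //; exact: mulr_ge0.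
  apply: (@le_trans _ _ (`|D| * L ^+ 4 * s)); last exact: ler_peMr.
  by rewrite ler_wpM2r// ler_wpM2r// ler_norm.
have h : sigma ^+ 2 * pi ^+ 2 / 8 * y ^+ 2 * s * ((A * `|D| / (sigma ^+ 2 * pi ^+ 2 / 8)) * L ^+ 5)
   <= sigma ^+ 2 * pi ^+ 2 / 8 * y ^+ 2 * s * s.
  by apply: ler_wpM2l => //; apply: mulr_ge0 => //; apply: mulr_ge0; exact: ltW.
rewrite ns.
rewrite [leRHS](_ : _ = sigma ^+ 2 * pi ^+ 2 / 8 * y ^+ 2 * s * s); last by ring.
apply: le_trans h; move: K0 {big}; move: (sigma ^+ 2 * pi ^+ 2 / 8) => K K0.
by rewrite le_eqVlt; apply/orP; left; apply/eqP; field; rewrite gt_eqF.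
Unshelve. all: by end_near. Qed.

Let exponentE n y : 0 < y -> (0 < n)%N ->
  pi ^+ 2 * s2 * n%:R / (8 * ball_radius n y ^+ 2) = s2 / sigma ^+ 2 * (y ^+ 2)^-1.
Proof.
move=> y0 n0; rewrite ball_radius_sqr; have := @pi_gt0 R; move: (pi : R) => q q0; field.
by rewrite !gt_eqF ?ltr0n.
Qed.

(** The precision [e] is left free: the direct part takes it of order 1 / loglog n, the comparison
    of variances takes it constant. *)
Lemma small_ball_upper_asym (A K : R) : 0 < s2 -> 0 < A -> 0 < K ->
  \forall n \near \oo, forall y e, 0 < y -> (y ^+ 2)^-1 <= A * loglogt (n%:R : R) ->
    K / loglogt (n%:R : R) <= e -> e <= 128^-1 -> tail2 (X 0%N) (quarter n) <= e * s2 / 10 ->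
    ball_prob n y <= 24 * expR 1 * expR (- (s2 / sigma ^+ 2 * (y ^+ 2)^-1 * (1 - 40 * e))).
Proof.
move=> s20 A0 K0; near=> n => y e y0 hy Ke e128 ht.
have n1 : (0 < n)%N by near: n; exact: nbhs_infty_gt.
have L1 := loglogt_ge1 (n%:R : R).
have L0 : 0 < loglogt (n%:R : R) by lra.
have [q1 _ _] : [/\ 1 <= quarter n :> R, loglogt (n%:R : R) / 2 <= loglogt (quarter n) &
      quarter n ^+ 2 = Num.sqrt (n%:R : R)] by near: n; exact: near_quarter.
have [r0 hr] : 0 < ball_radius n y /\
    (4 / K ^+ 4 + 4 * s2) * loglogt (n%:R : R) ^+ 4 * quarter n ^+ 2 <= ball_radius n y ^+ 2.
  by move: y y0 hy {Ke}; near: n; exact: near_radius.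
have e0 : 0 < e by apply: lt_le_trans Ke; rewrite divr_gt0.
have q0 : 0 <= quarter n :> R by exact: expR_ge0.
set L := loglogt _ in L1 L0 hr Ke hy.
have W1 : 1 <= L ^+ 4 * quarter n ^+ 2 by rewrite mulr_ege1// exprn_ege1.
have a0 : 0 <= 4 / K ^+ 4 by rewrite divr_ge0// exprn_ge0// ltW.
rewrite -mulrA in hr; set W := L ^+ 4 * quarter n ^+ 2 in hr W1.
have b0 : 0 <= 4 * s2 by rewrite mulr_ge0// ltW.
have aW : 0 <= 4 / K ^+ 4 * W by rewrite mulr_ge0//; lra.
have bW : 4 * s2 * 1 <= 4 * s2 * W by rewrite ler_wpM2l.
have hr1 : 4 / K ^+ 4 * W <= ball_radius n y ^+ 2 by apply: le_trans hr; rewrite mulrDl; lra.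
have hr2 : 4 * s2 <= ball_radius n y ^+ 2 by apply: le_trans hr; rewrite mulrDl; lra.
have sj : 2 * quarter n <= e ^+ 2 * ball_radius n y.
  have A1 : 0 <= 2 * quarter n :> R by exact: mulr_ge0.
  have A2 : 0 <= e ^+ 2 * ball_radius n y by rewrite mulr_ge0 ?sqr_ge0// ltW.
  rewrite -ler_sqr ?nnegrE// exprMn [leRHS]exprMn.
  have h : (K / L) ^+ 4 <= e ^+ 4.
    by rewrite lerXn2r ?nnegrE ?(ltW e0)// divr_ge0// ltW.
  rewrite -exprM; apply: (@le_trans _ _ ((K / L) ^+ 4 * ball_radius n y ^+ 2)); last first.
    by rewrite ler_wpM2r// sqr_ge0.
  apply: (@le_trans _ _ ((K / L) ^+ 4 * (4 / K ^+ 4 * W))); last first.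
    by rewrite ler_wpM2l// exprn_ge0// divr_ge0// ltW.
  by rewrite /W le_eqVlt; apply/orP; left; apply/eqP; field; rewrite !gt_eqF.
have he : 0 < e <= 128^-1 by rewrite e0.
have := small_ball_upper n hX s20 m1 m2 he r0 q0 sj ht hr2.
by rewrite exponentE// ball_probE ?(ltW y0)// lee_fin.
Unshelve. all: by end_near. Qed.

(** Choosing k with equality in the requirement of [small_ball_lower] turns s2 - T + 4 k s2, with T
    the tail at [u], into the displayed exponent: 40 is 4 * 10, and - T + 4 T / 8 = - T / 2. The
    second order term of the exponent and the term in th t cost at most 1 each, hence exp (- 2). *)
Lemma small_ball_lower_asym (A : R) : 0 < A ->
  \forall n \near \oo, forall y, 0 < y -> (y ^+ 2)^-1 <= A * loglogt (n%:R : R) ->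
    exists2 u, u <= 64 * ball_radius n y &
    2^-1 * expR (- 2) * expR (- ((sigma ^+ 2)^-1 * (y ^+ 2)^-1 *
      (s2 - tail2 (X 0%N) u / 2 + 40 * (tail2 (X 0%N) (quarter n) - tail2 (X 0%N) u))))
    <= ball_prob n y.
Proof.
move=> A0; have sg2 : 0 < sigma ^+ 2 by exact: exprn_gt0.
have s20 : 0 <= s2 by apply: le_trans (tail2_ge0 m2 0) (tail2_le m2 0).
(* M will bound the ratio of radius to jump level: 100 keeps k below 1/2, the other bound keeps the
   contribution of th t to the exponent below 1. *)
have [M M100 M8] : exists2 M, 100 <= M & 8 * A * s2 / sigma ^+ 2 <= M.
  by exists (Num.max 100 (8 * A * s2 / sigma ^+ 2)); rewrite le_max lexx ?orbT.
pose E := A * (3 * s2 / sigma ^+ 2).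
(* The degenerate case s2 = 0 has to be kept: the converse uses this bound before the variance is
   known to be positive. *)
have [t0 ht0] : exists t0, forall t, t0 <= t -> tail2 (X 0%N) t <= s2 / 100.
  have [s2p|s2n] := ltP 0 s2; first by apply: tail2_cvg0; rewrite divr_gt0.
  have -> : s2 = 0 by apply/le_anti; rewrite s2n.
  by exists 0 => t _; rewrite mul0r -(_ : s2 = 0) ?tail2_le//; apply/le_anti; rewrite s2n.
near=> n => y y0 hy.
have n1 : 1 <= n%:R :> R by near: n; exact: nbhs_infty_ger.
have n0 : 0 < n%:R :> R by lra.
have n0' : (0 < n)%N by rewrite -(ltr0n R).
have L1 := loglogt_ge1 (n%:R : R).
have L0 : 0 < loglogt (n%:R : R) by lra.
have [q1 _ _] : [/\ 1 + `|t0| <= quarter n :> R, loglogt (n%:R : R) / 2 <= loglogt (quarter n) &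
      quarter n ^+ 2 = Num.sqrt (n%:R : R)] by near: n; exact: near_quarter.
have [r0 hr] : 0 < ball_radius n y /\
    (4 * M ^+ 2 + 12 * s2) * loglogt (n%:R : R) ^+ 4 * quarter n ^+ 2 <= ball_radius n y ^+ 2.
  by move: y y0 hy; near: n; exact: near_radius.
have hE : 2 * E ^+ 2 * loglogt (n%:R : R) ^+ 5 <= Num.sqrt (n%:R : R).
  by near: n; exact: near_loglogt_expn.
set L := loglogt _ in L1 L0 hr hy hE.
set t : R := quarter n in q1 hr *.
set r := ball_radius n y in r0 hr *.
have tt0 : t0 <= t by have := ler_norm t0; lra.
have t1 : 1 <= t by have := normr_ge0 t0; lra.
set th := pi / (2 * r).
have p0 := @pi_gt0 R; have p2 := @pihalf_ge1 R; have p4 := @pihalf_lt2 R.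
have th0 : 0 < th by rewrite divr_gt0// mulr_gt0.
have thrE : th * r = pi / 2 by rewrite /th; move: (pi : R) => q; field; rewrite gt_eqF.
have thr : th * r <= 2 by rewrite thrE ltW.
have W1 : 1 <= L ^+ 4 * t ^+ 2 by rewrite mulr_ege1// exprn_ege1.
have hr1 : (2 * M * (L ^+ 2 * t)) ^+ 2 <= r ^+ 2.
  apply: le_trans hr.
  rewrite [leRHS](_ : _ = 4 * M ^+ 2 * (L ^+ 4 * t ^+ 2) + 12 * s2 * (L ^+ 4 * t ^+ 2)); last by ring.
  have -> : (2 * M * (L ^+ 2 * t)) ^+ 2 = 4 * M ^+ 2 * (L ^+ 4 * t ^+ 2) by ring.
  rewrite lerDl; apply: mulr_ge0; last exact: le_trans W1.
  exact: mulr_ge0.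
have hr2 : 12 * s2 <= r ^+ 2.
  apply: le_trans hr.
  rewrite [leRHS](_ : _ = 4 * M ^+ 2 * (L ^+ 4 * t ^+ 2) + 12 * s2 * (L ^+ 4 * t ^+ 2)); last by ring.
  have : 12 * s2 * 1 <= 12 * s2 * (L ^+ 4 * t ^+ 2) by rewrite ler_wpM2l// mulr_ge0.
  have : 0 <= 4 * M ^+ 2 * (L ^+ 4 * t ^+ 2).
    apply: mulr_ge0; last exact: le_trans W1.
    by apply: mulr_ge0 => //; exact: sqr_ge0.
  lra.
have hr3 : 2 * M * (L ^+ 2 * t) <= r.
  have M0 : 0 <= M by exact: le_trans M100.
  have t0' : 0 <= t by exact: le_trans t1.
  have hl : 0 <= 2 * M * (L ^+ 2 * t) by apply: mulr_ge0; apply: mulr_ge0 => //; exact: sqr_ge0.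
  by rewrite ler_sqr ?nnegrE ?(ltW r0) in hr1.
have tht0 : 0 <= th * t by rewrite mulr_ge0 ?(ltW th0)//; lra.
have tht : M * (L ^+ 2 * (th * t)) <= 1.
  have := ler_wpM2l (ltW th0) hr3.
  have -> : th * (2 * M * (L ^+ 2 * t)) = 2 * (M * (L ^+ 2 * (th * t))) by ring.
  lra.
have L2 : 1 <= L ^+ 2 by rewrite exprn_ege1.
have tht' : L * (th * t) <= L ^+ 2 * (th * t).
  by rewrite ler_wpM2r// expr2 ler_peMr// ltW.
have tht2 : th * t <= L ^+ 2 * (th * t) by rewrite ler_peMl.
have tht3 : 100 * (th * t) <= 1.
  apply: le_trans tht; apply: ler_pM => //; lra.
have tht4 : 8 * A * s2 / sigma ^+ 2 * (L * (th * t)) <= 1.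
  apply: le_trans tht; apply: ler_pM => //.
  - by rewrite divr_ge0 ?(ltW sg2)// mulr_ge0// mulr_ge0// ltW.
  - by rewrite mulr_ge0// ltW.
clearbody L t; set u := 64 / th.
have thu : th * u = 64 by rewrite /u; field; rewrite gt_eqF.
have tu : t <= u by rewrite -(ler_pM2l th0) thu; lra.
exists u.
  rewrite /u ler_pdivrMr// (_ : 64 * r * th = 64 * (th * r)); last by ring.
  by rewrite thrE; lra.
set e1 := tail2 _ t; set e2 := tail2 _ u.
have e20 : 0 <= e2 := tail2_ge0 m2 u.
have e12 : e2 <= e1 := tail2_anti m2 tu.
have e1s : e1 <= s2 / 100 by exact: ht0.
have [k [hk kE]] : exists k, 0 <= k <= 2^-1 /\
    k * s2 = 2 * (th * t) * s2 + 10 * (e1 - e2) + e2 / 8.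
  have [s2p|s2n] := ltP 0 s2; last first.
    have s2z : s2 = 0 by apply/le_anti; rewrite s2n.
    exists 0; split; first by apply/andP; split; lra.
    have -> : e2 = 0 by lra.
    have -> : e1 = 0 by lra.
    by rewrite s2z; ring.
  exists ((2 * (th * t) * s2 + 10 * (e1 - e2) + e2 / 8) / s2); split; last by rewrite divfK ?gt_eqF.
  have h : 0 <= 2 * (th * t) * s2 by rewrite mulr_ge0// mulr_ge0.
  apply/andP; split; first by rewrite divr_ge0//; lra.
  rewrite ler_pdivrMr//.
  have : 100 * (th * t) * s2 <= 1 * s2 by rewrite ler_wpM2r.
  have -> : 2 * (th * t) * s2 = 2 * ((th * t) * s2) by ring.
  have -> : 100 * (th * t) * s2 = 100 * ((th * t) * s2) by ring.
  lra.
have hth1 : 0 <= th * t <= 1 by rewrite tht0; lra.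
have htail : e2 <= s2 / 2 by lra.
have hks : 2 * (th * t) * s2 + 10 * (e1 - e2) + e2 / 8 <= k * s2 by rewrite kE.
have := small_ball_lower n hX s20 m1 m2 hk r0; lazy zeta => /(_ t hth1 htail hks hr2).
rewrite -/th -/u -/e2 ball_probE ?(ltW y0)// lee_fin; apply: le_trans.
rewrite -mulrA ler_pM2l ?invr_gt0// -expRD ler_expR.
set Z := s2 - e2 + 4 * k * s2.
set l := (y ^+ 2)^-1 in hy *.
have l0 : 0 < l by rewrite invr_gt0 exprn_gt0.
set x := _ / _ * Z.
have xE : n%:R * x = (sigma ^+ 2)^-1 * l * Z.
  have h := exponentE y0 n0'.
  rewrite /x (_ : n%:R * _ = (pi ^+ 2 * n%:R / (8 * r ^+ 2)) * Z); last by ring.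
  congr (_ * _); rewrite /r ball_radius_sqr /l; move: (pi : R) p0 => q q0.
  by field; rewrite !gt_eqF.
have ZE : Z = s2 - e2 / 2 + 40 * (e1 - e2) + 8 * ((th * t) * s2).
  have -> : Z = s2 - e2 + 4 * (k * s2) by rewrite /Z; ring.
  by rewrite kE; field.
have /andP[k0 k2] := hk.
have ks0 : 0 <= k * s2 by exact: mulr_ge0.
have Z0 : 0 <= Z by rewrite /Z -mulrA; lra.
have Z3 : Z <= 3 * s2.
  rewrite /Z -mulrA; have : k * s2 <= 2^-1 * s2 by rewrite ler_wpM2r.
  lra.
have sl0 : 0 <= (sigma ^+ 2)^-1 * l by apply: mulr_ge0; [rewrite invr_ge0|]; exact: ltW.
have nx : n%:R * x <= E * L.
  rewrite xE /E; apply: (@le_trans _ _ ((sigma ^+ 2)^-1 * (A * L) * (3 * s2))).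
    by apply: ler_pM => //; rewrite ler_wpM2l// invr_ge0 ltW.
  by rewrite le_eqVlt; apply/orP; left; apply/eqP; ring.
have nx0 : 0 <= n%:R * x by rewrite xE mulr_ge0.
have nxx : n%:R * x * (2 * x) <= 1.
  rewrite -(ler_pM2l n0) mulr1.
  have -> : n%:R * (n%:R * x * (2 * x)) = 2 * (n%:R * x) ^+ 2 by ring.
  have : (n%:R * x) ^+ 2 <= (E * L) ^+ 2 by rewrite lerXn2r ?nnegrE// (le_trans nx0).
  have : 2 * (E * L) ^+ 2 <= 2 * E ^+ 2 * L ^+ 5.
    have -> : 2 * (E * L) ^+ 2 = 2 * E ^+ 2 * L ^+ 2 by ring.
    apply: ler_wpM2l; first by rewrite mulr_ge0// sqr_ge0.
    exact: ler_weXn2l.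
  have : Num.sqrt (n%:R : R) <= n%:R.
    have s1 : 1 <= Num.sqrt (n%:R : R) by rewrite -[leLHS]sqrtr1 ler_wsqrtr.
    have nE : n%:R = Num.sqrt n%:R * Num.sqrt n%:R :> R by rewrite -expr2 sqr_sqrtr// ltW.
    by rewrite [leRHS]nE ler_peMr// (le_trans _ s1).
  lra.
have lL : (sigma ^+ 2)^-1 * l * (8 * ((th * t) * s2)) <= 1.
  apply: le_trans tht4.
  have -> : 8 * A * s2 / sigma ^+ 2 * (L * (th * t)) =
    (sigma ^+ 2)^-1 * (A * L) * (8 * ((th * t) * s2)) by ring.
  rewrite ler_wpM2r//; first by rewrite mulr_ge0// mulr_ge0.
  by rewrite ler_wpM2l// invr_ge0 ltW.
have e3 : n%:R * x = (sigma ^+ 2)^-1 * l * (s2 - e2 / 2 + 40 * (e1 - e2)) +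
    (sigma ^+ 2)^-1 * l * (8 * ((th * t) * s2)) by rewrite xE ZE mulrDr.
have -> : n%:R * x * (1 + 2 * x) = n%:R * x + n%:R * x * (2 * x) by ring.
rewrite e3 in nxx *; lra.
Unshelve. all: by end_near. Qed.

End small_ball_asymptotics.

(** * The direct part *)

Section integral_test_bounded.
Context d (T : measurableType d) (R : realType) (P : probability T R).
Variables (X : nat -> {RV P >-> R}) (hX : iid X) (sigma a b : R).

Lemma integral_testP psi : positive_on_ge1 psi ->
  integral_test X sigma a b psi <->
  (bounded_series (fun n : nat => weight a b n * expR (- (psi n%:R ^+ 2)^-1)) <->
   bounded_series (fun n : nat => weight a b n * ball_prob X sigma n (psi n%:R))).
Proof.
move=> psi0.
pose f (n : nat) : R := weight a b n * expR (- (psi n%:R ^+ 2)^-1).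
pose h (n : nat) : R := weight a b n * ball_prob X sigma n (psi n%:R).
rewrite -/f -/h.
have f0 k : 0 <= f k by rewrite mulr_ge0 ?weight_ge0 ?expR_ge0.
have h0 k : 0 <= h k by rewrite mulr_ge0 ?weight_ge0 ?ball_prob_ge0.
have JE : J a b psi = (\sum_(1 <= n <oo) (f n)%:E)%E.
  by apply: eq_eseriesr => n _; rewrite /f div1r.
have SE : small_ball_series X sigma a b psi = (\sum_(1 <= n <oo) (h n)%:E)%E.
  congr (limn _); apply/funext => N; apply: eq_big_nat => n /andP[n1 _].
  rewrite [RHS]EFinM; congr (_ * _)%E; apply: ball_probE.
  by rewrite ltW// psi0// ler1n.
rewrite /integral_test JE SE.
have Pf := bounded_seriesP f0; have Ph := bounded_seriesP h0.
have Nf := not_bounded_seriesP f0; have Nh := not_bounded_seriesP h0.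
split=> [[h1 h2]|hfh].
  split=> hs; first by apply/Ph/h1/Pf.
  by apply: contrapT => /Nf/h2/Nh.
split=> [/Pf hf|/Nf hf]; first by apply/Ph/hfh.
by apply/Nh => /hfh.
Qed.

End integral_test_bounded.

Section direct.
Context d (T : measurableType d) (R : realType) (P : probability T R).
Variables (X : nat -> {RV P >-> R}) (hX : iid X) (sigma a b C : R).
Hypotheses (sg0 : 0 < sigma) (C0 : 0 < C).
Hypothesis m1 : ('E_P[X 0%N] = 0)%E.
Hypothesis m2 : ('E_P[(fun w => X 0%N w ^+ 2)%R])%E = (sigma ^+ 2)%:E.
Hypothesis tail : \forall t \near +oo_R,
  (trunc_moment2 (X 0%N) t <= (C * (loglogt t)^-1)%:E)%E.

Let near_tail : \forall n \near \oo,
  tail2 (X 0%N) (quarter n) <= 2 * C / loglogt (n%:R : R).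
Proof.
case: tail => M [Mreal hM].
near=> n.
have L0 : 0 < loglogt (n%:R : R) by rewrite (lt_le_trans _ (loglogt_ge1 _)).
have [q1 q2 _] : [/\ M + 1 <= quarter n :> R, loglogt (n%:R : R) / 2 <= loglogt (quarter n) &
      quarter n ^+ 2 = Num.sqrt (n%:R : R)] by near: n; exact: near_quarter.
have := hM (quarter n); rewrite (tail2E m2) lee_fin => h.
apply: le_trans (h _) _; first by lra.
rewrite -mulrA mulrCA; apply: ler_wpM2l; first exact: ltW.
have lq : 0 < loglogt (quarter n : R) by rewrite (lt_le_trans _ (loglogt_ge1 _)).
rewrite -[leLHS]mul1r ler_pdivrMr// mulrAC ler_pdivlMr//; lra.
Unshelve. all: by end_near. Qed.

(** Here the tail condition enters: with e = K / loglog n it yields the small tail condition of the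
    upper bound, and e / y^2, like the tail terms of the lower exponent, stays bounded as long as 1
    / y^2 = O(loglog n). *)
Let ball_prob_two_sided (A : R) : 0 < A -> exists2 c : R, 0 < c &
  \forall n \near \oo, forall y, 0 < y -> (y ^+ 2)^-1 <= A * loglogt (n%:R : R) ->
    ball_prob X sigma n y <= c * expR (- (y ^+ 2)^-1) /\
    expR (- (y ^+ 2)^-1) <= c * ball_prob X sigma n y.
Proof.
move=> A0; have sg2 : 0 < sigma ^+ 2 by exact: exprn_gt0.
pose K := 20 * C / sigma ^+ 2.
have K0 : 0 < K by rewrite divr_gt0// mulr_gt0.
pose c1 := 24 * expR 1 * expR (40 * K * A).
pose c2 := 2 * expR 2 * expR (80 * C / sigma ^+ 2 * A).
have c10 : 0 < c1 by rewrite !mulr_gt0 ?expR_gt0.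
have c20 : 0 < c2 by rewrite !mulr_gt0 ?expR_gt0.
exists (c1 + c2); first by rewrite addr_gt0.
have [n1 _ up] := small_ball_upper_asym hX m1 sg0 m2 sg2 A0 K0.
have [n2 _ low] := small_ball_lower_asym hX m1 sg0 m2 A0.
near=> n => y y0 hy.
have n1n : (n1 <= n)%N by near: n; exact: nbhs_infty_ge.
have n2n : (n2 <= n)%N by near: n; exact: nbhs_infty_ge.
have L0 : 0 < loglogt (n%:R : R) by rewrite (lt_le_trans _ (loglogt_ge1 _)).
have ht : tail2 (X 0%N) (quarter n) <= 2 * C / loglogt (n%:R : R) by near: n; exact: near_tail.
have L128 : 128 * K <= loglogt (n%:R : R) by near: n; exact: near_loglogt.
have {}up : ball_prob X sigma n y <= 24 * expR 1 *
    expR (- (sigma ^+ 2 / sigma ^+ 2 * (y ^+ 2)^-1 * (1 - 40 * (K / loglogt (n%:R : R))))).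
  apply: (up n) => //.
  - by rewrite ler_pdivrMr// mulrC; lra.
  - rewrite (_ : _ * sigma ^+ 2 / 10 = 2 * C / loglogt (n%:R : R))//.
    by rewrite /K; field; rewrite !gt_eqF.
have [u _ {}low] : exists2 u, u <= 64 * ball_radius sigma n y &
    2^-1 * expR (- 2) * expR (- ((sigma ^+ 2)^-1 * (y ^+ 2)^-1 *
      (sigma ^+ 2 - tail2 (X 0%N) u / 2 + 40 * (tail2 (X 0%N) (quarter n) - tail2 (X 0%N) u))))
    <= ball_prob X sigma n y by apply: (low n).
set l := (y ^+ 2)^-1 in hy up low *; set L := loglogt _ in L0 ht L128 hy up.
have l0 : 0 < l by rewrite invr_gt0 exprn_gt0.
clearbody l L.
have u0 := tail2_ge0 m2 u.
have bp0 := ball_prob_ge0 X sigma n y.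
split.
  apply: (@le_trans _ _ (c1 * expR (- l))); last by rewrite ler_wpM2r ?expR_ge0//; lra.
  apply: (le_trans up); rewrite /c1 -[leRHS]mulrA; apply: ler_wpM2l.
    by apply: mulr_ge0 => //; exact: expR_ge0.
  rewrite -expRD ler_expR divff ?gt_eqF// mul1r.
  have : l * (K / L) <= K * A.
    rewrite (_ : l * (K / L) = K * l / L); last by ring.
    by rewrite ler_pdivrMr// -[leRHS]mulrA ler_wpM2l// ltW.
  nra.
apply: (@le_trans _ _ (c2 * ball_prob X sigma n y)); last by rewrite ler_wpM2r//; lra.
have c2n : 0 <= c2 by exact: ltW.
apply: le_trans (ler_wpM2l c2n low).
rewrite /c2; set G := _ * _ * (_ + _).
have hG : G <= l + 80 * C / sigma ^+ 2 * A.
  have h1 : G <= (sigma ^+ 2)^-1 * l * (sigma ^+ 2 + 40 * (2 * C / L)).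
    apply: ler_wpM2l; first by apply: mulr_ge0; [rewrite invr_ge0|]; exact: ltW.
    move: ht u0; move: (2 * C / L) (tail2 _ _) (tail2 _ _) (sigma ^+ 2) => x1 x2 x3 x4 h2 h3.
    lra.
  apply: (le_trans h1); rewrite mulrDr -mulrA mulrCA mulVf ?gt_eqF// mulr1 lerD2l.
  have -> : (sigma ^+ 2)^-1 * l * (40 * (2 * C / L)) = 80 * C / sigma ^+ 2 * (l / L).
    by field; rewrite !gt_eqF.
  apply: ler_wpM2l; last by rewrite ler_pdivrMr.
  by apply: divr_ge0; [apply: mulr_ge0 => //|]; exact: ltW.
have -> : 2 * expR 2 * expR (80 * C / sigma ^+ 2 * A) * (2^-1 * expR (- 2) * expR (- G)) =
   (2 * 2^-1) * (expR 2 * expR (- 2)) * (expR (80 * C / sigma ^+ 2 * A) * expR (- G)) by ring.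
rewrite divff// expRxMexpNx_1 !mul1r -expRD ler_expR; lra.
Unshelve. all: by end_near. Qed.

(** Where 1 / psi^2 exceeds A loglog n, both terms are at most a constant times B(n)^(-2), as A is
    twice the exponent bounding B by a power of log n. That error has a convergent series by Abel
    and Dini, so adding it to either side yields comparisons valid for all large n. *)
Lemma direct_part psi : positive_on_ge1 psi -> integral_test X sigma a b psi.
Proof.
move=> psi0; apply/(integral_testP X sigma a b psi0).
have [A0 A00 hA] := weight_sum_up a b.
pose A := 2 * A0.
have A_gt0 : 0 < A by rewrite mulr_gt0.
have [c c0 /= [N _ hN]] := ball_prob_two_sided A_gt0.
pose D n := expR (- (1 + 1) * ln (weight_sum a b n)).
have D0 n : 0 <= D n by exact: expR_ge0.
have sD : bounded_series (fun n => weight a b n * D n) by exact: abel_dini_cvg.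
pose k := expR (2 * ln 2) : R.
have k0 : 0 < k by exact: expR_gt0.
have AD n : (0 < n)%N -> expR (- (A * loglogt (n%:R : R))) <= k * D n.
  move=> n0; rewrite /k /D -expRD ler_expR.
  have B1 := weight_sum_ge1 a b n0.
  have : ln (weight_sum a b n) <= ln (2 * expR (A0 * loglogt (n%:R : R))).
    by rewrite ler_ln ?posrE ?mulr_gt0 ?expR_gt0 ?hA//; lra.
  rewrite lnM ?posrE ?expR_gt0// expRK /A; lra.
have key n : (maxn N 1 <= n)%N ->
    ball_prob X sigma n (psi n%:R) <= (c * (k + 1)) * (expR (- (psi n%:R ^+ 2)^-1) + D n) /\
    expR (- (psi n%:R ^+ 2)^-1) <= (c + k) * (ball_prob X sigma n (psi n%:R) + D n).
  rewrite geq_max => /andP[Nn n1].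
  have y0 : 0 < psi n%:R by apply: psi0; rewrite ler1n.
  set y := psi _ in y0 *.
  have bp0 := ball_prob_ge0 X sigma n y.
  have e0 := expR_ge0 (- (y ^+ 2)^-1).
  have Dn := D0 n.
  have AL0 : 0 < A * loglogt (n%:R : R).
    by rewrite mulr_gt0// (lt_le_trans _ (loglogt_ge1 _)).
  have [hy|hy] := leP ((y ^+ 2)^-1) (A * loglogt (n%:R : R)).
    have [h1 h2] := hN n Nn y y0 hy; split.
      apply: (le_trans h1); rewrite -mulrA ler_pM2l//; nra.
    apply: (le_trans h2); nra.
  have hD := AD n n1.
  split.
    (* The radius at the edge of the critical range; the probability is monotone in the radius, so
       its value at y' dominates. *)
    pose y' := (Num.sqrt (A * loglogt (n%:R : R)))^-1.
    have y'2 : (y' ^+ 2)^-1 = A * loglogt (n%:R : R).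
      by rewrite /y' exprVn invrK sqr_sqrtr// ltW.
    have y'0 : 0 < y' by rewrite invr_gt0 sqrtr_gt0.
    have yy' : y <= y'.
      rewrite -ler_sqr ?nnegrE ?(ltW y0) ?(ltW y'0)//.
      by rewrite -lef_pV2 ?posrE ?exprn_gt0// y'2 ltW.
    apply: (le_trans (ball_prob_homo X sigma n (ltW y0) yy')).
    have [|h1 _] := hN n Nn y' y'0; first by rewrite y'2.
    rewrite y'2 in h1; apply: (le_trans h1); rewrite -mulrA ler_pM2l//.
    apply: (le_trans hD); nra.
  apply: (@le_trans _ _ (k * D n)); last by nra.
  by apply: le_trans hD; rewrite ler_expR lerN2 ltW.
split=> hs.
  have hsD := bounded_seriesD hs sD.
  apply: (bounded_series_le (c := c * (k + 1)) (n0 := maxn N 1) _ _ _ _ hsD).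
  - by move=> n; rewrite mulr_ge0 ?weight_ge0 ?ball_prob_ge0.
  - by move=> n; rewrite -mulrDr mulr_ge0 ?weight_ge0// addr_ge0 ?expR_ge0.
  - by rewrite mulr_ge0 ?addr_ge0// ltW.
  - move=> n hn; have [h _] := key n hn.
    by rewrite -mulrDr mulrCA ler_wpM2l ?weight_ge0.
have hsD := bounded_seriesD hs sD.
apply: (bounded_series_le (c := c + k) (n0 := maxn N 1) _ _ _ _ hsD).
- by move=> n; rewrite mulr_ge0 ?weight_ge0 ?expR_ge0.
- by move=> n; rewrite -mulrDr mulr_ge0 ?weight_ge0// addr_ge0 ?ball_prob_ge0.
- by rewrite addr_ge0// ltW.
- move=> n hn; have [_ h] := key n hn.
  by rewrite -mulrDr mulrCA ler_wpM2l ?weight_ge0.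
Qed.

End direct.

(** * Two choices of psi *)

Section loglogt_square.
Context {R : realType}.

Lemma loglogt_sqr_le (n : nat) : loglogt ((n ^ 2)%:R : R) <= loglogt (n%:R : R) + 1.
Proof.
case: n => [|n]; first by rewrite exp0n// lerDl.
have n1 : 1 <= n.+1%:R :> R by rewrite ler1n.
have l1 := logt_ge1 (n.+1%:R : R).
have h : logt ((n.+1 ^ 2)%:R : R) <= logt (n.+1%:R : R) * 2.
  rewrite -mulnn natrM; apply: (le_trans (logt_mul_le n1 n1)).
  have := ln_le_logt (lt_le_trans ltr01 n1); lra.
apply: (le_trans (ler_logt h)); apply: le_trans (logt_mul_le l1 _) _; first by lra.
have := @ln_le_subr1 R 2 (ltr0Sn _ 1); have := loglogt_ge1 (n.+1%:R : R).
rewrite /loglogt; lra.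
Qed.

End loglogt_square.

Section choices_of_psi.
Context d (T : measurableType d) (R : realType) (P : probability T R).
Variables (X : nat -> {RV P >-> R}) (sigma a b : R).
Hypotheses (ha : -1 < a) (hb : -1 < b).
Hypothesis test : forall psi : R -> R, positive_on_ge1 psi ->
  eventually_nonincreasing psi -> integral_test X sigma a b psi.

Let B := weight_sum a b.

Let log_weight_sum_bounds : exists c A : R, [/\ 0 < c, 0 < A & exists N, forall n, (N <= n)%N ->
  c * loglogt (n%:R : R) <= 1 + ln (B n) <= A * loglogt (n%:R : R)].
Proof.
have [A0 A00 hA] := weight_sum_up a b.
have [c1 [c [c10 c0 hc]]] := weight_sum_low ha hb.
exists (c1 / 2), (2 + A0); split; [lra|lra|].
have [N _ hN] := near_loglogt (2 * `|1 + ln c| / c1).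
exists (maxn N 1) => n; rewrite geq_max => /andP[Nn n0].
have L1 := loglogt_ge1 (n%:R : R).
have := hN n Nn; rewrite /= ler_pdivrMr// => hL.
have B1 : 1 <= B n by exact: weight_sum_ge1.
have B0 : 0 < B n by lra.
have up : ln (B n) <= 1 + A0 * loglogt (n%:R : R).
  have : ln (B n) <= ln (2 * expR (A0 * loglogt (n%:R : R))).
    by rewrite ler_ln ?posrE ?mulr_gt0 ?expR_gt0 ?hA.
  rewrite lnM ?posrE ?expR_gt0// expRK.
  have := @ln_le_subr1 R 2 (ltr0Sn _ 1); lra.
have low : ln c + c1 * loglogt (n%:R : R) <= ln (B n).
  have : ln (c * expR (c1 * loglogt (n%:R : R))) <= ln (B n).
    by rewrite ler_ln ?posrE ?mulr_gt0 ?expR_gt0 ?hc.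
  by rewrite lnM ?posrE ?expR_gt0// expRK.
have := ler_norm (- (1 + ln c)); rewrite normrN => hn.
apply/andP; split; lra.
Qed.

Lemma not_uniformly_light (g C : R) : 0 < g -> 0 < C ->
  ~ (forall A c : R, 0 < A -> 0 < c -> \forall n \near \oo, forall y, 0 < y ->
       c * loglogt (n%:R : R) <= (y ^+ 2)^-1 <= A * loglogt (n%:R : R) ->
       ball_prob X sigma n y <= C * expR (- ((1 + g) * (y ^+ 2)^-1))).
Proof.
move=> g0 C0 light.
have [c [A [c0 A0 [N hN]]]] := log_weight_sum_bounds.
have [N1 _ hN1] := light A c A0 c0.
(* Since B 1 = 1, the summand 1 is what makes psi positive at 1. *)
pose l (n : nat) : R := 1 + ln (B n).
have l0 n : (0 < n)%N -> 0 < l n.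
  by move=> n0; rewrite /l ltr_pwDl// ln_ge0// /B weight_sum_ge1.
pose psi (x : R) := (Num.sqrt (l (Num.truncn x)))^-1.
have tr (x : R) : 1 <= x -> (0 < Num.truncn x)%N by rewrite truncn_gt0.
have psi0 : positive_on_ge1 psi.
  by move=> x x1; rewrite invr_gt0 sqrtr_gt0 l0// tr.
have psi_anti : eventually_nonincreasing psi.
  exists 1 => // x y x1 xy; have y1 := le_trans x1 xy.
  rewrite /psi lef_pV2 ?posrE ?sqrtr_gt0 ?l0 ?tr// ler_wsqrtr// lerD2l.
  rewrite ler_ln ?posrE ?(lt_le_trans ltr01 (weight_sum_ge1 _ _ (tr _ _)))//.
  by apply: weight_sum_homo; exact: le_truncn.
have psiE n : (0 < n)%N -> (psi n%:R ^+ 2)^-1 = l n.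
  by move=> n0; rewrite /psi exprVn invrK natrK sqr_sqrtr// ltW// l0.
have [_ back] := (integral_testP X sigma a b psi0).1 (test psi0 psi_anti).
apply: (abel_dini_div ha hb).
have B0 n : 0 <= B n by apply: sumr_ge0 => k _; exact: weight_ge0.
have w0 n : 0 <= weight a b n by exact: weight_ge0.
apply: (@bounded_series_le _ _ _ (expR 1) 1%N _ _ (expR_ge0 _) _ (back _)).
- by move=> n; rewrite divr_ge0.
- by move=> n; rewrite mulr_ge0 ?expR_ge0.
- move=> n n0; rewrite psiE// mulrCA ler_wpM2l//.
  rewrite /l opprD expRD mulrA expRxMexpNx_1 mul1r expRN lnK//.
  by rewrite posrE (lt_le_trans ltr01)// /B weight_sum_ge1.
have sA := abel_dini_cvg a b g0.
apply: (bounded_series_le (c := C) (n0 := maxn 1 (maxn N N1)) _ _ _ _ sA).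
- by move=> n; rewrite mulr_ge0// ball_prob_ge0.
- by move=> n; rewrite mulr_ge0// expR_ge0.
- exact: ltW.
move=> n; rewrite !geq_max => /and3P[n0 Nn N1n].
rewrite mulrCA ler_wpM2l//.
have h : ball_prob X sigma n (psi n%:R) <= C * expR (- ((1 + g) * l n)).
  rewrite -(psiE n n0); apply: (hN1 n N1n); first by rewrite psi0// ler1n.
  by rewrite psiE// hN.
apply: (le_trans h); rewrite ler_pM2l// ler_expR mulNr lerN2 /l.
by rewrite ler_wpM2l ?lerDr//; lra.
Qed.

(* [psi] is constant on the blocks ]N_(k-1)^2, N_k^2], with value chosen so
   that block k contributes at most exp(-1-k) to J, whereas the part of the
   block beyond N_k carries a fixed proportion of its total weight. *)
Lemma not_heavy_blocks :
  ~ (forall (A c K : R) (N0 : nat), 0 < A -> 0 < c -> 0 < K -> exists2 N : nat, (N0 <= N)%N &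
       forall n : nat, (N < n <= N ^ 2)%N -> forall y, 0 < y ->
       c * loglogt (n%:R : R) <= (y ^+ 2)^-1 <= A * loglogt (n%:R : R) ->
       K * expR (- (y ^+ 2)^-1) <= ball_prob X sigma n y).
Proof.
move=> heavy.
have [c [A [c0 A0 [N1 hN1]]]] := log_weight_sum_bounds.
have [r r0 hr] := weight_sum_block ha hb.
(* [weight_sum_block] says that ]N, N^2] carries at least the proportion rho of B(N^2); [K k] is
   what brings the sum of the probabilities over block k up to 1. *)
pose rho := r / (1 + r).
have rho0 : 0 < rho by rewrite divr_gt0//; lra.
pose K (k : nat) : R := expR (1 + k%:R) / rho.
have K0 k : 0 < K k by rewrite divr_gt0// expR_gt0.
(* On block k the exponent is 1 + k + ln B(M_k^2). The part k is at most loglog M_k, by the choice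
   of M_k, and the rest at most A loglog (M_k^2) <= 2 A loglog n; hence 1 + 2 A. *)
have A'0 : 0 < 1 + 2 * A by lra.
have step (p : nat * nat) : exists N : nat, [/\ (p.2 <= N)%N, (4 <= N)%N, (N1 <= N)%N,
    p.1%:R <= loglogt (N%:R : R) & (p.1 <= N)%N /\
    forall n : nat, (N < n <= N ^ 2)%N -> forall y, 0 < y ->
       c * loglogt (n%:R : R) <= (y ^+ 2)^-1 <= (1 + 2 * A) * loglogt (n%:R : R) ->
       K p.1 * expR (- (y ^+ 2)^-1) <= ball_prob X sigma n y].
  have [N2 _ hN2] := near_loglogt (p.1%:R : R).
  have [N + h] := heavy _ _ _ (maxn p.2 (maxn 4 (maxn N1 (maxn N2 p.1)))) A'0 c0 (K0 p.1).
  rewrite !geq_max => /and5P[h1 h2 h3 h4 h5].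
  by exists N; split => //; exact: hN2.
have [F hF] := boolp.choice step.
pose fix M (k : nat) : nat := if k is j.+1 then F (k, ((M j) ^ 2).+1) else F (0%N, 0%N).
have M4 k : (4 <= M k)%N by case: k => [|k] /=; [case: (hF (0, 0)%N)|case: (hF (k.+1, ((M k) ^ 2).+1)%N)].
have MN1 k : (N1 <= M k)%N by case: k => [|k] /=; [case: (hF (0, 0)%N)|case: (hF (k.+1, ((M k) ^ 2).+1)%N)].
have Mk k : k%:R <= loglogt ((M k)%:R : R).
  by case: k => [|k] /=; [case: (hF (0, 0)%N)|case: (hF (k.+1, ((M k) ^ 2).+1)%N)].
have kM k : (k <= M k)%N.
  by case: k => // k /=; case: (hF (k.+1, ((M k) ^ 2).+1)%N) => _ _ _ _ [].
have Mstep k : ((M k) ^ 2 < M k.+1)%N by case: (hF (k.+1, ((M k) ^ 2).+1)%N).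
have Mheavy k (n : nat) : (M k < n <= (M k) ^ 2)%N -> forall y, 0 < y ->
       c * loglogt (n%:R : R) <= (y ^+ 2)^-1 <= (1 + 2 * A) * loglogt (n%:R : R) ->
       K k * expR (- (y ^+ 2)^-1) <= ball_prob X sigma n y.
  case: k => [|k] /=; first by case: (hF (0, 0)%N) => _ _ _ _ [_]; apply.
  by case: (hF (k.+1, ((M k) ^ 2).+1)%N) => _ _ _ _ [_]; apply.
have sq k : (M k <= (M k) ^ 2)%N by rewrite -{1}(expn1 (M k)) leq_pexp2l// (leq_trans _ (M4 k)).
have Msq_homo k j : (k <= j)%N -> ((M k) ^ 2 <= (M j) ^ 2)%N.
  elim: j => [|j IH]; first by rewrite leqn0 => /eqP ->.
  rewrite leq_eqVlt => /predU1P[->//|/IH h].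
  by apply: (leq_trans h); apply: (leq_trans _ (sq _)); exact: ltnW.
have Mlt i k : (i < k)%N -> ((M i) ^ 2 < M k)%N.
  by case: k => // k; rewrite ltnS => /Msq_homo h; exact: leq_ltn_trans (Mstep k).
have ex (n : nat) : exists k, (n <= (M k) ^ 2)%N.
  by exists n; exact: leq_trans (sq n).
pose kk n := ex_minn (ex n).
have kk_homo m n : (m <= n)%N -> (kk m <= kk n)%N.
  move=> mn; rewrite /kk; case: ex_minnP => i _ hi; case: ex_minnP => j hj _.
  by apply: hi; exact: leq_trans hj.
have kk_block k n : (M k < n <= (M k) ^ 2)%N -> kk n = k.
  move=> /andP[n1 n2]; rewrite /kk; case: ex_minnP => i hi1 /(_ k n2) hi2.
  apply/eqP; rewrite eqn_leq hi2 /= leqNgt; apply/negP => ik.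
  have h := Mlt i k ik.
  by have := leq_ltn_trans hi1 (ltn_trans h n1); rewrite ltnn.
have B1 n : (0 < n)%N -> 1 <= B n by exact: weight_sum_ge1.
have M2 k : (0 < (M k) ^ 2)%N by rewrite expn_gt0 (leq_trans _ (M4 k)).
pose l (k : nat) : R := 1 + k%:R + ln (B ((M k) ^ 2)).
have l0 k : 0 < l k.
  by rewrite /l ltr_pwDl ?ln_ge0 ?B1// ltr_pwDl.
have l_homo k j : (k <= j)%N -> l k <= l j.
  move=> kj; rewrite /l lerD ?lerD2l ?ler_nat// ler_ln ?posrE ?(lt_le_trans ltr01 (B1 _ _))//.
  by apply: weight_sum_homo; exact: Msq_homo.
pose psi (x : R) := (Num.sqrt (l (kk (Num.truncn x))))^-1.
have psi0 : positive_on_ge1 psi by move=> x x1; rewrite invr_gt0 sqrtr_gt0.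
have psi_anti : eventually_nonincreasing psi.
  exists 1 => // x y x1 xy.
  rewrite /psi lef_pV2 ?posrE ?sqrtr_gt0// ler_wsqrtr//.
  by apply/l_homo/kk_homo; exact: le_truncn.
have psiE (n : nat) : (psi n%:R ^+ 2)^-1 = l (kk n).
  by rewrite /psi exprVn invrK natrK sqr_sqrtr// ltW.
have [forth _] := (integral_testP X sigma a b psi0).1 (test psi0 psi_anti).
have w0 n : 0 <= weight a b n by exact: weight_ge0.
have expl k : expR (- l k) = expR (- (1 + k%:R)) / B ((M k) ^ 2).
  by rewrite /l opprD expRD [in X in _ * X]expRN lnK// posrE (lt_le_trans ltr01 (B1 _ _)).
have cvJ : bounded_series (fun n : nat => weight a b n * expR (- (psi n%:R ^+ 2)^-1)).
  have f0 n : 0 <= weight a b n * expR (- l (kk n)) by rewrite mulr_ge0// expR_ge0.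
  (* The partial sums up to M_k^2 are kept below 1 - exp (- (1 + k)). The next block adds exp (- (2
     + k)), and 2 / e <= 1 makes the bound inductive. *)
  have e2 : 2 * expR (- 1) <= 1 :> R.
    rewrite expRN ler_pdivrMr ?expR_gt0// mul1r; apply: le_trans (expR_ge1Dx _); lra.
  have h k : \sum_(1 <= n < ((M k) ^ 2).+1) weight a b n * expR (- l (kk n)) <= 1 - expR (- (1 + k%:R)).
    elim: k => [|k IH].
      apply: (@le_trans _ _ (\sum_(1 <= n < ((M 0%N) ^ 2).+1) weight a b n * expR (- l 0%N))).
        by apply: ler_sum => n _; rewrite ler_wpM2l// ler_expR lerN2 l_homo.
      rewrite -mulr_suml -/(weight_sum a b _) -/B expl mulrCA divff ?gt_eqF ?(lt_le_trans ltr01 (B1 _ _))//.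
      by rewrite mulr1 addr0; lra.
    have hM : ((M k) ^ 2 <= (M k.+1) ^ 2)%N by exact: Msq_homo.
    rewrite (@big_cat_nat _ _ _ ((M k) ^ 2).+1)//=.
    have : \sum_(((M k) ^ 2).+1 <= n < ((M k.+1) ^ 2).+1) weight a b n * expR (- l (kk n)) <=
        expR (- (1 + k.+1%:R)).
      apply: (@le_trans _ _ (\sum_(((M k) ^ 2).+1 <= n < ((M k.+1) ^ 2).+1) weight a b n * expR (- l k.+1))).
        rewrite big_nat [leRHS]big_nat; apply: ler_sum => n /andP[n1 _].
        rewrite ler_wpM2l// ler_expR lerN2 l_homo// /kk; case: ex_minnP => i hi _.
        rewrite ltnNge; apply/negP => /Msq_homo h.
        by have := leq_trans n1 (leq_trans hi h); rewrite ltnn.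
      rewrite -mulr_suml.
      apply: (@le_trans _ _ (B ((M k.+1) ^ 2) * expR (- l k.+1))).
        rewrite ler_wpM2r ?expR_ge0// /B /weight_sum.
        rewrite [leRHS](@big_cat_nat _ _ _ ((M k) ^ 2).+1)//= lerDr.
        by apply: sumr_ge0.
      by rewrite expl mulrCA divff ?gt_eqF ?(lt_le_trans ltr01 (B1 _ _))// mulr1.
    have -> : expR (- (1 + k.+1%:R)) = expR (- 1) * expR (- (1 + k%:R)) :> R.
      by rewrite -expRD -natr1; congr expR; ring.
    have := expR_gt0 (- (1 + k%:R) : R); nra.
  exists 1 => N.
  under eq_bigr => n _ do rewrite psiE.
  apply: (@le_trans _ _ (1 - expR (- (1 + N%:R)))); last by rewrite gerBl expR_ge0.
  apply: le_trans (h N).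
  have NM : (N <= (M N) ^ 2)%N by exact: leq_trans (sq N).
  by rewrite [leRHS](@big_cat_nat _ _ _ N.+1)//= lerDl; apply: sumr_ge0.
have h0 n : 0 <= weight a b n * ball_prob X sigma n (psi n%:R).
  by rewrite mulr_ge0// ball_prob_ge0.
have [N hN] := bounded_series_block h0 (forth cvJ) ltr01.
have := hN (M N) ((M N) ^ 2)%N (kM N) (sq N).
apply/negP; rewrite -leNgt.
rewrite (@big_cat_nat _ _ _ (M N).+1 1 ((M N) ^ 2).+1)//=; last exact: sq.
rewrite [leRHS](_ : _ = \sum_((M N).+1 <= i < ((M N) ^ 2).+1)
  weight a b i * ball_prob X sigma i (psi i%:R)); last by ring.
(* The lower bound K exp (- l) for the probabilities makes this block sum at least 1, against the
   Cauchy criterion with bound 1. *)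
apply: (@le_trans _ _ (\sum_((M N).+1 <= i < ((M N) ^ 2).+1) weight a b i * (K N * expR (- l N)))).
  rewrite -mulr_suml.
  have -> : \sum_((M N).+1 <= i < ((M N) ^ 2).+1) weight a b i = B ((M N) ^ 2) - B (M N).
    by rewrite /B /weight_sum (@big_cat_nat _ _ _ (M N).+1 1 ((M N) ^ 2).+1)//=; [ring|exact: sq].
  have := hr _ (M4 N); rewrite -/B.
  have := B1 _ (M2 N); rewrite expl /K /rho expRN.
  move: (B (M N ^ 2)) (B (M N)) (expR (1 + N%:R)) (expR_gt0 (1 + N%:R : R)) => x z e e0 x1 hx.
  have x0 : 0 < x by lra.
  have r1 : 0 < 1 + r by lra.
  have -> : (x - z) * (e / (r / (1 + r)) * (e^-1 / x)) = (x - z) * (1 + r) / (r * x).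
    by field; rewrite !gt_eqF.
  rewrite ler_pdivlMr ?mulr_gt0// mul1r; nra.
rewrite big_nat [leRHS]big_nat; apply: ler_sum => n; rewrite ltnS => hn.
rewrite ler_wpM2l//.
have n0 : (0 < n)%N by case/andP: hn => hn _; exact: leq_ltn_trans hn.
have kn := kk_block N n hn.
have := Mheavy N n hn (psi n%:R); rewrite psiE kn; apply.
  by rewrite psi0// ler1n.
case/andP: hn => Mn nM.
have N1M : (N1 <= M N ^ 2)%N by exact: leq_trans (sq N).
have /andP[h1 h2] := hN1 _ N1M.
have L1 := loglogt_ge1 (n%:R : R).
have LMn : loglogt ((M N)%:R : R) <= loglogt (n%:R : R) by rewrite ler_loglogt// ler_nat ltnW.
have LnM : loglogt (n%:R : R) <= loglogt ((M N ^ 2)%:R : R) by rewrite ler_loglogt// ler_nat.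
have LM2 : loglogt ((M N ^ 2)%:R : R) <= 2 * loglogt (n%:R : R).
  by apply: (le_trans (loglogt_sqr_le _)); lra.
have hk := Mk N; have N0 : 0 <= N%:R :> R by [].
have : c * loglogt (n%:R : R) <= c * loglogt ((M N ^ 2)%:R : R) by rewrite ler_pM2l.
have : A * loglogt ((M N ^ 2)%:R : R) <= A * (2 * loglogt (n%:R : R)) by rewrite ler_pM2l.
rewrite /l => h3 h4; apply/andP; split; lra.
Qed.

End choices_of_psi.

(** * The converse part *)

Section truncated_moments.
Context d (T : measurableType d) (R : realType) (P : probability T R).
Variable (Y : {RV P >-> R}).

Lemma trunc_sqr_homo t u : 0 <= t -> t <= u -> trunc_sqr Y t <= trunc_sqr Y u.
Proof.
move=> t0 tu; have u0 := le_trans t0 tu.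
have it := integrable_cut_sqr Y t0; have iu := integrable_cut_sqr Y u0.
apply: fine_le; [exact: integrable_fin_num it|exact: integrable_fin_num iu|].
apply: le_integral => // w _; rewrite lee_fin /cut_sqr; case: ifPn => h.
  by rewrite (le_trans h tu).
by case: ifP => // _; exact: sqr_ge0.
Qed.

Lemma trunc_sqr_unbounded (V : R) : ('E_P[(fun w => Y w ^+ 2)%R] = +oo)%E ->
  exists t0 : R, forall t, t0 <= t -> V <= trunc_sqr Y t.
Proof.
move=> m2.
have mf k : measurable_fun setT (fun w => (cut_sqr k%:R (Y w))%:E).
  exact: measurable_int (integrable_cut_sqr Y (ler0n R k)).
have cv : (\int[P]_w (cut_sqr k%:R (Y w))%:E)%E @[k --> \oo] --> (\int[P]_w (Y w ^+ 2)%:E)%E.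
  rewrite [X in _ --> X](_ : _ = \int[P]_w limn (fun k => (cut_sqr k%:R (Y w))%:E))%E.
    apply: (cvg_monotone_convergence measurableT mf) => //.
      by move=> k w _; rewrite lee_fin /cut_sqr; case: ifP => // _; exact: sqr_ge0.
    move=> w _ m n mn; rewrite lee_fin /cut_sqr; case: ifPn => h.
      by rewrite (le_trans h)// ler_nat.
    by case: ifP => // _; exact: sqr_ge0.
  apply: eq_integral => w _; apply/esym/cvg_lim => //.
  apply: cvg_near_cst; near=> k.
  rewrite /cut_sqr ifT//; near: k; exact: nbhs_infty_ger.
move: m2; rewrite unlock => m2; rewrite m2 in cv.
have /cvgeyPge/(_ V)[N _ hN] := cv.
exists N%:R => t Nt; apply: (@le_trans _ _ (trunc_sqr Y N%:R)); last exact: trunc_sqr_homo.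
have := hN N (leqnn N); rewrite /= /trunc_sqr -lee_fin fineK//.
exact: integrable_fin_num (integrable_cut_sqr Y (ler0n R N)).
Unshelve. all: by end_near. Qed.

(** The discarded part of Y is at most Y^2 / t in absolute value, because |Y| > t where it is not
    zero. *)
Lemma trunc_mean_dist (s2 mu t : R) : 0 < t -> ('E_P[Y] = mu%:E)%E ->
  ('E_P[(fun w => Y w ^+ 2)%R] = s2%:E)%E -> `|mu - trunc_mean Y t| <= s2 / t.
Proof.
move=> t0 m1 m2.
have it := integrable_cut_id Y (ltW t0); have iY := integrable_Y m2.
have i2 := integrable_sqr m2.
have i2t : P.-integrable setT (fun w => (t^-1)%:E * (Y w ^+ 2)%:E)%E by exact: integrableZl.
have E1 : ((mu - trunc_mean Y t)%:E = \int[P]_w ((Y w)%:E - (cut_id t (Y w))%:E))%E.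
  rewrite integralB// EFinB /trunc_mean fineK; last exact: integrable_fin_num it.
  by rewrite -m1 unlock.
rewrite -lee_fin -abse_EFin E1; apply: (le_trans (le_abse_integral _ _ _)) => //.
  by have /integrableP[] := integrableB measurableT iY it.
have -> : ((s2 / t)%:E = \int[P]_w ((t^-1)%:E * (Y w ^+ 2)%:E))%E.
  by rewrite integralZl// mulrC EFinM; congr (_ * _)%E; rewrite -m2 unlock.
apply: ge0_le_integral => //.
- apply: (measurableT_comp (@abse_measurable _ _)).
  by have /integrableP[] := integrableB measurableT iY it.
- by have /integrableP[] := i2t.
- move=> w _; rewrite -EFinB abse_EFin -EFinM lee_fin /cut_id; case: ifPn => h.
    by rewrite subrr normr0 mulr_ge0 ?invr_ge0 ?sqr_ge0// ltW.
  rewrite subr0 mulrC ler_pdivlMr// -(real_normK (num_real (Y w))).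
  by move: h; rewrite -ltNge expr2 => h; rewrite ler_wpM2l// ltW.
Qed.

End truncated_moments.

Lemma geometric_gt_linear (R : realType) (rho C : R) : 1 < rho ->
  exists j : nat, C * j.+1%:R < rho ^+ j.
Proof.
move=> rho1; have rho0 : 0 < rho by lra.
have l0 : 0 < ln rho by rewrite ln_gt0.
have l2 : 0 < ln rho ^+ 2 by exact: exprn_gt0.
exists (Num.truncn (4 * `|C| / ln rho ^+ 2)).+1.
set j := (Num.truncn _).+1; have : 4 * `|C| / ln rho ^+ 2 < j%:R by exact: truncnS_gt.
rewrite ltr_pdivrMr// => hj.
rewrite (_ : j.+1%:R = j%:R + 1 :> R); last by rewrite natr1.
have j1 : 1 <= j%:R :> R by rewrite ler1n.
clearbody j.
have -> : rho ^+ j = expR (j%:R * ln rho) by rewrite mulrC expRM_natr lnK.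
have x0 : 0 <= j%:R * ln rho by rewrite mulr_ge0// ltW.
have := expR_ge1Dxn 1 x0; rewrite (_ : (2`!)%:R = 2 :> R)// => h.
apply: lt_le_trans h.
have hC : C * (j%:R + 1) <= 2 * `|C| * j%:R.
  have := ler_norm C; have := normr_ge0 C; nra.
apply: (le_lt_trans hC); rewrite exprMn.
have : j%:R * (4 * `|C|) < j%:R * (j%:R * ln rho ^+ 2) by rewrite ltr_pM2l//; lra.
have -> : j%:R ^+ 2 * ln rho ^+ 2 / 2 = j%:R * (j%:R * ln rho ^+ 2) / 2 by ring.
lra.
Qed.

Section converse.
Context d (T : measurableType d) (R : realType) (P : probability T R).
Variables (X : nat -> {RV P >-> R}) (hX : iid X) (sigma a b : R).
Hypotheses (ha : -1 < a) (hb : -1 < b) (sg0 : 0 < sigma).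
Hypothesis test : forall psi : R -> R, positive_on_ge1 psi ->
  eventually_nonincreasing psi -> integral_test X sigma a b psi.

Let kappa : R := sigma ^+ 2 * pi ^+ 2 / 8.

Let kappa0 : 0 < kappa.
Proof. by rewrite divr_gt0// mulr_gt0// exprn_gt0// pi_gt0. Qed.

Let ball_radius_sqr n y : ball_radius sigma n y ^+ 2 = kappa * n%:R * y ^+ 2.
Proof.
rewrite exprMn sqr_sqrtr.
  by congr (_ * _); rewrite /kappa; move: (pi : R) => p; field.
by apply: divr_ge0 => //; apply: mulr_ge0 => //; apply: mulr_ge0; exact: sqr_ge0.
Qed.

Let near_ratio (M : R) : \forall n \near \oo, M * loglogt (n%:R : R) <= n%:R.
Proof.
have [N _ hN] := near_loglogt_expn `|M|.
exists (maxn N 1) => // n /=; rewrite geq_max => /andP[Nn n0].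
have L1 := loglogt_ge1 (n%:R : R).
have n1 : 1 <= n%:R :> R by rewrite ler1n.
have := hN n Nn; rewrite /= => h.
apply: (@le_trans _ _ (`|M| * loglogt (n%:R : R) ^+ 5)).
  apply: (@le_trans _ _ (`|M| * loglogt (n%:R : R))).
    by apply: ler_wpM2r; [lra|exact: ler_norm].
  by rewrite ler_wpM2l// -[leLHS]expr1 ler_weXn2l.
apply: (le_trans h); rewrite -[leRHS]sqr_sqrtr//.
rewrite expr2 ler_peMr ?sqrtr_ge0//.
by rewrite -[leLHS]sqrtr1 ler_wsqrtr.
Qed.

(** One argument against infinite second moment and nonzero mean alike. With l = 1 / y^2 and m
    between n / (8 l) and n / (4 l), the crude bound decays like exp (- 2 l), a relative gain g = 1.
    The constant 400 is 50 * 8, from 50 r^2 = 50 kappa n / l. *)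
Let local_variance_bounded :
  ~ (forall V : R, exists r0 : R, forall r, r0 <= r ->
       V <= trunc_sqr (X 0%N) (2 * r) + 2 * r * `|trunc_mean (X 0%N) (2 * r)|).
Proof.
move=> large.
have [V V0 VE] : exists2 V : R, 0 < V & V = 400 * kappa.
  by exists (400 * kappa) => //; have := kappa0; move: kappa => q; lra.
have [r0 hr0] := large V.
apply: (not_uniformly_light ha hb test ltr01 (expR_gt0 (2^-1))) => A c A0 c0.
have [N1 _ hN1] := near_ratio (A * (`|r0| + 1) ^+ 2 / kappa).
have [N2 _ hN2] := near_ratio (8 * A).
exists (maxn N1 N2) => // n /=; rewrite geq_max => /andP[/hN1 /= n1 /hN2 /= n2] y y0 /andP[_ hy].
have L1 := loglogt_ge1 (n%:R : R).
have [r rE] : exists r, ball_radius sigma n y = r by eexists.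
set l := (y ^+ 2)^-1 in hy *.
have y2 : 0 < y ^+ 2 by rewrite exprn_gt0.
have l0 : 0 < l by rewrite invr_gt0.
have yl : y ^+ 2 = l^-1 by rewrite invrK.
have r2 : r ^+ 2 = kappa * n%:R / l by rewrite -rE ball_radius_sqr yl.
have rn : 0 <= r by rewrite -rE; apply: ball_radius_ge0; exact: ltW.
clearbody l.
have L0 : 0 < A * loglogt (n%:R : R) by rewrite mulr_gt0//; lra.
have nl0 : 0 < n%:R :> R by apply: lt_le_trans n2; rewrite -mulrA mulr_gt0.
have rbig : (`|r0| + 1) ^+ 2 <= r ^+ 2.
  rewrite r2 ler_pdivlMr//.
  apply: (@le_trans _ _ ((`|r0| + 1) ^+ 2 * (A * loglogt (n%:R : R)))).
    by rewrite ler_wpM2l// sqr_ge0.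
  rewrite -ler_pdivrMl// mulrC.
  apply: le_trans n1; rewrite le_eqVlt; apply/orP; left; apply/eqP; ring.
have rr0 : `|r0| + 1 <= r by rewrite -ler_sqr ?nnegrE ?addr_ge0.
have r0' : r0 <= r by have := ler_norm r0; lra.
have rpos : 0 < r by have := normr_ge0 r0; lra.
have nl : 8 <= n%:R / l.
  rewrite ler_pdivlMr//; apply: le_trans n2.
  by rewrite -mulrA ler_pM2l.
pose m := (Num.truncn (n%:R / l / 8)).+1.
have m1 : n%:R / l / 8 < m%:R by exact: truncnS_gt.
have m2 : m%:R <= n%:R / l / 4.
  have : (Num.truncn (n%:R / l / 8))%:R <= n%:R / l / 8 by rewrite truncn_le//; lra.
  have -> : m%:R = (Num.truncn (n%:R / l / 8))%:R + 1 :> R by rewrite natr1.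
  lra.
rewrite -lee_fin -ball_probE ?rE; last exact: ltW.
have hv := hr0 r r0'.
apply: (le_trans (crude_upper hX rpos n (m := m) isT _)).
  apply: (@le_trans _ _ (m%:R * V)); last by rewrite ler_wpM2l.
  rewrite r2; have : (n%:R / l / 8) * V <= m%:R * V.
    by apply: ler_wpM2r; exact: ltW.
  apply: le_trans; rewrite VE le_eqVlt; apply/orP; left; apply/eqP; field.
  by rewrite gt_eqF.
rewrite lee_fin -expRD ler_expR lerD2l lerN2.
have m0 : 0 < m%:R :> R by rewrite ltr0n.
rewrite ler_pdivlMr ?mulr_gt0//.
have : l * m%:R <= l * (n%:R / l / 4) by rewrite ler_pM2l.
have -> : l * (n%:R / l / 4) = n%:R / 4 by field; rewrite gt_eqF.
lra.
Qed.

Lemma converse_second_moment_finite :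
  exists s2 : R, ('E_P[(fun w => X 0%N w ^+ 2)%R] = s2%:E)%E.
Proof.
have ge0 : (0 <= 'E_P[(fun w => X 0%N w ^+ 2)%R])%E.
  by rewrite unlock; apply: integral_ge0 => w _; rewrite lee_fin sqr_ge0.
case E : ('E_P[(fun w => X 0%N w ^+ 2)%R])%E ge0 => [s2| |] // _; first by exists s2.
exfalso; apply: local_variance_bounded => V.
have [t0 ht0] := trunc_sqr_unbounded V E.
exists `|t0| => r hr.
have rt : t0 <= 2 * r by have := ler_norm t0; have := normr_ge0 t0; lra.
have := ht0 _ rt; move=> /le_trans; apply; rewrite lerDl mulr_ge0// mulr_ge0//.
exact: le_trans hr.
Qed.

Variable s2 : R.
Hypothesis m2 : ('E_P[(fun w => X 0%N w ^+ 2)%R] = s2%:E)%E.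

(** If mu is not 0, then 2 r times the truncated mean is at least 2 r |mu| - s2 in absolute value,
    and the local variance would be unbounded. *)
Lemma converse_mean_zero : ('E_P[X 0%N] = 0)%E.
Proof.
have fin : ('E_P[X 0%N] \is a fin_num)%E.
  by rewrite unlock; exact: integrable_fin_num (integrable_Y m2).
set mu := fine ('E_P[X 0%N])%E.
have m1 : ('E_P[X 0%N] = mu%:E)%E by rewrite fineK.
have [mu0|mu0] := eqVneq mu 0; first by rewrite m1 mu0.
exfalso; apply: local_variance_bounded => V.
have mu_gt0 : 0 < `|mu| by rewrite normr_gt0.
exists (Num.max 1 ((`|V| + s2) / `|mu|)) => r; rewrite ge_max => /andP[r1].
rewrite ler_pdivrMr// => hr.
have t0 : 0 < 2 * r by lra.
have := trunc_mean_dist t0 m1 m2; rewrite ler_pdivlMr// => h.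
have h2 : `|mu| <= `|mu - trunc_mean (X 0%N) (2 * r)| + `|trunc_mean (X 0%N) (2 * r)|.
  by apply: le_trans (ler_normD _ _); rewrite subrK.
have v0 : 0 <= trunc_sqr (X 0%N) (2 * r).
  by apply: fine_ge0; apply: integral_ge0 => w _; rewrite lee_fin /cut_sqr; case: ifP => // _; exact: sqr_ge0.
have h3 : 2 * r * `|mu| <= 2 * r * (`|mu - trunc_mean (X 0%N) (2 * r)| + `|trunc_mean (X 0%N) (2 * r)|).
  by rewrite ler_pM2l.
have := ler_norm V; have s20 : 0 <= s2 := le_trans (tail2_ge0 m2 0) (tail2_le m2 0).
have := normr_ge0 V.
rewrite mulrDr in h3; nra.
Qed.

Let s2_ge0 : 0 <= s2 := le_trans (tail2_ge0 m2 0) (tail2_le m2 0).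

Let sg2 : 0 < sigma ^+ 2. Proof. exact: exprn_gt0. Qed.

Lemma converse_variance_le : s2 <= sigma ^+ 2.
Proof.
have m1 := converse_mean_zero; have sg2' := sg2.
rewrite leNgt; apply/negP => lt.
have s20 : 0 < s2 by lra.
pose q := s2 / sigma ^+ 2.
have q1 : 1 < q by rewrite ltr_pdivlMr// mul1r.
have q0 : 0 < q by lra.
(* So small that q (1 - 40 e) = q - (40 / 128) (q - 1) is still above 1 + (q - 1) / 2. *)
pose e := (q - 1) / (128 * q).
have e0 : 0 < e by apply: divr_gt0; [rewrite subr_gt0|exact: mulr_gt0].
have e128 : e <= 128^-1.
  rewrite /e ler_pdivrMr; last exact: mulr_gt0.
  rewrite (_ : 128^-1 * (128 * q) = q); last by field.
  by rewrite gerBl.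
have [t0 ht0] : exists t0, forall t, t0 <= t -> tail2 (X 0%N) t <= e * s2 / 10.
  by apply: (tail2_cvg0 m2); rewrite divr_gt0// mulr_gt0.
have g0 : 0 < (q - 1) / 2 by lra.
have C0 : 0 < 24 * expR 1 :> R by rewrite mulr_gt0// expR_gt0.
apply: (not_uniformly_light ha hb test g0 C0) => A c A0 c0.
have up := small_ball_upper_asym hX m1 sg0 m2 s20 A0 ltr01.
have [N1 _ hN1] := up.
have [N2 _ hN2] := @near_quarter R t0.
have [N3 _ hN3] := near_loglogt e^-1.
exists (maxn N1 (maxn N2 N3)) => // n /=; rewrite !geq_max => /and3P[n1 /hN2[n2 _ _] /hN3 /= n3] y y0 /andP[_ hy].
have L1 := loglogt_ge1 (n%:R : R).
apply: (le_trans (hN1 n n1 y e y0 hy _ e128 (ht0 _ n2))).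
  rewrite ler_pdivrMr; last by lra.
  by rewrite -ler_pdivrMl// mulr1.
rewrite ler_wpM2l ?(ltW C0)// ler_expR lerN2 -/q.
have l0 : 0 <= (y ^+ 2)^-1 by rewrite invr_ge0 sqr_ge0.
rewrite [leRHS](_ : _ = (q * (1 - 40 * e)) * (y ^+ 2)^-1); last by ring.
rewrite ler_wpM2r//.
have -> : q * (1 - 40 * e) = q - 40 / 128 * (q - 1) by rewrite /e; field; rewrite gt_eqF.
lra.
Qed.

(* [s2 - t/2 + 40 (h - t) = s2 - T/4] at the extreme values [t = T] and
   [h = (1 + 1/160) T] of the tails at the large and the small scale. *)
Lemma heavy_of_exponent_gain (A c K : R) : 0 < A -> 0 < c -> 0 < K ->
  exists2 N0 : nat, True & forall (n : nat) (y D : R), (N0 <= n)%N -> 0 < y ->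
   c * loglogt (n%:R : R) <= (y ^+ 2)^-1 <= A * loglogt (n%:R : R) ->
   2 * K * expR 2 <= expR (c * loglogt (n%:R : R) * D) ->
   (forall u, u <= 64 * ball_radius sigma n y ->
     (sigma ^+ 2)^-1 * (s2 - tail2 (X 0%N) u / 2 +
       40 * (tail2 (X 0%N) (quarter n) - tail2 (X 0%N) u)) <= 1 - D) ->
   0 <= D -> K * expR (- (y ^+ 2)^-1) <= ball_prob X sigma n y.
Proof.
move=> A0 c0 K0; have m1 := converse_mean_zero.
have [N0 _ hN0] := small_ball_lower_asym hX m1 sg0 m2 A0.
exists N0 => // n y D n0 y0 /andP[h1 h2] hK hD D0.
have [u hu] := hN0 n n0 y y0 h2.
have {}hD := hD u hu.
set G := _ * (_ + _) in hD.
rewrite [_ * (_ + _)]mulrAC -/G => hG; apply: le_trans hG; clearbody G.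
set l := (y ^+ 2)^-1 in h1 *.
have l0 : 0 <= l by rewrite invr_ge0 sqr_ge0.
clearbody l.
have e1 : 0 < expR 2 :> R by exact: expR_gt0.
apply: (@le_trans _ _ (2^-1 * expR (- 2) * expR (c * loglogt (n%:R : R) * D) * expR (- l))).
  rewrite ler_wpM2r ?expR_ge0//.
  have -> : K = 2^-1 * expR (- 2) * (2 * K * expR 2).
    by rewrite expRN; field; rewrite gt_eqF.
  by rewrite ler_wpM2l// mulr_ge0 ?expR_ge0.
rewrite -[leLHS]mulrA ler_wpM2l ?mulr_ge0 ?expR_ge0//.
rewrite -expRD ler_expR.
have : c * loglogt (n%:R : R) * D <= l * D by rewrite ler_wpM2r.
have : G * l <= (1 - D) * l by rewrite ler_wpM2r.
lra.
Qed.

Lemma converse_variance_ge : sigma ^+ 2 <= s2.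
Proof.
have sg2' := sg2.
rewrite leNgt; apply/negP => lt.
apply: (not_heavy_blocks ha hb test) => A c K N0 A0 c0 K0.
have [N1 _ hN1] := heavy_of_exponent_gain A0 c0 K0.
pose D := (1 - s2 / sigma ^+ 2) / 2.
have D0 : 0 < D.
  have : s2 / sigma ^+ 2 < 1 by rewrite ltr_pdivrMr// mul1r.
  by rewrite /D; lra.
(* 40 times this tail is half of the gap between the variances; the other half is sigma^2 times the
   gain [D]. *)
have [t0 ht0] : exists t0, forall t, t0 <= t -> tail2 (X 0%N) t <= (sigma ^+ 2 - s2) / 80.
  by apply: (tail2_cvg0 m2); lra.
have [N2 _ hN2] := @near_quarter R t0.
have [N3 _ hN3] := near_loglogt (ln (2 * K * expR 2) / (c * D)).
exists (maxn N0 (maxn N1 (maxn N2 N3))); first exact: leq_maxl.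
move=> n /andP[/ltnW + _]; rewrite !geq_max => /and4P[_ n1 /hN2[n2 _ _] /hN3 /= n3] y y0 hy.
have K2 : 0 < 2 * K * expR 2 by rewrite !mulr_gt0// expR_gt0.
apply: (hN1 n y D n1 y0 hy); last exact: ltW.
  move: n3; rewrite ler_pdivrMr; last exact: mulr_gt0.
  rewrite -{2}(lnK K2) ler_expR.
  by rewrite (_ : _ * (c * D) = c * loglogt (n%:R : R) * D)//; ring.
move=> u _; have hq := ht0 _ n2; have u0 := tail2_ge0 m2 u.
rewrite -(ler_pM2l sg2) mulrA mulfV ?gt_eqF// mul1r.
have -> : sigma ^+ 2 * (1 - D) = (sigma ^+ 2 + s2) / 2 by rewrite /D; field; rewrite gt_eqF.
lra.
Qed.

(** Otherwise, along M_(j+1) = M_j^8, for which [quarter] of M_(j+1) is exactly M_j^2, the tail at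
    M_j^2 decays geometrically. Each step is three squarings and adds at most 3 to loglog, so loglog
    times the tail could not stay above 1. *)
Let scale_exists (N0 : nat) :
  (exists t0, forall t, t0 <= t -> 1 <= loglogt t * tail2 (X 0%N) t) ->
  exists2 N : nat, (N0 <= N)%N &
    tail2 (X 0%N) (quarter N) <= 161 / 160 * tail2 (X 0%N) ((N ^ 2)%:R).
Proof.
move=> [t0 ht0]; apply: contrapT => none.
have hN (N : nat) : (N0 <= N)%N ->
    161 / 160 * tail2 (X 0%N) ((N ^ 2)%:R) < tail2 (X 0%N) (quarter N).
  by move=> h; rewrite ltNge; apply/negP => h2; apply: none; exists N.
pose M0 := maxn N0 (Num.truncn `|t0|).+1.
have M01 : (0 < M0)%N by rewrite leq_max orbT.
have [M [M_0 MS]] : exists M : nat -> nat, M 0%N = M0 /\ forall j, M j.+1 = (M j ^ 8)%N.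
  by exists (fun j => iter j (fun n => n ^ 8)%N M0); split.
have MM j : (M0 <= M j)%N.
  elim: j => [|j IH]; first by rewrite M_0.
  rewrite MS; apply: (leq_trans IH).
  by rewrite -{1}(expn1 (M j)) leq_pexp2l// (leq_trans M01 IH).
pose f j := tail2 (X 0%N) ((M j ^ 2)%:R).
have f_dec j : (161 / 160) ^+ j * f j <= s2.
  elim: j => [|j IH]; first by rewrite expr0 mul1r; exact: tail2_le.
  apply: le_trans IH; rewrite exprS -mulrA mulrCA ler_wpM2l ?exprn_ge0//.
  have Mj0 : (0 < M j)%N := leq_trans M01 (MM j).
  have Mr0 : 0 < (M j)%:R :> R by rewrite ltr0n.
  have -> : f j = tail2 (X 0%N) (quarter (M j.+1)).
    rewrite /f; congr (tail2 _ _); rewrite MS /quarter !natrX (lnXn 8)//.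
    rewrite -[LHS]lnK ?posrE ?exprn_gt0// lnXn//; congr expR.
    by rewrite -[_ *+ 2]mulr_natr -[_ *+ 8]mulr_natr; field.
  by apply/ltW/hN; apply: leq_trans (MM _); exact: leq_maxl.
have L_lin j : loglogt ((M j ^ 2)%:R : R) <= loglogt ((M0 ^ 2)%:R : R) + 3 * j%:R.
  elim: j => [|j IH]; first by rewrite M_0 mulr0 addr0.
  have -> : (M j.+1 ^ 2 = (((M j ^ 2) ^ 2) ^ 2) ^ 2)%N by rewrite MS -!expnM.
  apply: (le_trans (loglogt_sqr_le _)); have := @loglogt_sqr_le R ((M j ^ 2) ^ 2).
  have := @loglogt_sqr_le R (M j ^ 2).
  rewrite (_ : j.+1%:R = j%:R + 1 :> R); last by rewrite natr1.
  lra.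
have f_low j : 1 <= loglogt ((M j ^ 2)%:R : R) * f j.
  apply: ht0; apply: (@le_trans _ _ (M0%:R)).
    apply: (@le_trans _ _ ((Num.truncn `|t0|).+1%:R)).
      by apply: (le_trans (ler_norm _)); exact/ltW/truncnS_gt.
    by rewrite ler_nat leq_maxr.
  rewrite ler_nat (leq_trans (MM j))// -{1}(expn1 (M j)) leq_pexp2l//.
  exact: leq_trans M01 (MM j).
set L0 := loglogt ((M0 ^ 2)%:R : R) in L_lin.
have rho1 : 1 < 161 / 160 :> R by lra.
have [j] := geometric_gt_linear ((L0 + 3) * s2) rho1.
apply/negP; rewrite -leNgt.
have f0 : 0 <= f j := tail2_ge0 m2 _.
have r0 : 0 <= (161 / 160) ^+ j :> R by apply: exprn_ge0; lra.
have L1 : 1 <= L0 by exact: loglogt_ge1.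
have h1 := f_low j; have h2 := f_dec j; have h3 := L_lin j.
move: (loglogt _) h1 h3 => Lj h1 h3.
have Lj0 : 0 <= Lj by nra.
have j0 : 0 <= j%:R :> R by [].
have -> : (L0 + 3) * s2 * j.+1%:R = ((L0 + 3) * (j%:R + 1)) * s2 by rewrite natr1; ring.
apply: (@le_trans _ _ (Lj * s2)); last first.
  apply: ler_wpM2r; first exact: s2_ge0.
  nra.
apply: (@le_trans _ _ (Lj * ((161 / 160) ^+ j * f j))); last by rewrite ler_wpM2l.
rewrite mulrCA; rewrite -[leLHS]mulr1; apply: ler_wpM2l => //.
Qed.

Lemma converse_tail : s2 = sigma ^+ 2 ->
  ~ (forall M, exists t0, forall t, t0 <= t -> M <= loglogt t * tail2 (X 0%N) t).
Proof.
move=> s2E large; have sg2' := sg2; have k0 := kappa0.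
apply: (not_heavy_blocks ha hb test) => A c K N0 A0 c0 K0.
have [N1 _ hN1] := heavy_of_exponent_gain A0 c0 K0.
have K2 : 0 < 2 * K * expR 2 by rewrite !mulr_gt0// expR_gt0.
(* With the gain D = t / (4 sigma^2), a tail t with loglog (N^2) t >= M gives c loglog n D >= ln (2
   K exp 2), since loglog (N^2) <= 2 loglog n on the block. *)
pose M := 8 * sigma ^+ 2 / c * ln (2 * K * expR 2).
have [t0 ht0] := large M.
(* 4096 = 64^2: with N >= N3, 64 radii are at most N^2 throughout the block, so the tail at the
   scale [u] is at least the tail at N^2. *)
pose N2 := (Num.truncn `|t0|).+1; pose N3 := (Num.truncn (4096 * kappa / c)).+1.
have [N + hT] := scale_exists (maxn N0 (maxn N1 (maxn N2 N3))) (large 1).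
rewrite !geq_max => /and4P[NN0 NN1 NN2 NN3].
have N_gt0 : (0 < N)%N by exact: leq_trans NN2.
have Nsq : (N <= N ^ 2)%N by rewrite -{1}(expn1 N) leq_pexp2l.
exists N => // n /andP[Nn nN] y y0 hy.
set t := tail2 _ ((N ^ 2)%:R) in hT.
have tM : M <= loglogt ((N ^ 2)%:R : R) * t.
  apply: ht0; apply: (@le_trans _ _ (N2%:R)).
    by apply: (le_trans (ler_norm _)); exact/ltW/truncnS_gt.
  by rewrite ler_nat (leq_trans NN2).
have t0' : 0 <= t := tail2_ge0 m2 _.
have tq : tail2 (X 0%N) (quarter n) <= 161 / 160 * t.
  apply: le_trans hT; apply: (tail2_anti m2); rewrite /quarter ler_expR ler_wpM2r// ler_ln ?posrE ?ltr0n//.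
    by rewrite ler_nat ltnW.
  exact: ltn_trans Nn.
have L1 := loglogt_ge1 (n%:R : R).
have LN : loglogt ((N ^ 2)%:R : R) <= 2 * loglogt (n%:R : R).
  have : loglogt (N%:R : R) <= loglogt (n%:R : R) by rewrite ler_loglogt// ler_nat ltnW.
  by have := @loglogt_sqr_le R N; lra.
have D0 : 0 <= t / (4 * sigma ^+ 2) by rewrite divr_ge0// mulr_ge0// ltW.
apply: (hN1 n y (t / (4 * sigma ^+ 2)) (leq_trans NN1 (ltnW Nn)) y0 hy _ _ D0).
  rewrite -[leLHS]lnK// ler_expR.
  have -> : c * loglogt (n%:R : R) * (t / (4 * sigma ^+ 2)) =
     c / (8 * sigma ^+ 2) * (2 * loglogt (n%:R : R) * t) by field; rewrite gt_eqF.
  have -> : ln (2 * K * expR 2) = c / (8 * sigma ^+ 2) * M.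
    by rewrite /M; field; rewrite !gt_eqF.
  have hc : 0 <= c / (8 * sigma ^+ 2) by rewrite divr_ge0 ?(ltW c0)// mulr_ge0// ltW.
  apply: ler_wpM2l => //; apply: (le_trans tM); exact: ler_wpM2r.
move=> u hu.
have ut : t <= tail2 (X 0%N) u.
  apply: (tail2_anti m2); apply: (le_trans hu).
  have r0 := ball_radius_ge0 sigma n (ltW y0).
  suff : (64 * ball_radius sigma n y) ^+ 2 <= ((N ^ 2)%:R : R) ^+ 2.
    have r64 : 0 <= 64 * ball_radius sigma n y by apply: mulr_ge0.
    by rewrite ler_sqr ?nnegrE.
  rewrite [leLHS]exprMn ball_radius_sqr.
  have y2 : y ^+ 2 <= c^-1.
    rewrite -[leLHS]invrK lef_pV2 ?posrE ?invr_gt0 ?exprn_gt0//.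
    case/andP: hy => hy _; apply: le_trans hy; rewrite -[leLHS]mulr1.
    by apply: ler_wpM2l => //; exact: ltW.
  have nN' : n%:R <= N%:R ^+ 2 :> R by rewrite -natrX ler_nat.
  have N3' : 4096 * kappa / c <= N%:R.
    by apply: (@le_trans _ _ N3%:R); [exact/ltW/truncnS_gt|rewrite ler_nat].
  have N1' : 1 <= N%:R :> R by rewrite ler1n.
  rewrite natrX.
  apply: (@le_trans _ _ (64 ^+ 2 * (kappa * N%:R ^+ 2 * c^-1))).
    apply: ler_wpM2l; first exact: sqr_ge0.
    apply: ler_pM => //; first by rewrite mulr_ge0// ltW.
      exact: sqr_ge0.
    by rewrite ler_pM2l.
  have -> : 64 ^+ 2 * (kappa * N%:R ^+ 2 * c^-1) = N%:R ^+ 2 * (4096 * kappa / c) by ring.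
  rewrite [leRHS]expr2; apply: ler_wpM2l; first exact: sqr_ge0.
  by apply: (le_trans N3'); rewrite expr2 ler_peMl//; lra.
rewrite -(ler_pM2l sg2) mulrA mulfV ?gt_eqF// mul1r.
have -> : sigma ^+ 2 * (1 - t / (4 * sigma ^+ 2)) = sigma ^+ 2 - t / 4 by field; rewrite gt_eqF.
lra.
Qed.

End converse.

Lemma lt_limf_einf_pinfty (R : realType) (f : R -> \bar R) (M : R) :
  (M%:E < limf_einf f +oo_R)%E -> exists t0 : R, forall t, t0 <= t -> (M%:E <= f t)%E.
Proof.
rewrite limf_einfE => /ereal_sup_gt[_ [V [m [_ hm]] <-] hV].
exists (m + 1) => t mt; apply: (le_trans (ltW hV)).
by apply: ereal_inf_lbound; exists t => //; apply: hm; lra.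
Qed.

Theorem theorem1p3 (d : measure_display) (T : measurableType d) (R : realType)
    (P : probability T R) (X : nat -> {RV P >-> R}) (hX : iid X) :
  (forall a b sigma : R, -1 < a -> -1 < b -> 0 < sigma ->
     'E_P[X 0%N]%E = 0%E ->
     'E_P[(fun w => X 0%N w ^+ 2)%R]%E = (sigma ^+ 2)%:E ->
     (exists2 C : R, 0 < C & \forall t \near +oo_R,
        (trunc_moment2 (X 0%N) t <= (C * (loglogt t)^-1)%:E)%E) ->
     forall psi : R -> R, positive_on_ge1 psi -> eventually_nonincreasing psi ->
       integral_test X sigma a b psi)
  /\
  (forall sigma : R,
     (exists a b : R, [/\ -1 < a, -1 < b, 0 < sigma &
        forall psi : R -> R, positive_on_ge1 psi ->
          eventually_nonincreasing psi -> integral_test X sigma a b psi]) ->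
     [/\ 'E_P[X 0%N]%E = 0%E,
         'E_P[(fun w => X 0%N w ^+ 2)%R]%E = (sigma ^+ 2)%:E &
         (limf_einf (fun t : R => (loglogt t)%:E * trunc_moment2 (X 0%N) t)%E
            (+oo_R) < +oo)%E]).
Proof.
split=> [a b sigma ha hb sg0 m1 m2 [C C0 tail] psi psi0 _|sigma [a [b [ha hb sg0 test]]]].
  exact: (direct_part hX a b sg0 C0 m1 m2 tail).
have [s2 m2] := converse_second_moment_finite hX ha hb sg0 test.
have m1 := converse_mean_zero hX ha hb sg0 test m2.
have s2E : s2 = sigma ^+ 2.
  apply/le_anti; rewrite (converse_variance_le hX ha hb sg0 test m2).
  exact: (converse_variance_ge hX ha hb sg0 test m2).
split=> //; first by rewrite m2 s2E.
apply: contrapT => /negP h.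
have {h} lim : limf_einf (fun t : R => ((loglogt t)%:E * trunc_moment2 (X 0%N) t)%E) +oo_R = +oo%E.
  by apply/eqP; rewrite -leye_eq leNgt.
apply: (converse_tail hX ha hb sg0 test m2 s2E) => M.
have [|t0 ht0] := @lt_limf_einf_pinfty R (fun t => (loglogt t)%:E * trunc_moment2 (X 0%N) t)%E M.
  by rewrite lim ltry.
by exists t0 => t /ht0; rewrite (tail2E m2) -EFinM lee_fin.
Qed.
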